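(* Let $B_*$ be a smooth planar vector field on $\overline\omega$ with $\nabla\times B_*=F_*$, and assume that $j\in\mathcal{Z}$ is a global minimizer of $I_\infty(\cdot\,;F_* )$. Then $j=B_*-\frac1a\nabla^\perp\zeta$, where $\zeta\in H^1_0(\omega)$ solves the minimization problem $$\min_{\xi\in H^1_0(\omega),\ |\xi|\le a(x)/2}\mathcal{E}_\infty(\xi),\qquad \mathcal{E}_\infty(\xi)=\int_\omega\Big[\frac{1}{2a(x)}|\nabla\xi|^2-F_*\,\xi\Big]dx .$$
   Context: $\omega\subset\mathbb{R}^2$ is a bounded regular (smooth) domain, $f,g$ are smooth functions on $\overline\omega$ with $f<g$ on $\overline\omega$, $a=g-f$, and $H=(H_1,H_2,H_3)\in\mathbb{R}^3$ is a constant vector. The effective field is $$F_*(x)=H_3-(H_1,H_2)\cdot\nabla\Big(\frac{f(x)+g(x)}{2}\Big),\quad x\in\omega .$$ For planar fields, $\nabla\times B=\partial_1B_2-\partial_2B_1$ (in the sense of distributions), and $\nabla^\perp\zeta=(\partial_2\zeta,-\partial_1\zeta)$. $\mathfrak{M}(\omega)$ is the space of Radon measures on $\omega$ with finite total variation, and $\|\cdot\|_{\mathfrak{M}(\omega)}$ is the total variation. Let $\Omega=\{(x',x_3): x'\in\omega,\ f(x')<x_3<g(x')\}$ and $$\mathcal{Z}=\{j\in L^2(\Omega;\mathbb{R}^3):\ j=(j'(x'),0),\ \tfrac12\nabla\times j\in\mathfrak{M}(\Omega;\mathbb{R}^3)\};$$ elements of $\mathcal{Z}$ are identified with planar fields $j=j'$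 on $\omega$. For $j\in\mathcal{Z}$, $$I_\infty(j;F_* )=\frac12\|a\,\nabla\times j\|_{\mathfrak{M}(\omega)}+\frac12\int_\omega a(x)|j-B_*|^2\,dx,$$ where $B_*$ is the chosen field with $\nabla\times B_*=F_*$; $I_\infty=+\infty$ outside $\mathcal{Z}$. *)

(* Defs.v *)
From HB Require Import structures.
From mathcomp Require Import all_boot all_order all_algebra.
From mathcomp Require Import all_classical all_reals all_analysis.

Set Implicit Arguments.
Unset Strict Implicit.
Unset Printing Implicit Defensive.

Import Order.TTheory GRing.Theory Num.Theory.
Import numFieldNormedType.Exports.

Local Open Scope classical_set_scope.
Local Open Scope ring_scope.

(* The plane and space with their Borel sigma-algebras, as carriers of measures.
   As plain types they are convertible to R * R and R * R * R. *)
Notation mplane R := (measurableTypeR R * measurableTypeR R)%type.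
Notation mspace R := (mplane R * measurableTypeR R)%type.

(* The plane is R * R and space is (R * R) * R, so that a point of space is
   (x', x3) with x' in the plane.  The library norms on these products are
   sup norms, equivalent to the Euclidean ones; wherever Euclidean lengths
   matter, normsq is used. *)
Section Coordinates.
Context {R : realType}.

Definition e1 : R * R := (1, 0).
Definition e2 : R * R := (0, 1).
Definition i1 : R * R * R := (e1, 0).
Definition i2 : R * R * R := (e2, 0).
Definition i3 : R * R * R := (0, 1).

Definition normsq (v : R * R) : R := v.1 ^+ 2 + v.2 ^+ 2.

Definition perp (v : R * R) : R * R := (v.2, - v.1).

Definition grad (f : R * R -> R) (x : R * R) : R * R := ('D_e1 f x, 'D_e2 f x).

Definition leb2 : set (mplane R) -> \bar R :=
  (@lebesgue_measure R \x @lebesgue_measure R)%E.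

HB.instance Definition _ := Measure.on leb2.

Definition leb3 : set (mspace R) -> \bar R := (leb2 \x @lebesgue_measure R)%E.

HB.instance Definition _ := Measure.on leb3.

End Coordinates.

Section Smoothness.
Context {R : realType}.

(* C^n in terms of iterated directional derivatives; for finite-dimensional V
   this is the usual class of n times continuously differentiable functions. *)
Fixpoint Cn (V : normedModType R) (n : nat) (f : V -> R) : Prop :=
  continuous f /\
  if n is m.+1 then
    forall v : V, (forall x, derivable f x v) /\ Cn m ('D_v f)
  else True.

Definition smooth (V : normedModType R) (f : V -> R) : Prop :=
  forall n, Cn n f.

Definition testfun (V : normedModType R) (W : set V) : set (V -> R) :=
  [set phi | smooth phi /\
     exists K, [/\ compact K, K `<=` W & forall x, ~ K x -> phi x = 0]].

(* C^oo(closure W): restrictions to closure W of smooth functions. *)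
Definition smooth_on_closure (V : normedModType R) (W : set V) (f : V -> R) :=
  exists2 F : V -> R, smooth F & forall x, closure W x -> f x = F x.

(* Near each boundary point, and after possibly swapping the coordinates and
   reversing the second one, w is the strict epigraph of a smooth function. *)
Definition smooth_boundary (w : set (R * R)) : Prop :=
  forall p, (closure w `\` interior w) p ->
  exists (r : R) (gam : R -> R) (swap flip : bool),
    [/\ 0 < r, @smooth R^o gam &
     forall x : R * R, ball p r x ->
       let s := if swap then x.2 else x.1 in
       let t := if swap then x.1 else x.2 in
       w x <-> gam s < (if flip then - t else t)].

Definition smooth_bounded_domain (w : set (R * R)) : Prop :=
  [/\ open w, connected w, w !=set0, bounded_set w & smooth_boundary w].

End Smoothness.

Section Measures.
Context {R : realType} d (T : measurableType d).

Definition L2 (mu : set T -> \bar R) (D : set T) (f : T -> R) : Prop :=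
  measurable_fun D f /\ (\int[mu]_(x in D) ((f x) ^+ 2)%:E < +oo)%E.

Variable nu : {charge set T -> \bar R}.

Definition hahn_pos : set T := sval (cid (Hahn_decomposition nu)).
Definition hahn_neg : set T := sval (cid (svalP (cid (Hahn_decomposition nu)))).
Definition hahnPN : hahn_decomposition nu hahn_pos hahn_neg :=
  svalP (cid (svalP (cid (Hahn_decomposition nu)))).

Definition charge_total_variation : set T -> \bar R := charge_variation hahnPN.

Definition charge_integral (D : set T) (phi : T -> R) : R :=
  \int[jordan_pos hahnPN]_(x in D) phi x -
  \int[jordan_neg hahnPN]_(x in D) phi x.

End Measures.

(* A distribution on W is given by its values L phi on test functions.  A
   finite signed Radon measure on W is the restriction to W of a charge (finite
   Borel signed measure) on the whole space. *)
Section RadonMeasures.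
Context {R : realType} d (T : measurableType d).

Definition represents (W : set T) (test : set (T -> R)) (L : (T -> R) -> R)
    (nu : {charge set T -> \bar R}) : Prop :=
  forall phi, test phi -> L phi = charge_integral nu W phi.

Definition is_Radon (W : set T) (test : set (T -> R)) (L : (T -> R) -> R) :=
  exists nu : {charge set T -> \bar R}, represents W test L nu.

(* The representing measure is unique on W, so the infimum is over a set with
   at most one element; it is +oo when L is not a finite measure. *)
Definition Radon_norm (W : set T) (test : set (T -> R)) (L : (T -> R) -> R)
    : \bar R :=
  ereal_inf [set charge_total_variation nu W | nu in represents W test L].

End RadonMeasures.

Section Sobolev.
Context {R : realType}.
Variable w : set (R * R).

Definition weak_grad (u : R * R -> R) (G : R * R -> R * R) : Prop :=
  forall phi, testfun w phi ->
    (\int[leb2]_(x in w) (u x * 'D_e1 phi x) =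
      - \int[leb2]_(x in w) ((G x).1 * phi x)) /\
    (\int[leb2]_(x in w) (u x * 'D_e2 phi x) =
      - \int[leb2]_(x in w) ((G x).2 * phi x)).

(* u belongs to H^1(w), with gradient G. *)
Definition in_H1 (u : R * R -> R) (G : R * R -> R * R) : Prop :=
  [/\ L2 leb2 w u, L2 leb2 w (fun x => (G x).1), L2 leb2 w (fun x => (G x).2)
    & weak_grad u G].

(* u belongs to H^1_0(w), the closure of the test functions in H^1(w), with
   gradient G. *)
Definition in_H10 (u : R * R -> R) (G : R * R -> R * R) : Prop :=
  in_H1 u G /\
  exists phi : nat -> R * R -> R, (forall n, testfun w (phi n)) /\
    (\int[leb2]_(x in w)
       ((phi n x - u x) ^+ 2 + normsq (grad (phi n) x - G x))%:E
     @[n --> \oo] --> 0)%E.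

End Sobolev.

Section Curl.
Context {R : realType}.

Definition curl2 (w : set (R * R)) (B : R * R -> R * R) (phi : R * R -> R) : R :=
  \int[leb2]_(x in w) ((B x).1 * 'D_e2 phi x - (B x).2 * 'D_e1 phi x).

Section Curl3.
Variables (W : set (R * R * R)) (k : R * R * R -> R * R * R).
Implicit Type phi : R * R * R -> R.

Definition curl3_1 phi : R :=
  \int[leb3]_(y in W) ((k y).1.2 * 'D_i3 phi y - (k y).2 * 'D_i2 phi y).
Definition curl3_2 phi : R :=
  \int[leb3]_(y in W) ((k y).2 * 'D_i1 phi y - (k y).1.1 * 'D_i3 phi y).
Definition curl3_3 phi : R :=
  \int[leb3]_(y in W) ((k y).1.1 * 'D_i2 phi y - (k y).1.2 * 'D_i1 phi y).

End Curl3.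
End Curl.

Section Model.
Context {R : realType}.
Variables (w : set (R * R)) (f g : R * R -> R).

Definition thickness (x : R * R) : R := g x - f x.

Definition Omega : set (R * R * R) :=
  [set y | w y.1 /\ f y.1 < y.2 < g y.1].

Definition effective_field (H1 H2 H3 : R) (x : R * R) : R :=
  let m := fun z => (f z + g z) / 2 in
  H3 - (H1 * 'D_e1 m x + H2 * 'D_e2 m x).

Definition planar_lift (j : R * R -> R * R) (y : R * R * R) : R * R * R := (j y.1, 0).

(* The space Z, whose elements are identified with planar fields. *)
Definition Zspace : set (R * R -> R * R) :=
  [set j | let k := planar_lift j in
    [/\ L2 leb3 Omega (fun y => (k y).1.1),
        L2 leb3 Omega (fun y => (k y).1.2)
      & L2 leb3 Omega (fun y => (k y).2)] /\
    [/\ @is_Radon R _ (mspace R) Omega (testfun Omega)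
          (fun phi => 2^-1 * curl3_1 Omega k phi),
        @is_Radon R _ (mspace R) Omega (testfun Omega)
          (fun phi => 2^-1 * curl3_2 Omega k phi)
      & @is_Radon R _ (mspace R) Omega (testfun Omega)
          (fun phi => 2^-1 * curl3_3 Omega k phi)]].

(* The product of the smooth function a and the distribution curl j is the
   distribution phi |-> <curl j, a phi>. *)
Definition Iinfty (B j : R * R -> R * R) : \bar R :=
  if `[< Zspace j >] then
    ((2^-1)%:E * @Radon_norm R _ (mplane R) w (testfun w)
                   (fun phi => curl2 w j (fun x => (thickness x * phi x)%R)) +
     (2^-1)%:E * \int[leb2]_(x in w) (thickness x * normsq (j x - B x))%:E)%E
  else +oo%E.

Definition Einfty (F xi : R * R -> R) (G : R * R -> R * R) : R :=
  \int[leb2]_(x in w) (normsq (G x) / (2 * thickness x) - F x * xi x).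

(* xi (with gradient G) belongs to H^1_0(w) and |xi| <= a / 2. *)
Definition admissible (xi : R * R -> R) (G : R * R -> R * R) : Prop :=
  in_H10 w xi G /\ {ae leb2, forall x, w x -> `|xi x| <= thickness x / 2}.

End Model.

(* Main.v *)
From HB Require Import structures.
Require Import Defs.
From mathcomp Require Import all_boot all_order all_algebra.
From mathcomp Require Import all_classical all_reals all_analysis.
From mathcomp Require Import measurable_realfun ring lra.

(** Write a = g - f and v = a (B - j), let N be the norm of the measure a curl j,
    and let perp (p, q) = (q, - p).  The claim is that v = perp (grad zeta) for
    some zeta in H^1_0, that |zeta| <= a / 2, and that zeta minimizes the energy;
    this is convex duality, carried out by hand.

    Minimality is used only against the fields s j + k with s >= 0 and k a square
    integrable planar field whose curl is a square integrable function h.  They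
    are competitors ([Zspace_perturb]), and the norm of a curl (s j + k) is at
    most s N plus the integral of a |h| ([Radon_norm_perturb]).  The resulting
    inequality ([minimizer_inequalities]) has two first-order consequences: the
    integral of v . k is at most half of the integral of a |h|
    ([first_variation], with s = 1), and the integral of v . j is N / 2
    ([scaling_variation], with k = 0 and s on both sides of 1).

    Existence of zeta ([potential]).  By the Riesz representation theorem in
    H^1_0 ([dirichlet_solution]) there is a zeta such that
    q = v - perp (grad zeta) is curl-free.  The first variation with k = q and
    h = 0 shows that the integral of v . q is nonpositive, and q is orthogonal
    to perp (grad zeta), so q = 0.

    The bound on zeta ([potential_bound]).  Let h be the difference of zeta and
    its projection onto [- a / 2, a / 2], and k a field with curl h, again given
    by the Dirichlet problem.  The integral of v . k is that of h zeta, hence at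
    most half of that of a |h|; but h zeta - a |h| / 2 = h^2, so h = 0.

    Minimality of zeta ([energy_ge], [potential_minimizer]).  By Young's
    inequality the energy of an admissible xi is at least minus half of the
    integral of a |B - j|^2 minus the integral of j . perp (grad xi), with
    equality for zeta.  The last integral is the pairing of curl j with xi; it is
    N / 2 for zeta, and at most N / 2 for every xi with |xi| <= a / 2
    ([curl_pairing]).  The last point needs care, since xi is neither smooth nor
    continuous: it is approximated by test functions in H^1_0, whose quotients
    by a are truncated smoothly just above the level 1 / 2, and the truncated
    functions are controlled in the limit by dominated convergence. *)

Set Implicit Arguments.
Unset Strict Implicit.
Unset Printing Implicit Defensive.
Import Order.TTheory GRing.Theory Num.Theory.
Import numFieldNormedType.Exports.
Local Open Scope classical_set_scope.
Local Open Scope ring_scope.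

(** * Smooth functions and test functions *)

Section CnCalculus.
Context {R : realType} {V : normedModType R}.
Implicit Types (f g : V -> R) (n : nat).

Lemma Cn_continuous n f : Cn n f -> continuous f.
Proof. by case: n => [|n] []. Qed.

Lemma CnS n f : Cn n.+1 f -> Cn n f.
Proof.
elim: n f => [|n IH] f; first by case.
move=> [cf df]; split=> // v; have [dfv Cdf] := df v.
by split=> //; exact: IH.
Qed.

Lemma Cn_cst n (c : R) : Cn n (cst c : V -> R).
Proof.
elim: n c => [|n IH] c; first by split=> //; exact: cst_continuous.
split; first exact: cst_continuous.
move=> v; split; first by move=> x; exact: derivable_cst.
rewrite (_ : 'D_v _ = cst 0) //; apply/funext => x; exact: derive_cst.
Qed.

Lemma CnD n f g : Cn n f -> Cn n g -> Cn n (fun x => f x + g x).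
Proof.
elim: n f g => [|n IH] f g [cf df] [cg dg].
  by split=> // x; apply: cvgD; [exact: cf|exact: cg].
split; first by move=> x; apply: cvgD; [exact: cf|exact: cg].
move=> v; have [df1 df2] := df v; have [dg1 dg2] := dg v.
split; first by move=> x; exact: derivableD.
rewrite (_ : 'D_v _ = fun x => 'D_v f x + 'D_v g x); first exact: IH.
by apply/funext => x; rewrite -deriveD.
Qed.

Lemma CnM n f g : Cn n f -> Cn n g -> Cn n (fun x => f x * g x).
Proof.
elim: n f g => [|n IH] f g.
  by move=> [cf _] [cg _]; split=> // x; apply: cvgM; [exact: cf|exact: cg].
move=> hf hg; have [cf df] := hf; have [cg dg] := hg.
split; first by move=> x; apply: cvgM; [exact: cf|exact: cg].
move=> v; have [df1 df2] := df v; have [dg1 dg2] := dg v.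
split; first by move=> x; exact: derivableM.
rewrite (_ : 'D_v _ = fun x => f x * 'D_v g x + g x * 'D_v f x); last first.
  by apply/funext => x; rewrite -deriveM.
by apply: CnD; apply: IH => //; exact: CnS.
Qed.

Lemma smooth_continuous f : smooth f -> continuous f.
Proof. by move=> /(_ 0%N); exact: Cn_continuous. Qed.

Lemma smooth_derivable f (sf : smooth f) v x : derivable f x v.
Proof. by have [_ /(_ v)[]] := sf 1%N. Qed.

Lemma smooth_derive f v : smooth f -> smooth ('D_v f).
Proof. by move=> sf n; have [_ /(_ v)[]] := sf n.+1. Qed.

Lemma smooth_cst (c : R) : smooth (cst c : V -> R).
Proof. by move=> n; exact: Cn_cst. Qed.

Lemma smoothD f g : smooth f -> smooth g -> smooth (fun x => f x + g x).
Proof. by move=> sf sg n; exact: CnD. Qed.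

Lemma smoothM f g : smooth f -> smooth g -> smooth (fun x => f x * g x).
Proof. by move=> sf sg n; exact: CnM. Qed.

Lemma smoothZ (c : R) f : smooth f -> smooth (fun x => c * f x).
Proof. by apply: (@smoothM (cst c)); exact: smooth_cst. Qed.

Lemma smoothB f g : smooth f -> smooth g -> smooth (fun x => f x - g x).
Proof.
move=> sf sg; rewrite (_ : (fun x => _) = fun x => f x + (-1) * g x).
  by apply: smoothD => //; exact: smoothZ.
by apply/funext => x; rewrite mulN1r.
Qed.

(** Off the support all directional derivatives vanish, the support being
    closed. *)
Lemma derive_off_compact (K : set V) f v x : compact K ->
  (forall y, ~ K y -> f y = 0) -> ~ K x -> 'D_v f x = 0.
Proof.
move=> cK f0 Kx.
rewrite (@near_eq_derive _ _ _ f (cst 0)) ?derive_cst//.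
have oK : open (~` K) by apply: closed_openC; exact: compact_closed.
by near=> y; apply: f0; near: y; exact: open_nbhs_nbhs.
Unshelve. all: by end_near. Qed.

Variable W : set V.
Local Notation test := (@testfun R V W).

Lemma testfun_derive f v : test f -> test ('D_v f).
Proof.
move=> [sf [K [cK KW f0]]]; split; first exact: smooth_derive.
by exists K; split=> // x; exact: derive_off_compact.
Qed.

Lemma testfunD f g : test f -> test g -> test (fun x => f x + g x).
Proof.
move=> [sf [K [cK KW f0]]] [sg [L [cL LW g0]]]; split; first exact: smoothD.
exists (K `|` L); split; first exact: compactU.
  by move=> x [/KW|/LW].
by move=> x /not_orP[/f0 -> /g0 ->]; rewrite addr0.
Qed.

(** The product of a test function with a function that agrees on [W] with a
    smooth one. *)
Lemma testfunM_on f g h : smooth g -> (forall x, W x -> h x = g x) ->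
  test f -> test (fun x => h x * f x).
Proof.
move=> sg hgW [sf [K [cK KW f0]]].
rewrite (_ : (fun x => _) = fun x => g x * f x); last first.
  apply/funext => x; have [/KW Wx|Kx] := pselect (K x); first by rewrite hgW.
  by rewrite f0// !mulr0.
split; first exact: smoothM.
by exists K; split=> // x Kx; rewrite f0// mulr0.
Qed.

Lemma testfunM f g : smooth g -> test f -> test (fun x => g x * f x).
Proof. by move=> sg; exact: (testfunM_on sg). Qed.

Lemma testfunZ (c : R) f : test f -> test (fun x => c * f x).
Proof. by apply: testfunM; exact: smooth_cst. Qed.

Lemma testfun0 : test (cst 0).
Proof.
split; first exact: smooth_cst.
by exists set0; split=> //; exact: compact0.
Qed.

Lemma testfun_off f x : test f -> ~ W x -> f x = 0.
Proof. by move=> [_ [K [_ KW f0]]] Wx; apply: f0 => /KW. Qed.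

Lemma testfun_derivable f v x : test f -> derivable f x v.
Proof. by move=> [sf _]; exact: smooth_derivable. Qed.

Lemma testfun_continuous f : test f -> continuous f.
Proof. by move=> [sf _]; exact: smooth_continuous. Qed.

Lemma testfun_bounded f : test f -> exists M : R, 0 < M /\ forall x, `|f x| <= M.
Proof.
move=> [sf [K [cK KW f0]]].
have cfK : compact (f @` K).
  apply: continuous_compact => //; apply: continuous_subspaceT.
  exact: smooth_continuous.
have [M [_ HM]] := compact_bounded cfK.
exists (`|M| + 1); split; first by rewrite ltr_pwDr.
move=> x; have [Kx|Kx] := pselect (K x).
  by apply: (HM (`|M| + 1)); [rewrite ltr_pwDr// ler_norm|exists x].
by rewrite f0// normr0 addr_ge0.
Qed.

(** Division of a test function by a smooth function without zeros on [W]. *)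
Lemma testfun_div f b h : open W -> smooth b -> (forall x, W x -> b x != 0) ->
  (forall x, W x -> h x = b x) -> test f -> test (fun x => f x / h x).
Proof.
move=> oW sb b0 hb tf.
have [sf [K [cK KW f0]]] := tf.
rewrite (_ : (fun x => _) = fun x => f x / b x); last first.
  apply/funext => x; have [/KW Wx|Kx] := pselect (K x); first by rewrite hb.
  by rewrite f0// !mul0r.
split; last by exists K; split=> // x Kx; rewrite f0// mul0r.
clear h hb => n; elim: n f b sb b0 tf sf f0 => [|n IH] f b sb b0 tf sf f0.
  split=> // x; have [Kx|Kx] := pselect (K x).
    apply: cvgM; first exact: smooth_continuous.
    by apply: cvgV; [exact/b0/KW|exact: smooth_continuous].
  rewrite /continuous_at f0// mul0r; apply: cvg_near_cst.
  have oK : open (~` K) by apply: closed_openC; exact: compact_closed.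
  near=> y; rewrite f0 ?mul0r//; near: y; exact: open_nbhs_nbhs.
split; first by apply: (@Cn_continuous n); exact: IH.
move=> v.
pose p x := 'D_v f x * b x - f x * 'D_v b x.
have E x : is_derive x v (fun y => f y / b y) (p x / (b x * b x)).
  have [Kx|Kx] := pselect (K x).
    have bx := b0 _ (KW _ Kx).
    have db : derivable b x v by exact: smooth_derivable.
    have df : derivable f x v by exact: smooth_derivable.
    apply: is_derive_eq.
      apply: is_deriveM; first exact: derivableP.
      apply: DeriveDef; first exact: derivableV.
      exact: deriveV.
    rewrite /p /GRing.scale/=; field.
    by rewrite bx.
  rewrite /p (derive_off_compact _ cK f0)// f0// !mul0r subrr mul0r.
  apply: (@near_eq_is_derive _ _ _ (cst (0 : R))).
  have oK : open (~` K) by apply: closed_openC; exact: compact_closed.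
  near=> y; rewrite /cst f0 ?mul0r//; near: y; exact: open_nbhs_nbhs.
split; first by move=> x; exact: ex_derive.
rewrite (_ : 'D_v _ = fun x => p x / (b x * b x)); last first.
  by apply/funext => x; exact: derive_val.
have sp : smooth p.
  by apply: smoothB; apply: smoothM => //; exact: smooth_derive.
have p0 x : ~ K x -> p x = 0.
  by move=> Kx; rewrite /p (derive_off_compact _ cK f0)// f0// !mul0r subrr.
apply: (IH p) => //.
- exact: smoothM.
- by move=> x /b0 bx; rewrite mulf_neq0.
- by split=> //; exists K.
Unshelve. all: by end_near. Qed.

End CnCalculus.
Arguments smooth_derivable {R V f} sf v x.

(** * Smooth truncations of test functions *)

(** Chain rule for a directional derivative. *)
Lemma is_derive_line {R : realType} {V : normedModType R} (f : V -> R) (T : R -> R)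
    (x v : V) (d : R) :
  derivable f x v -> is_derive (f x) 1 T d ->
  is_derive x v (fun y => T (f y)) (d * 'D_v f x).
Proof.
move=> df dT.
pose l := fun h : R => f (h *: v + x).
have lP (g : V -> R) : 'D_1 (fun h : R => g (h *: v + x)) 0 = 'D_v g x.
  rewrite /derive; congr (lim (_ @ 0^')); apply/funext => h /=.
  by rewrite addr0 scale0r add0r [_%:A]mulr1.
have dl : is_derive (0 : R) 1 l ('D_v f x).
  by apply: DeriveDef; [exact: (derivable1P f x v).1|exact: lP].
have [] : is_derive (0 : R) 1 (T \o l) (d * 'D_v f x).
  apply: is_derive1_comp.
  by rewrite /l scale0r add0r.
move=> h1 h2; apply: DeriveDef; first exact: (derivable1P (fun y => T (f y)) x v).2.
by rewrite -h2 -(lP (fun y => T (f y))).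
Qed.

Section Clamp.
Context {R : realType}.
Implicit Types s lam c : R.

(** The logistic function and its primitive. *)
Definition logistic s : R := (1 + expR (- s))^-1.
Definition softplus s : R := ln (1 + expR s).

(** [clamp lam c] is a smooth function with values in [[- c, c]] that tends to
    the identity on [[- c, c]] as [lam] tends to infinity; [dclamp lam c] is its
    derivative. *)
Definition clamp lam c s : R :=
  (softplus (lam * (s + c)) - softplus (lam * (s - c))) / lam - c.
Definition dclamp lam c s : R :=
  logistic (lam * (s + c)) - logistic (lam * (s - c)).

Let exp1_gt0 s : 0 < 1 + expR s.
Proof. by rewrite ltr_wpDr ?expR_ge0. Qed.

Lemma logistic_bounds s : 0 <= logistic s <= 1.
Proof.
rewrite /logistic invr_ge0 ltW//=.
by rewrite invf_le1// lerDl expR_ge0.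
Qed.

Lemma logistic_le s t : s <= t -> logistic s <= logistic t.
Proof.
by move=> st; rewrite /logistic lef_pV2 ?posrE// lerD2l ler_expR lerN2.
Qed.

Lemma logisticN s : logistic (- s) = 1 - logistic s.
Proof.
rewrite /logistic opprK expRN; have e0 := expR_gt0 s.
field; by rewrite !gt_eqF ?addr_gt0.
Qed.

Lemma logisticN_le s : 0 <= s -> logistic (- s) <= (1 + s)^-1.
Proof.
move=> s0; rewrite /logistic opprK lef_pV2 ?posrE//; last by rewrite ltr_wpDr.
by have := expR_ge1Dx s; have := expR_ge0 s; lra.
Qed.

Lemma softplusN s : softplus s = s + softplus (- s).
Proof.
rewrite /softplus -{2}(expRK s) -lnM ?posrE ?expR_gt0//.
by rewrite mulrDr mulr1 -expRD subrr expR0 addrC.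
Qed.

Lemma softplus_ge0 s : 0 <= softplus s.
Proof. by rewrite ln_ge0// lerDl expR_ge0. Qed.

Lemma softplus_le s t : s <= t -> softplus s <= softplus t.
Proof. by move=> st; rewrite ler_ln ?posrE// lerD2l ler_expR. Qed.

Lemma softplusN_le1 s : 0 <= s -> softplus (- s) <= 1.
Proof.
move=> s0; apply: (le_trans (softplus_le (_ : - s <= 0))); first by rewrite oppr_le0.
by rewrite /softplus expR0 -ler_expR lnK ?posrE// expR_ge1Dx.
Qed.

Lemma is_derive_logistic s :
  is_derive s 1 logistic (logistic s * (1 - logistic s)).
Proof.
have e0 := exp1_gt0 (- s).
apply: is_derive_eq.
  apply: (@is_deriveV _ (fun t => 1 + expR (- t))); first by rewrite gt_eqF.
rewrite /logistic /GRing.scale/=; field.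
by rewrite gt_eqF.
Qed.

Lemma is_derive_softplus s : is_derive s 1 softplus (logistic s).
Proof.
have dln : is_derive (1 + expR s) 1 (@ln R) (1 + expR s)^-1.
  exact: is_derive1_ln.
have dexp : is_derive s 1 (fun t : R => 1 + expR t) (0 + expR s).
  exact: is_deriveD.
have := @is_derive1_comp _ (@ln R) (fun t => 1 + expR t) _ _ _ dln dexp.
move=> /is_derive_eq; apply.
have e0 := expR_gt0 s.
rewrite /logistic expRN add0r; field.
by rewrite !gt_eqF ?addr_gt0.
Qed.

Lemma is_derive_clamp lam c s : lam != 0 ->
  is_derive s 1 (clamp lam c) (dclamp lam c s).
Proof.
move=> l0.
have D (k : R) : is_derive s 1 (fun t => softplus (lam * (t + k)))
    (logistic (lam * (s + k)) * lam).
  apply: (@is_derive1_comp _ softplus (fun t => lam * (t + k))).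
    exact: is_derive_softplus.
  by apply: is_derive_eq; rewrite /GRing.scale/= addr0 mulr1.
have := D (- c); have := D c => D1 D2.
rewrite /clamp; apply: is_derive_eq.
rewrite /dclamp /GRing.scale/=; field.
by [].
Qed.

Lemma clamp0 lam c : lam != 0 -> clamp lam c 0 = 0.
Proof.
move=> l0; rewrite /clamp add0r sub0r mulrN (softplusN (lam * c)).
by field.
Qed.

Lemma clamp_bounded lam c s : 0 < lam -> 0 <= c -> `|clamp lam c s| <= c.
Proof.
move=> l0 c0; rewrite /clamp.
have h1 : softplus (lam * (s - c)) <= softplus (lam * (s + c)).
  by apply: softplus_le; rewrite ler_pM2l//; lra.
have h2 : softplus (lam * (s + c)) <= lam * (2 * c) + softplus (lam * (s - c)).
  rewrite (softplusN (lam * (s + c))) (softplusN (lam * (s - c))).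
  have : softplus (- (lam * (s + c))) <= softplus (- (lam * (s - c))).
    by apply: softplus_le; rewrite lerN2 ler_pM2l//; lra.
  by lra.
rewrite ler_norml; apply/andP; split.
  by rewrite lerBrDr addNr divr_ge0 ?(ltW l0)// subr_ge0.
rewrite lerBlDr ler_pdivrMr//; lra.
Qed.

Lemma dclamp_bounds lam c s : 0 < lam -> 0 <= c -> 0 <= dclamp lam c s <= 1.
Proof.
move=> l0 c0; rewrite /dclamp.
have : logistic (lam * (s - c)) <= logistic (lam * (s + c)).
  by apply: logistic_le; rewrite ler_pM2l//; lra.
have /andP[_ ?] := logistic_bounds (lam * (s + c)).
have /andP[? _] := logistic_bounds (lam * (s - c)).
by move=> ?; apply/andP; split; lra.
Qed.

Lemma clamp_near_id lam c s : 0 < lam -> `|s| <= c ->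
  `|clamp lam c s - s| <= lam^-1.
Proof.
move=> l0; rewrite ler_norml => /andP[s1 s2].
have E : clamp lam c s - s =
    (softplus (- (lam * (s + c))) - softplus (- (lam * (c - s)))) / lam.
  rewrite /clamp (softplusN (lam * (s + c))) -(mulrN lam (c - s)) opprB.
  by field; rewrite gt_eqF.
rewrite E normrM (@gtr0_norm _ lam^-1) ?invr_gt0// ler_piMl ?invr_ge0 ?(ltW l0)//.
have h1 := softplus_ge0 (- (lam * (s + c))).
have h2 := softplus_ge0 (- (lam * (c - s))).
have h3 : softplus (- (lam * (s + c))) <= 1.
  by apply: softplusN_le1; apply: mulr_ge0; lra.
have h4 : softplus (- (lam * (c - s))) <= 1.
  by apply: softplusN_le1; apply: mulr_ge0; lra.
by rewrite ler_norml; apply/andP; split; lra.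
Qed.

Lemma dclamp_near_1 lam c b s : 0 < lam -> `|s| <= b -> b <= c ->
  1 - dclamp lam c s <= 2 / (1 + lam * (c - b)).
Proof.
move=> l0; rewrite ler_norml => /andP[s1 s2] bc.
have E : 1 - dclamp lam c s =
    logistic (- (lam * (s + c))) + logistic (- (lam * (c - s))).
  have -> : - (lam * (c - s)) = lam * (s - c) by ring.
  by rewrite /dclamp logisticN; ring.
have p0 : 0 <= lam * (c - b) by apply: mulr_ge0; lra.
have h u : c - b <= u -> logistic (- (lam * u)) <= (1 + lam * (c - b))^-1.
  move=> ub; apply: le_trans (logisticN_le p0).
  by apply: logistic_le; rewrite lerN2 ler_pM2l.
have h1 := h (s + c) ltac:(lra); have h2 := h (c - s) ltac:(lra).
rewrite E; lra.
Qed.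

Variable V : normedModType R.
Implicit Types f : V -> R.

Lemma Cn_logistic n f : smooth f -> Cn n (fun x => logistic (f x)).
Proof.
move=> sf.
have D v x : is_derive x v (fun y => logistic (f y))
    (logistic (f x) * (1 - logistic (f x)) * 'D_v f x).
  apply: is_derive_line; first exact: smooth_derivable.
  exact: is_derive_logistic.
have cs : continuous logistic.
  move=> s; apply/differentiable_continuous/derivable1_diffP.
  by have [] := is_derive_logistic s.
have cont : continuous (fun x => logistic (f x)).
  move=> x; apply: (@continuous_comp _ _ _ f logistic); last exact: cs.
  exact: smooth_continuous.
elim: n => [|n IH]; first by split.
split=> // v; split; first by move=> x; have [] := D v x.
rewrite (_ : 'D_v _ = fun x =>
    (logistic (f x) * (1 + (-1) * logistic (f x))) * 'D_v f x); last first.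
  by apply/funext => x; rewrite mulN1r; exact: derive_val.
apply: CnM; last exact: smooth_derive.
apply: CnM => //; apply: CnD; first exact: Cn_cst.
by apply: CnM => //; exact: Cn_cst.
Qed.

Lemma derive_clamp lam c f x v : lam != 0 -> derivable f x v ->
  is_derive x v (fun y => clamp lam c (f y)) (dclamp lam c (f x) * 'D_v f x).
Proof. by move=> l0 df; apply: is_derive_line => //; exact: is_derive_clamp. Qed.

Lemma smooth_dclamp lam c f : smooth f -> smooth (fun x => dclamp lam c (f x)).
Proof.
move=> sf n.
have aff (k : R) : smooth (fun x => lam * (f x + k)).
  by apply: smoothZ; apply: smoothD => //; exact: smooth_cst.
rewrite (_ : (fun x => _) = fun x => logistic (lam * (f x + c)) +
    (-1) * logistic (lam * (f x - c))); last first.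
  by apply/funext => x; rewrite mulN1r.
apply: CnD; first exact: Cn_logistic.
by apply: CnM; [exact: Cn_cst|exact: Cn_logistic].
Qed.

Lemma testfun_clamp (W : set V) lam c f : lam != 0 -> testfun W f ->
  testfun W (fun x => clamp lam c (f x)).
Proof.
move=> l0 [sf [K [cK KW f0]]]; split; last first.
  by exists K; split=> // x Kx; rewrite f0// clamp0.
have D v x := derive_clamp c l0 (smooth_derivable sf v x).
have cont : continuous (fun x => clamp lam c (f x)).
  move=> x; apply: (@continuous_comp _ _ _ f (clamp lam c)).
    exact: smooth_continuous.
  apply/differentiable_continuous/derivable1_diffP.
  by have [] := is_derive_clamp c (f x) l0.
move=> [|n]; split=> // v; split; first by move=> x; have [] := D v x.
rewrite (_ : 'D_v _ = fun x => dclamp lam c (f x) * 'D_v f x); last first.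
  by apply/funext => x; have [] := D v x.
by apply: CnM; [exact: smooth_dclamp|exact: smooth_derive].
Qed.

End Clamp.

(** * Borel sets of the plane and of space *)

(** Sigma-finiteness of the Lebesgue measures on the plane and on space is what
    Fubini's theorem asks for. *)
Lemma sigma_finite_product d1 d2 (T1 : measurableType d1) (T2 : measurableType d2)
    (R : realType) (m1 : {sigma_finite_measure set T1 -> \bar R})
    (m2 : {sigma_finite_measure set T2 -> \bar R}) :
  sigma_finite [set: T1 * T2] (m1 \x m2)%E.
Proof.
have [F TF Foo] := sigma_finiteT m1; have [G TG Goo] := sigma_finiteT m2.
exists (fun k => if unpickle k is Some (i, j) then F i `*` G j else set0).
  apply/seteqP; split=> // -[x y] _.
  have [i _ Fx] : (\bigcup_i F i) x by rewrite -TF.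
  have [j _ Gy] : (\bigcup_i G i) y by rewrite -TG.
  by exists (pickle (i, j)); rewrite ?pickleK.
move=> k; case: unpickle => [[i j]|]; last by rewrite measure0.
have [mF Fi] := Foo i; have [mG Gj] := Goo j; split; first exact: measurableX.
by rewrite product_measure1E// lte_mul_pinfty// ge0_fin_numE.
Qed.

HB.instance Definition _ (R : realType) :=
  @Measure_isSigmaFinite.Build _ _ _ (@leb2 R)
    (sigma_finite_product (@lebesgue_measure R) (@lebesgue_measure R)).

HB.instance Definition _ (R : realType) :=
  @Measure_isSigmaFinite.Build _ _ _ (@leb3 R)
    (sigma_finite_product (@leb2 R) (@lebesgue_measure R)).

Section OpenMeasurable.
Context {R : realType}.

(** The sequence [q] is dense in [T]. *)
Definition dense_seq (T : pseudoMetricType R) (q : nat -> T) :=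
  forall x (e : R), 0 < e -> exists k, ball (q k) e x.

Lemma dense_seqX (T U : pseudoMetricType R) (q : nat -> T) (r : nat -> U) :
  dense_seq q -> dense_seq r ->
  dense_seq (fun k => if unpickle k is Some (i, j) then (q i, r j)
                      else (q 0%N, r 0%N)).
Proof.
move=> dq dr [x y] e e0; have [i qi] := dq x e e0; have [j rj] := dr y e e0.
by exists (pickle (i, j)); rewrite pickleK; split.
Qed.

Lemma dense_seq_real : exists q : nat -> R, dense_seq q.
Proof.
exists (fun k => if unpickle k is Some u then ratr (u : rat) else 0).
move=> x e e0; have [u] := @rat_in_itvoo R (x - e) (x + e) ltac:(lra).
rewrite in_itv/= => /andP[u1 u2]; exists (pickle u); rewrite pickleK.
by rewrite /ball/= ltr_distlC; apply/andP; split; lra.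
Qed.

(** In a separable metric space every open set is a countable union of balls. *)
Lemma open_bigcup_ball (T : pseudoMetricType R) (q : nat -> T) (U : set T) :
  dense_seq q -> open U ->
  U = \bigcup_(p : nat * nat)
        (if `[< ball (q p.1) p.2.+1%:R^-1 `<=` U >]
         then ball (q p.1) p.2.+1%:R^-1 else set0).
Proof.
move=> dq oU; apply/seteqP; split=> x; last first.
  by move=> [[i j] _]/=; case: ifPn => // /asboolP; apply.
move=> Ux; have /nbhs_ballP[e/= e0 eU] := open_nbhs_nbhs (conj oU Ux).
have [n ne] : exists n, n.+1%:R^-1 < e / 2.
  have [N _ /(_ N (leqnn N))] := near_infty_natSinv_lt (PosNum (divr_gt0 e0 (ltr0n R 2))).
  by exists N.
have [k kx] := dq x n.+1%:R^-1 ltac:(by rewrite invr_gt0).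
exists (k, n) => //=; rewrite asboolT// => y ky; apply: eU.
apply: le_ball (ball_triangle (ball_sym kx) ky);
set r := _^-1 in ne *; lra.
Qed.

(** [P] carries the topology and [T] the sigma-algebra; [i] identifies their
    points. *)
Lemma open_measurable_dense d (T : measurableType d) (P : pseudoMetricType R)
    (i : P -> T) (q : nat -> P) (U : set P) :
  (forall x r, measurable [set i y | y in ball x r]) -> injective i ->
  dense_seq q -> open U -> measurable [set i y | y in U].
Proof.
move=> mb inji dq oU; rewrite (open_bigcup_ball dq oU) image_bigcup.
apply: countable_bigcupT_measurable => [|p]; first exact: countableP.
by case: ifPn => _; [exact: mb|rewrite image_set0].
Qed.

Lemma open_measurable2 (U : set (R * R)) :
  open U -> measurable (U : set (mplane R)).
Proof.
move=> oU; have [q dq] := dense_seq_real.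
rewrite -[X in measurable X]image_id.
apply: (@open_measurable_dense _ (mplane R) (R * R)%type id _ _ _ _ (dense_seqX dq dq)) => //.
move=> x r; rewrite image_id.
rewrite (_ : ball x r = ball x.1 r `*` ball x.2 r)//.
by apply: measurableX; exact: measurable_ball.
Qed.

Lemma open_measurable3 (U : set (R * R * R)) :
  open U -> measurable (U : set (mspace R)).
Proof.
move=> oU; have [q dq] := dense_seq_real.
rewrite -[X in measurable X]image_id.
apply: (@open_measurable_dense _ (mspace R) (R * R * R)%type id _ _ _ _
  (dense_seqX (dense_seqX dq dq) dq)) => //.
move=> x r; rewrite image_id.
rewrite (_ : ball x r = (ball x.1.1 r `*` ball x.1.2 r) `*` ball x.2 r)//.
apply: measurableX; last exact: measurable_ball.
by apply: measurableX; exact: measurable_ball.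
Qed.

Lemma continuous_measurable2 (f : R * R -> R) :
  continuous f -> measurable_fun [set: mplane R] f.
Proof.
move=> cf; apply: (measurability _ (RGenOpens.measurableE R)) => _ [_ [a [b ->]] <-].
rewrite setTI; apply: open_measurable2.
by apply: open_comp => // x _; exact: cf.
Qed.

Lemma continuous_measurable3 (f : R * R * R -> R) :
  continuous f -> measurable_fun [set: mspace R] f.
Proof.
move=> cf; apply: (measurability _ (RGenOpens.measurableE R)) => _ [_ [a [b ->]] <-].
rewrite setTI; apply: open_measurable3.
by apply: open_comp => // x _; exact: cf.
Qed.

End OpenMeasurable.

(** * The inner product of L^2 *)

Section SquareIntegrable.
Context {R : realType} d (T : measurableType d).
Variables (mu : {measure set T -> \bar R}) (D : set T).
Hypothesis mD : measurable D.
Implicit Types (f g h : T -> R) (c : R).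
Local Notation L2 := (L2 mu D).

(** The inner product of L^2(D). *)
Definition dot f g : R := \int[mu]_(x in D) (f x * g x).

Lemma L2_measurable f : L2 f -> measurable_fun D f.
Proof. by case. Qed.

Lemma L2_integrable_sqr f : L2 f -> mu.-integrable D (EFin \o (fun x => f x ^+ 2)).
Proof.
move=> [mf fi]; apply/integrableP; split.
  by apply/measurable_EFinP; exact: measurable_funX.
apply: le_lt_trans fi; rewrite le_eqVlt; apply/orP; left; apply/eqP.
by apply: eq_integral => x _ /=; rewrite ger0_norm// sqr_ge0.
Qed.

Lemma L2_mul_integrable f g : L2 f -> L2 g ->
  mu.-integrable D (EFin \o (fun x => f x * g x)).
Proof.
move=> Lf Lg.
apply: (@le_integrable _ _ _ _ _ mD _ (EFin \o (fun x => f x ^+ 2 + g x ^+ 2))).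
- by apply/measurable_EFinP; apply: measurable_funM; exact: L2_measurable.
- move=> x _; rewrite /= lee_fin normrM [leRHS]ger0_norm ?addr_ge0 ?sqr_ge0//.
  rewrite -(real_normK (num_real (f x))) -(real_normK (num_real (g x))).
  have := sqr_ge0 (`|f x| - `|g x|); have := mulr_ge0 (normr_ge0 (f x)) (normr_ge0 (g x)).
  by nra.
- rewrite (_ : _ \o _ = (EFin \o (fun x => f x ^+ 2)) \+ (EFin \o (fun x => g x ^+ 2)))//.
  by apply: integrableD => //; exact: L2_integrable_sqr.
Qed.

Lemma L2_le f g : measurable_fun D f -> (forall x, D x -> `|f x| <= `|g x|) ->
  L2 g -> L2 f.
Proof.
move=> mf fg [mg gi]; split=> //; apply: le_lt_trans gi.
apply: ge0_le_integral => //.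
- by move=> x _; rewrite lee_fin sqr_ge0.
- by apply/measurable_EFinP; exact: measurable_funX.
- by apply/measurable_EFinP; exact: measurable_funX.
move=> x Dx; rewrite lee_fin -(real_normK (num_real (f x))).
rewrite -(real_normK (num_real (g x))).
by rewrite lerXn2r ?nnegrE//; exact: fg.
Qed.

Lemma L2Z c f : L2 f -> L2 (fun x => c * f x).
Proof.
move=> Lf; split.
  by apply: measurable_funM => //; exact: L2_measurable.
rewrite (_ : (fun x => _) = fun x => ((c ^+ 2)%:E * (f x ^+ 2)%:E)%E); last first.
  by apply/funext => x; rewrite -EFinM exprMn.
have [mf fi] := Lf.
rewrite ge0_integralZl//; first by rewrite lte_mul_pinfty// lee_fin sqr_ge0.
- by apply/measurable_EFinP; exact: measurable_funX.
- by move=> x _; rewrite lee_fin sqr_ge0.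
- by rewrite lee_fin sqr_ge0.
Qed.

Lemma L2D f g : L2 f -> L2 g -> L2 (fun x => f x + g x).
Proof.
move=> Lf Lg; split; first by apply: measurable_funD; exact: L2_measurable.
apply: (@le_lt_trans _ _ (\int[mu]_(x in D) (2 * f x ^+ 2 + 2 * g x ^+ 2)%:E)%E).
  apply: ge0_le_integral => //.
  - by move=> x _; rewrite lee_fin sqr_ge0.
  - by apply/measurable_EFinP; apply: measurable_funX; apply: measurable_funD;
      exact: L2_measurable.
  - by apply/measurable_EFinP; apply: measurable_funD; apply: measurable_funM => //;
      apply: measurable_funX; exact: L2_measurable.
  by move=> x _; rewrite lee_fin; have := sqr_ge0 (f x - g x); nra.
apply: integrable_lty => //.
rewrite (_ : (fun x => _) = (fun x => 2%:E * (f x ^+ 2)%:E)%E \+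
    (fun x => 2%:E * (g x ^+ 2)%:E)%E)//.
by apply: integrableD => //; apply: integrableZl => //; exact: L2_integrable_sqr.
Qed.

Lemma L2B f g : L2 f -> L2 g -> L2 (fun x => f x - g x).
Proof.
move=> Lf Lg; rewrite (_ : (fun x => _) = fun x => f x + (-1) * g x).
  by apply: L2D => //; exact: L2Z.
by apply/funext => x; rewrite mulN1r.
Qed.

Lemma L2_0 : L2 (cst 0).
Proof. by split=> //; rewrite integral0_eq// => x _; rewrite expr0n. Qed.

Lemma L2_eq f g : (forall x, D x -> f x = g x) -> L2 f -> L2 g.
Proof.
move=> fg Lf; apply: (L2_le _ _ Lf); last by move=> x Dx; rewrite fg.
by apply: eq_measurable_fun (L2_measurable Lf) => x /[!inE]; exact: fg.
Qed.

Lemma L2_mul_bounded f g c : measurable_fun D g -> (forall x, D x -> `|g x| <= c) ->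
  L2 f -> L2 (fun x => g x * f x).
Proof.
move=> mg gc Lf; apply: (@L2_le _ (fun x => c * f x)); last exact: L2Z.
  by apply: measurable_funM => //; exact: L2_measurable.
move=> x Dx; rewrite !normrM ler_wpM2r//.
exact: le_trans (gc x Dx) (ler_norm _).
Qed.

Lemma bounded_L2 g c : (mu D < +oo)%E -> measurable_fun D g ->
  (forall x, D x -> `|g x| <= c) -> L2 g.
Proof.
move=> muD mg gc; apply: (@L2_le _ (cst c)) => //.
  by move=> x Dx; rewrite (le_trans (gc x Dx)) ?ler_norm.
split=> //; apply: (@le_lt_trans _ _ ((c ^+ 2)%:E * mu D)%E).
  by rewrite -integral_cst.
by rewrite lte_mul_pinfty// lee_fin sqr_ge0.
Qed.

Lemma dotC f g : dot f g = dot g f.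
Proof. by apply: eq_Rintegral => x _; rewrite mulrC. Qed.

Lemma dotDl f g h : L2 f -> L2 g -> L2 h ->
  dot (fun x => f x + g x) h = dot f h + dot g h.
Proof.
move=> Lf Lg Lh; rewrite /dot -RintegralD//; try exact: L2_mul_integrable.
by apply: eq_Rintegral => x _; rewrite mulrDl.
Qed.

Lemma dotZl c f g : L2 f -> L2 g -> dot (fun x => c * f x) g = c * dot f g.
Proof.
move=> Lf Lg; rewrite /dot -RintegralZl//; last exact: L2_mul_integrable.
by apply: eq_Rintegral => x _; rewrite mulrA.
Qed.

Lemma dotBl f g h : L2 f -> L2 g -> L2 h ->
  dot (fun x => f x - g x) h = dot f h - dot g h.
Proof.
move=> Lf Lg Lh; rewrite /dot -RintegralB//; try exact: L2_mul_integrable.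
by apply: eq_Rintegral => x _; rewrite mulrBl.
Qed.

Lemma dotDr f g h : L2 f -> L2 g -> L2 h ->
  dot h (fun x => f x + g x) = dot h f + dot h g.
Proof. by move=> *; rewrite dotC dotDl// !(dotC h). Qed.

Lemma dotZr c f g : L2 f -> L2 g -> dot g (fun x => c * f x) = c * dot g f.
Proof. by move=> *; rewrite dotC dotZl// (dotC g). Qed.

Lemma dotBr f g h : L2 f -> L2 g -> L2 h ->
  dot h (fun x => f x - g x) = dot h f - dot h g.
Proof. by move=> *; rewrite dotC dotBl// !(dotC h). Qed.

Lemma dot_ge0 f : 0 <= dot f f.
Proof. by apply: Rintegral_ge0 => x _; rewrite -expr2 sqr_ge0. Qed.

Lemma dotE f : L2 f -> (\int[mu]_(x in D) (f x ^+ 2)%:E)%E = (dot f f)%:E.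
Proof.
move=> Lf; rewrite /dot /Rintegral fineK; first by apply: eq_integral.
by apply: integrable_fin_num => //; exact: L2_mul_integrable.
Qed.

Lemma dot_eq0 f : L2 f -> dot f f = 0 -> {ae mu, forall x, D x -> f x = 0}.
Proof.
move=> Lf f0; have := dotE Lf; rewrite f0 => f0'.
have : (\int[mu]_(x in D) `| (f x ^+ 2)%:E |)%E = 0%E.
  rewrite -[RHS]f0'; apply: eq_integral => x _.
  by rewrite /= ger0_norm// sqr_ge0.
move/ae_eq_integral_abs => /(_ mD) H.
have : ae_eq mu D (fun x => (f x ^+ 2)%:E) (cst 0%E).
  apply: H; apply/measurable_EFinP; apply: measurable_funX; exact: L2_measurable.
apply: filterS => x h Dx; have := h Dx.
by move=> /eqP; rewrite eqe sqrf_eq0 => /eqP.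
Qed.

(** The Cauchy-Schwarz inequality. *)
Lemma dot_CS f g : L2 f -> L2 g -> (dot f g) ^+ 2 <= dot f f * dot g g.
Proof.
move=> Lf Lg.
have Q t : 0 <= dot f f + (2 * t) * dot f g + t ^+ 2 * dot g g.
  have Lt : L2 (fun x => t * g x) by exact: L2Z.
  have := dot_ge0 (fun x => f x + t * g x).
  rewrite dotDl ?dotDr//; try exact: L2D.
  rewrite !(dotZl, dotZr)// (dotC g f).
  by move: (dot f f) (dot f g) (dot g g) => A B C h; nra.
have := dot_ge0 g; rewrite le_eqVlt => /orP[/eqP g0|g0].
  have [->|B0] := eqVneq (dot f g) 0; first by rewrite expr0n -g0 mulr0.
  have := Q (- (dot f f + 1) / (2 * dot f g)); rewrite -g0 mulr0 addr0.
  have -> : 2 * (- (dot f f + 1) / (2 * dot f g)) * dot f g = - (dot f f + 1).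
    by field.
  by rewrite opprD addNKr ler0N1.
have := Q (- dot f g / dot g g).
rewrite -(ler_pM2r g0) mul0r.
have -> : (dot f f + 2 * (- dot f g / dot g g) * dot f g +
   (- dot f g / dot g g) ^+ 2 * dot g g) * dot g g =
   dot f f * dot g g - dot f g ^+ 2 by field; rewrite gt_eqF.
by rewrite subr_ge0.
Qed.

Lemma dotD_le f g : L2 f -> L2 g ->
  dot (fun x => f x + g x) (fun x => f x + g x) <= 2 * dot f f + 2 * dot g g.
Proof.
move=> Lf Lg; have LD : L2 (fun x => f x + g x) by exact: L2D.
have := dot_ge0 (fun x => f x - g x).
rewrite dotBl ?dotBr//; try exact: L2B.
rewrite dotDl ?dotDr// (dotC g f); lra.
Qed.

(** Convergence in L^2(D). *)
Definition cvgL2 (u : nat -> T -> R) f : Prop :=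
  dot (fun x => u n x - f x) (fun x => u n x - f x) @[n --> \oo] --> (0 : R).

Lemma cvgL2_dot u f h : (forall n, L2 (u n)) -> L2 f -> L2 h -> cvgL2 u f ->
  dot (u n) h @[n --> \oo] --> dot f h.
Proof.
move=> Lu Lf Lh uf; apply/cvgrPdist_le => e e0.
have h0 : 0 < dot h h + 1 by rewrite ltr_wpDl// dot_ge0.
have e2 : 0 < e ^+ 2 / (dot h h + 1) by rewrite divr_gt0// exprn_gt0.
move/cvgrPdist_le : uf => /(_ _ e2); apply: filterS => n.
rewrite sub0r normrN ger0_norm ?dot_ge0// => un.
have Ln : L2 (fun x => u n x - f x) by exact: L2B.
rewrite distrC -dotBl// -(@ler_pXn2r _ 2)// ?nnegrE ?(ltW e0)//.
rewrite real_normK ?num_real// (le_trans (dot_CS Ln Lh))//.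
have := dot_ge0 h; have := dot_ge0 (fun x => u n x - f x).
move: un; rewrite ler_pdivlMr//; nra.
Qed.

Lemma cvgL2_mul_bounded u f g c : (forall n, L2 (u n)) -> L2 f ->
  measurable_fun D g -> (forall x, D x -> `|g x| <= c) ->
  cvgL2 u f -> cvgL2 (fun n x => g x * u n x) (fun x => g x * f x).
Proof.
move=> Lu Lf mg gc uf.
apply: (@squeeze_cvgr _ _ _ _ (cst 0) (fun n => c ^+ 2 *
   dot (fun x => u n x - f x) (fun x => u n x - f x))).
- apply: nearW => n; rewrite dot_ge0/=.
  have Ln : L2 (fun x => u n x - f x) by exact: L2B.
  rewrite -RintegralZl//; last exact: L2_mul_integrable.
  apply: le_Rintegral => //.
  + have Lg : L2 (fun x => g x * u n x - g x * f x).
      by apply: L2B; apply: L2_mul_bounded gc _.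
    exact: L2_mul_integrable.
  + rewrite (_ : _ \o _ = fun x => ((c ^+ 2)%:E * ((u n x - f x) * (u n x - f x))%:E)%E)//.
    by apply: integrableZl => //; exact: L2_mul_integrable.
  + move=> x Dx; rewrite -mulrBr -!expr2 exprMn ler_wpM2r ?sqr_ge0//.
    rewrite -(real_normK (num_real (g x))) lerXn2r ?nnegrE ?gc//.
    exact: le_trans (gc x Dx).
- exact: cvg_cst.
- by rewrite -(mulr0 (c ^+ 2)); apply: cvgMr.
Qed.

End SquareIntegrable.

(** * Completeness of L^2 *)

Section L2Completeness.
Context {R : realType} d (T : measurableType d).
Variables (mu : {measure set T -> \bar R}) (D : set T).
Hypothesis mD : measurable D.
Implicit Types (f g h : T -> R) (u v : nat -> T -> R).
Local Notation L2 := (L2 mu D).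
Local Notation dot := (dot mu D).
Local Notation cvgL2 := (cvgL2 mu D).

Let L2m f : L2 f -> measurable_fun D f. Proof. exact: L2_measurable. Qed.

(** Nonnegative functions with summable integrals are pointwise bounded almost
    everywhere. *)
Lemma ae_bounded_of_summable (h : nat -> T -> R) :
  (forall n, measurable_fun D (h n)) -> (forall n x, D x -> 0 <= h n x) ->
  (forall n, (\int[mu]_(x in D) (h n x)%:E <= (1 / (2 ^ n.+1)%:R)%:E)%E) ->
  {ae mu, forall x, D x -> exists C, forall n, h n x <= C}.
Proof.
move=> mh h0 hs.
pose H x := (\sum_(0 <= n <oo) (h n x)%:E)%E.
have mhE n : measurable_fun D (fun x => (h n x)%:E) by exact/measurable_EFinP.
have H0 x : D x -> (0 <= H x)%E.
  by move=> Dx; apply: nneseries_ge0 => n _ _; rewrite lee_fin h0.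
have iH : mu.-integrable D H.
  apply/integrableP; split.
    apply: ge0_emeasurable_sum => // n x Dx _.
    by rewrite lee_fin h0.
  apply: (@le_lt_trans _ _ (1%:E)); last exact: ltry.
  rewrite (eq_integral H); last by move=> x /[!inE] Dx; rewrite gee0_abs// H0.
  rewrite integral_nneseries//.
  have := @epsilon_trick R (fun=> 0%E) 1 xpredT (fun=> lexx _) ler01.
  rewrite [X in (_ <= X + _)%E]eseries0// add0e; apply: le_trans.
  apply: lee_nneseries => [n _ _|n _]; last by rewrite add0e hs.
  by apply: integral_ge0 => x Dx; rewrite lee_fin h0.
have := integrable_ae mD iH; apply: filterS => x Hx Dx.
exists (fine (H x)) => n; rewrite -lee_fin fineK ?Hx//.
apply: le_trans (nneseries_lim_ge n.+1 _); last by move=> *; rewrite lee_fin h0.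
rewrite big_nat_recr//= leeDr// sume_ge0// => i _; by rewrite lee_fin h0.
Qed.

Let mB u f n : (forall n, L2 (u n)) -> L2 f ->
  measurable_fun D (fun x => (u n x - f x) ^+ 2).
Proof.
move=> Lu Lf; apply: measurable_funX; apply: measurable_funB; exact: L2m.
Qed.

(** A sequence converging in L^2 has a subsequence converging almost
    everywhere. *)
Lemma cvgL2_ae_subseq u f : (forall n, L2 (u n)) -> L2 f -> cvgL2 u f ->
  exists s : nat -> nat, (forall n, (n <= s n)%N) /\
    {ae mu, forall x, D x -> u (s n) x @[n --> \oo] --> f x}.
Proof.
move=> Lu Lf uf.
have ex n : exists m, (n <= m)%N /\
    dot (fun x => u m x - f x) (fun x => u m x - f x) <= 1 / (4 ^ n.+1)%:R.
  have e0 : 0 < 1 / (4 ^ n.+1)%:R :> R by rewrite divr_gt0// ltr0n expn_gt0.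
  move/cvgrPdist_le : uf => /(_ _ e0)[N _ NP].
  exists (maxn n N); split; first exact: leq_maxl.
  have := NP (maxn n N) (leq_maxr _ _).
  by rewrite sub0r normrN ger0_norm// dot_ge0.
(* the squared distances along [s] are at most 4^-n, so the functions
   2^n (u_(s n) - f)^2 are bounded in n almost everywhere *)
have [s sP] := choice ex; exists s; split; first by move=> n; have [] := sP n.
have := @ae_bounded_of_summable (fun n x => (2 ^ n.+1)%:R * (u (s n) x - f x) ^+ 2).
have A1 n : measurable_fun D (fun x => (2 ^ n.+1)%:R * (u (s n) x - f x) ^+ 2).
  by apply: measurable_funM => //; exact: mB.
move=> /(_ A1); have A2 n x : D x -> 0 <= (2 ^ n.+1)%:R * (u (s n) x - f x) ^+ 2.
  by move=> _; rewrite mulr_ge0// sqr_ge0.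
move=> /(_ A2).
have A3 n : (\int[mu]_(x in D) ((2 ^ n.+1)%:R * (u (s n) x - f x) ^+ 2)%:E <=
    (1 / (2 ^ n.+1)%:R)%:E)%E.
  under eq_integral do rewrite EFinM.
  rewrite ge0_integralZl//; last 2 first.
  - by apply/measurable_EFinP; exact: mB.
  - by move=> x _; rewrite lee_fin sqr_ge0.
  rewrite (dotE mD); last exact: L2B.
  rewrite -EFinM lee_fin.
  have [_] := sP n; move/(ler_wpM2l (ler0n R (2 ^ n.+1))) => /le_trans; apply.
  rewrite (_ : 4 = 2 * 2)%N// expnMn natrM le_eqVlt; apply/orP; left; apply/eqP.
  field; by rewrite pnatr_eq0 expn_eq0.
move=> /(_ A3); apply: filterS => x Hx Dx; have [C CP] := Hx Dx.
apply/cvgrPdist_le => e e0.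
near=> n.
rewrite distrC -(@ler_pXn2r _ 2)// ?nnegrE ?(ltW e0)// real_normK ?num_real//.
have p0 : 0 < (2 ^ n.+1)%:R :> R by rewrite ltr0n expn_gt0.
rewrite -(ler_pM2l p0); apply: le_trans (CP n) _.
have e2 : 0 < e ^+ 2 by rewrite exprn_gt0.
rewrite -ler_pdivrMr//.
have : `|C| / e ^+ 2 < n%:R by near: n; exact: nbhs_infty_gtr.
have : (n%:R : R) <= (2 ^ n.+1)%:R by rewrite ler_nat ltnW// (ltn_trans (ltnSn n))// ltn_expl.
have : C / e ^+ 2 <= `|C| / e ^+ 2 by rewrite ler_pM2r ?invr_gt0// ler_norm.
by move=> h1 h2 h3; apply: (le_trans h1); apply: (le_trans (ltW h3)).
Unshelve. all: by end_near. Qed.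

(** Completeness of L^2 (Riesz-Fischer). *)
Lemma L2_complete u : (forall n, L2 (u n)) ->
  (forall e, 0 < e -> exists N, forall n m, (N <= n)%N -> (N <= m)%N ->
     dot (fun x => u n x - u m x) (fun x => u n x - u m x) <= e) ->
  exists f, L2 f /\ cvgL2 u f.
Proof.
move=> Lu cu.
(* along a subsequence [v] with squared distances at most 8^-n, the functions
   4^n (v_(n+1) - v_n)^2 are bounded in n almost everywhere, so that the
   increments of [v] are dominated by a geometric series *)
have ex n : exists N, forall p q, (N <= p)%N -> (N <= q)%N ->
    dot (fun x => u p x - u q x) (fun x => u p x - u q x) <= 1 / (8 ^ n.+1)%:R.
  by apply: cu; rewrite divr_gt0// ltr0n expn_gt0.
have [s0 s0P] := choice ex.
pose s n := ((\max_(i < n.+1) s0 i) + n)%N.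
have s0s n : (s0 n <= s n)%N.
  rewrite (leq_trans _ (leq_addr _ _))//.
  exact: (leq_bigmax (F := fun i : 'I_n.+1 => s0 i) ord_max).
have ss n : (s n <= s n.+1)%N.
  by rewrite /s addnS ltnW// ltnS leq_add2r [leqRHS]big_ord_recr/= leq_maxl.
pose v n := u (s n).
have Lv n : L2 (v n) by exact: Lu.
have vP n : dot (fun x => v n.+1 x - v n x) (fun x => v n.+1 x - v n x)
    <= 1 / (8 ^ n.+1)%:R.
  by apply: s0P => //; rewrite (leq_trans (s0s n)).
have := @ae_bounded_of_summable (fun n x => (4 ^ n.+1)%:R * (v n.+1 x - v n x) ^+ 2).
have A0 n : measurable_fun D (fun x => (v n.+1 x - v n x) ^+ 2).
  by apply: measurable_funX; apply: measurable_funB; exact: L2m.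
have A1 n : measurable_fun D (fun x => (4 ^ n.+1)%:R * (v n.+1 x - v n x) ^+ 2).
  by apply: measurable_funM.
move=> /(_ A1); have A2 n x : D x -> 0 <= (4 ^ n.+1)%:R * (v n.+1 x - v n x) ^+ 2.
  by move=> _; rewrite mulr_ge0// sqr_ge0.
move=> /(_ A2).
have A3 n : (\int[mu]_(x in D) ((4 ^ n.+1)%:R * (v n.+1 x - v n x) ^+ 2)%:E <=
    (1 / (2 ^ n.+1)%:R)%:E)%E.
  under eq_integral do rewrite EFinM.
  rewrite ge0_integralZl//; last 2 first.
  - exact/measurable_EFinP.
  - by move=> x _; rewrite lee_fin sqr_ge0.
  rewrite (dotE mD); last exact: L2B.
  rewrite -EFinM lee_fin.
  have := vP n; move/(ler_wpM2l (ler0n R (4 ^ n.+1))) => /le_trans; apply.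
  rewrite (_ : 8 = 4 * 2)%N// expnMn natrM le_eqVlt; apply/orP; left; apply/eqP.
  by field; rewrite !pnatr_eq0 !expn_eq0.
move=> /(_ A3)[N [mN N0 DN]].
(* the limit of the fast subsequence off the null set [N] *)
pose f x := if x \in D `\` N then limn (v ^~ x) else 0.
pose w n x := if x \in D `\` N then v n x else 0.
have wf x : w n x @[n --> \oo] --> f x.
  rewrite /w /f; case: ifPn => [|_]; last exact: cvg_cst.
  rewrite inE => -[Dx Nx].
  have [C CP] : exists C, forall n, (4 ^ n.+1)%:R * (v n.+1 x - v n x) ^+ 2 <= C.
    by apply: contrapT => nC; apply: Nx; apply: DN => /= /(_ Dx).
  have C0 : 0 <= C by apply: le_trans (CP 0%N); rewrite mulr_ge0// sqr_ge0.
  have dv n : `|v n.+1 x - v n x| <= (C + 1) / (2 ^ n.+1)%:R.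
    have p0 : 0 < (2 ^ n.+1)%:R :> R by rewrite ltr0n expn_gt0.
    rewrite -(@ler_pXn2r _ 2)// ?nnegrE ?divr_ge0//; last by lra.
    rewrite real_normK ?num_real// expr_div_n ler_pdivlMr ?exprn_gt0// mulrC.
    have := CP n; rewrite (_ : 4 = 2 * 2)%N// expnMn natrM -expr2 => /le_trans.
    by apply; nra.
  suff : cvgn (v ^~ x) by [].
  have -> : v ^~ x = (fun n => v 0%N x + series (fun n => v n.+1 x - v n x) n).
    apply/funext => n; rewrite /series /= telescope_sumr//.
    by rewrite addrC subrK.
  apply: is_cvgD; first exact: is_cvg_cst.
  apply: normed_cvg; apply: (series_le_cvg _ _ dv) => //.
    by move=> n; rewrite divr_ge0// addr_ge0.
  rewrite (_ : (fun n => _) = geometric ((C + 1) / 2) (1 / 2)); last first.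
    apply/funext => n; rewrite /geometric/= expnS natrM natrX exprMn expr1n mul1r.
    by rewrite invfM mulrA exprVn.
  by apply: is_cvg_geometric_series; rewrite ger0_norm; lra.
have mDN : measurable (D `\` N) by exact: measurableD.
have wE n : w n = v n \_ (D `\` N) by [].
have mw n : measurable_fun D (w n).
  rewrite wE; apply/measurable_restrict => //.
  by apply: measurable_funS (L2m (Lv n)) => // x [].
have mf : measurable_fun D f by apply: measurable_fun_cvg mw _ => x _; exact: wf.
have aew n : {ae mu, forall x, D x -> w n x = v n x}.
  exists N; split=> // x /= H; apply: contrapT => Nx; apply: H => Dx.
  by rewrite /w ifT// inE.
(* Fatou's lemma bounds the distance to the limit *)
have key e : 0 < e -> exists M, forall n, (M <= n)%N ->
    (\int[mu]_(x in D) ((u n x - f x) ^+ 2)%:E <= e%:E)%E.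
  move=> e0; have [M MP] := cu e e0; exists M => n Mn.
  have mwn k : measurable_fun D (fun x => ((u n x - w k x) ^+ 2)%:E).
    apply/measurable_EFinP; apply: measurable_funX; apply: measurable_funB => //.
    exact: L2m.
  have nn k x : D x -> (0 <= ((u n x - w k x) ^+ 2)%:E)%E.
    by move=> _; rewrite lee_fin sqr_ge0.
  have := fatou mu mD mwn nn.
  set L := (X in (X <= _)%E -> _) => FT.
  have -> : (\int[mu]_(x in D) ((u n x - f x) ^+ 2)%:E)%E = L.
    apply: eq_integral => x _.
    have : ((u n x - w k x) ^+ 2)%:E @[k --> \oo] --> ((u n x - f x) ^+ 2)%:E.
      apply: cvg_EFin; first exact: nearW.
      apply: (@cvg_comp _ _ _ (fun k => u n x - w k x) (fun y => y ^+ 2)).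
        by apply: cvgB; [exact: cvg_cst|exact: wf].
      exact: exprn_continuous.
    by move/cvg_limn_einf_sup => [->].
  apply: le_trans FT _; rewrite limn_einf_lim.
  apply: lime_le; first exact: is_cvg_einfs.
  near=> k.
  apply: (@le_trans _ _ (\int[mu]_(x in D) ((u n x - w k x) ^+ 2)%:E)%E).
    by apply: ereal_inf_lbound; exists k => /=.
  have -> : (\int[mu]_(x in D) ((u n x - w k x) ^+ 2)%:E)%E =
      (\int[mu]_(x in D) ((u n x - v k x) ^+ 2)%:E)%E.
    apply: ge0_ae_eq_integral => //.
    - by apply/measurable_EFinP; apply: measurable_funX; apply: measurable_funB;
        exact: L2m.
    - by move=> x _; rewrite lee_fin sqr_ge0.
    - by move=> x _; rewrite lee_fin sqr_ge0.
    - by have := aew k; apply: filterS => x H Dx; rewrite H.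
  rewrite (dotE mD); last exact: L2B.
  rewrite lee_fin; apply: MP => //.
  rewrite (@leq_trans k)//; last exact: leq_addl.
  by near: k; exact: nbhs_infty_ge.
have mfB n : measurable_fun D (fun x => u n x - f x).
  by apply: measurable_funB => //; exact: L2m.
have [M0 M0P] := key 1 ltr01.
have Lf : L2 f.
  apply: (@L2_eq _ _ _ _ _ mD (fun x => u M0 x - (u M0 x - f x))).
    by move=> x _; rewrite subKr.
  apply: L2B => //; split=> //.
  by apply: le_lt_trans (M0P M0 (leqnn _)) _; exact: ltry.
exists f; split=> //; apply/cvgrPdist_le => e e0.
have [M MP] := key e e0; exists M => // n /= Mn.
rewrite sub0r normrN ger0_norm ?dot_ge0// -lee_fin -(dotE mD); first exact: MP.
exact: L2B.
Unshelve. all: by end_near. Qed.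

End L2Completeness.

(** * Integration against signed measures *)

Section ChargeIntegral.
Context {R : realType} d (T : measurableType d).
Implicit Types (nu : {charge set T -> \bar R}) (m : {measure set T -> \bar R})
  (W : set T) (phi h : T -> R).

Lemma bounded_integrable m W phi c : measurable W -> (m W < +oo)%E ->
  measurable_fun W phi -> (forall x, W x -> `|phi x| <= c) ->
  m.-integrable W (EFin \o phi).
Proof.
move=> mW fm mphi phic; apply: measurable_bounded_integrable => //.
exists c; split; first exact: num_real.
by move=> M cM x Wx /=; rewrite (le_trans (phic x Wx))// ltW.
Qed.

(** The integral against a signed measure can be computed from any
    decomposition as a difference of finite measures, not only from Jordan's. *)
Lemma charge_integral_diff nu m1 m2 W phi c : measurable W ->
  (m1 W < +oo)%E -> (m2 W < +oo)%E ->
  (forall A, measurable A -> A `<=` W -> (nu A + m2 A = m1 A)%E) ->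
  measurable_fun W phi -> (forall x, W x -> `|phi x| <= c) ->
  charge_integral nu W phi = \int[m1]_(x in W) phi x - \int[m2]_(x in W) phi x.
Proof.
move=> mW f1 f2 nuE mphi phic.
set jp := jordan_pos (hahnPN nu); set jn := jordan_neg (hahnPN nu).
have fp : (jp W < +oo)%E by rewrite ltey_eq fin_num_measure.
have fn : (jn W < +oo)%E by rewrite ltey_eq fin_num_measure.
have i m : (m W < +oo)%E -> m.-integrable W (EFin \o phi).
  by move=> fm; exact: bounded_integrable phic.
have E : (\int[measure_add jp m2]_(x in W) (phi x)%:E =
          \int[measure_add jn m1]_(x in W) (phi x)%:E)%E.
  apply: eq_measure_integral => A mA AW.
  rewrite [LHS](measure_addE jp m2) [RHS](measure_addE jn m1).
  have fA m : (m W < +oo)%E -> m A \is a fin_num.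
    move=> fm; rewrite ge0_fin_numE//; apply: le_lt_trans fm.
    by apply: le_measure; rewrite ?inE.
  have := nuE A mA AW; rewrite (jordan_decomp (hahnPN nu) mA).
  rewrite /cadd/= cscaleN1 -/jp -/jn => <-.
  move: (fA jp fp) (fA jn fn) (fA m2 f2); rewrite /jp /jn/=.
  move: (jordan_pos _ A) (jordan_neg _ A) (m2 A) => [a| |] [b| |] [e| |] //= _ _ _.
  by rewrite -!EFinD; congr (_%:E); ring.
move: E; rewrite !integral_measure_add//; try exact: i.
rewrite /charge_integral /Rintegral -/jp -/jn.
have fi m : (m W < +oo)%E -> (\int[m]_(x in W) (phi x)%:E)%E \is a fin_num.
  by move=> fm; apply: integrable_fin_num => //; exact: i.
move: (fi _ fp) (fi _ fn) (fi _ f1) (fi _ f2).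
move: (integral jp _ _) (integral jn _ _) (integral m1 _ _) (integral m2 _ _).
move=> [a| |] [b| |] [p| |] [q| |] //= _ _ _ _ [] H.
by lra.
Qed.

(** Among these decompositions, Jordan's has the smallest mass. *)
Lemma charge_variation_le nu m1 m2 W : measurable W ->
  (m1 W < +oo)%E -> (m2 W < +oo)%E ->
  (forall A, measurable A -> A `<=` W -> (nu A + m2 A = m1 A)%E) ->
  (charge_total_variation nu W <= m1 W + m2 W)%E.
Proof.
move=> mW f1 f2 nuE.
rewrite /charge_total_variation /charge_variation/=.
have [[mP _] [mN _] PN PN0] := hahnPN nu.
have mWP : measurable (W `&` hahn_pos nu) by exact: measurableI.
have mWN : measurable (W `&` hahn_neg nu) by exact: measurableI.
rewrite jordan_posE cjordan_posE jordan_negE cjordan_negE /crestr0 !mem_set// /crestr.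
have fA m A : measurable A -> A `<=` W -> (m W < +oo)%E -> m A \is a fin_num.
  move=> mA AW fm; rewrite ge0_fin_numE//; apply: le_lt_trans fm.
  by apply: le_measure; rewrite ?inE.
have nuE' A : measurable A -> A `<=` W -> (nu A = m1 A - m2 A)%E.
  by move=> mA AW; rewrite -(nuE A)// addeK//; exact: fA.
have split m : (m W = m (W `&` hahn_pos nu) + m (W `&` hahn_neg nu))%E.
  rewrite -measureU//; first by rewrite -setIUr PN setIT.
  by rewrite setIACA PN0 setI0.
rewrite !nuE'//; try exact: subIsetl.
rewrite (split m1) (split m2).
move: (fA m1 _ mWP (@subIsetl _ _ _) f1) (fA m1 _ mWN (@subIsetl _ _ _) f1).
move: (fA m2 _ mWP (@subIsetl _ _ _) f2) (fA m2 _ mWN (@subIsetl _ _ _) f2).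
have g m A : (0 <= m A)%E := measure_ge0 m A.
move: (g m1 (W `&` hahn_pos nu)) (g m1 (W `&` hahn_neg nu)).
move: (g m2 (W `&` hahn_pos nu)) (g m2 (W `&` hahn_neg nu)).
move: (m1 _) (m1 _) (m2 _) (m2 _) => [a| |] [b| |] [p| |] [q| |] //=.
by rewrite !lee_fin; lra.
Qed.

Lemma charge_integral_le nu W phi c : measurable W ->
  measurable_fun W phi -> (forall x, W x -> `|phi x| <= c) -> 0 <= c ->
  ((charge_integral nu W phi)%:E <= c%:E * charge_total_variation nu W)%E.
Proof.
move=> mW mphi phic c0.
have J (m : {finite_measure set T -> \bar R}) :
    (`| \int[m]_(x in W) phi x |%:E <= c%:E * m W)%E.
  have im : m.-integrable W (EFin \o phi).
    by apply: bounded_integrable phic => //; rewrite ltey_eq fin_num_measure.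
  apply: (@le_trans _ _ (\int[m]_(x in W) `|phi x|)%:E).
    by rewrite lee_fin le_normr_Rintegral.
  apply: (@le_trans _ _ (\int[m]_(x in W) c%:E)%E); last by rewrite integral_cst.
  rewrite /Rintegral fineK; last first.
    by apply: integrable_fin_num => //; exact: integrable_norm.
  apply: ge0_le_integral => //.
  by apply/measurable_EFinP; exact: measurableT_comp.
rewrite /charge_total_variation /charge_variation /charge_integral /=.
rewrite ge0_muleDr//.
apply: le_trans (leeD (J _) (J _)); rewrite -EFinD lee_fin.
set a := Rintegral _ _ _; set b := Rintegral _ _ _.
have := ler_norm a; have := ler_norm (- b); rewrite normrN; lra.
Qed.

End ChargeIntegral.

Section Density.
Context {R : realType} d (T : measurableType d).
Variables (mu : {sigma_finite_measure set T -> \bar R}) (f : T -> \bar R).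
Hypotheses (intf : mu.-integrable setT f) (f0 : forall x, (0 <= f x)%E).
Local Open Scope charge_scope.

(** The measure with density [f] with respect to [mu].  The two hypotheses are
    arguments because it is a finite measure only under them. *)
Definition density of mu.-integrable setT f & (forall x, (0 <= f x)%E) :
  set T -> \bar R := fun A => (\int[mu]_(x in A) f x)%E.

Local Notation m := (density intf f0).

Let m0 : m set0 = 0%E. Proof. exact: integral_set0. Qed.
Let m_ge0 A : (0 <= m A)%E. Proof. exact: integral_ge0. Qed.
Let m_add : semi_sigma_additive m.
Proof. by apply: semi_sigma_additive_nng_induced => //; exact: measurable_int intf. Qed.

HB.instance Definition _ := isMeasure.Build _ _ _ m m0 m_ge0 m_add.

Let m_fin : fin_num_fun m.
Proof.
by move=> A mA; apply: integrable_fin_num => //; exact: integrableS intf.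
Qed.

HB.instance Definition _ := @Measure_isFinite.Build _ _ _ m m_fin.

Lemma density_dominated : m `<< mu.
Proof.
apply/null_content_dominatesP => A mA muA; apply: null_set_integral => //.
by apply: measurable_funTS; exact: measurable_int intf.
Qed.

Lemma integral_density W (phi : T -> \bar R) : measurable W ->
  [the {measure set T -> \bar R} of m].-integrable W phi ->
  (\int[m]_(x in W) phi x = \int[mu]_(x in W) (phi x * f x))%E.
Proof.
move=> mW iphi; have dm := density_dominated.
rewrite -(Radon_Nikodym_change_of_variables dm mW iphi).
have dm' : charge_of_finite_measure m `<< mu by [].
have mphi : measurable_fun W phi by exact: measurable_int iphi.
have mf : measurable_fun W f by apply: measurable_funTS; exact: measurable_int intf.
apply: ae_eq_integral => //.
- apply: emeasurable_funM => //; apply: measurable_funTS.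
  exact: measurable_int (Radon_Nikodym_integrable dm').
- exact: emeasurable_funM.
apply: ae_eqe_mul2l; apply: (ae_eq_subset (@subsetT _ W)).
apply: integral_ae_eq => //; first exact: Radon_Nikodym_integrable.
- exact: measurable_int intf.
by move=> E _ mE; rewrite -Radon_Nikodym_integral.
Qed.

End Density.

(** * Norms of functionals represented by measures *)

Section RadonPerturbation.
Context {R : realType} d (T : measurableType d).
Variable mu : {sigma_finite_measure set T -> \bar R}.
Variables (W : set T) (test : set (T -> R)).
Hypothesis mW : measurable W.
Hypothesis test_bounded : forall phi, test phi ->
  measurable_fun W phi /\ exists c : R, forall x, W x -> `|phi x| <= c.
Implicit Types (nu : {charge set T -> \bar R}) (L : (T -> R) -> R) (h phi : T -> R).

Let Rintegral_mscale (s : {nonneg R}) (m : {measure set T -> \bar R}) phi :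
  (m W < +oo)%E -> m.-integrable W (EFin \o phi) ->
  (\int[mscale s m]_(x in W) (phi x)%:E = s%:num%:E * \int[m]_(x in W) (phi x)%:E)%E.
Proof.
move=> fm iphi; have mphi := measurable_int _ iphi.
set f := EFin \o phi in iphi mphi *.
have E (k : T -> \bar R) : measurable_fun W k -> (forall x, W x -> (0 <= k x)%E) ->
    (\int[mscale s m]_(x in W) k x = s%:num%:E * \int[m]_(x in W) k x)%E.
  by move=> mk k0; rewrite ge0_integral_mscale.
rewrite -[LHS]/(\int[mscale s m]_(x in W) f x)%E -[X in (_ = _ * X)%E]/(\int[m]_(x in W) f x)%E.
rewrite (@integralE _ _ _ (mscale s m)) (@integralE _ _ _ m) !E//.
- rewrite (@muleBr _ _ (\int[m]_(x in W) f^\+ x)%E (\int[m]_(x in W) f^\- x)%E)//.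
  apply: fin_num_adde_defr; apply: integrable_fin_num => //.
  exact: integrable_funepos.
- exact: measurable_funeneg.
- exact: measurable_funepos.
Qed.

(** Scaling a functional represented by a signed measure by [s >= 0] and adding
    an integrable density keeps it represented by a signed measure. *)
Lemma represents_perturb L nu (s : R) h : 0 <= s ->
  mu.-integrable W (EFin \o h) -> represents W test L nu ->
  exists nu', represents W test
      (fun phi => s * L phi + \int[mu]_(x in W) (h x * phi x)) nu' /\
    (charge_total_variation nu' W <=
       s%:E * charge_total_variation nu W + \int[mu]_(x in W) `|h x|%:E)%E.
Proof.
move=> s0 ih rL.
pose hW : T -> \bar R := (EFin \o h) \_ W.
have ihW : mu.-integrable setT hW by exact: (integrable_mkcond (EFin \o h) mW).1.
pose ip := integrable_funepos measurableT ihW.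
pose iN := integrable_funeneg measurableT ihW.
pose dp : {finite_measure set T -> \bar R} := density ip (funepos_ge0 hW).
pose dn : {finite_measure set T -> \bar R} := density iN (funeneg_ge0 hW).
pose sn := NngNum s0.
pose jp : {finite_measure set T -> \bar R} := jordan_pos (hahnPN nu).
pose jn : {finite_measure set T -> \bar R} := jordan_neg (hahnPN nu).
have jdec A : measurable A -> nu A = (jp A - jn A)%E.
  by move=> mA; rewrite (jordan_decomp (hahnPN nu) mA) /cadd/= cscaleN1.
(* the perturbed charge is s nu + h^+ mu - h^- mu, which is the difference of
   the finite measures [m1] and [m2] *)
pose m1 := measure_add (mscale sn jp) dp.
pose m2 := measure_add (mscale sn jn) dn.
pose nu' : {charge set T -> \bar R} := cadd (cscale s nu)
  (cadd (charge_of_finite_measure dp) (copp (charge_of_finite_measure dn))).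
have fin (m : {finite_measure set T -> \bar R}) A : measurable A -> m A \is a fin_num.
  by move=> mA; exact: fin_num_measure.
have m1E A : m1 A = (s%:E * jp A + dp A)%E by exact: measure_addE.
have m2E A : m2 A = (s%:E * jn A + dn A)%E by exact: measure_addE.
have nuE A : measurable A -> A `<=` W -> (nu' A + m2 A = m1 A)%E.
  move=> mA _; rewrite m1E m2E.
  rewrite (_ : nu' A = (s%:E * nu A + (dp A - dn A))%E)//.
  rewrite jdec//.
  move: (fin dp A mA) (fin dn A mA) (fin jp A mA) (fin jn A mA).
  move: (dp A) (dn A) (jp A) (jn A) => [a| |] [b| |] [p| |] [q| |] // _ _ _ _.
  by rewrite -!(EFinD, EFinN, EFinM); congr (_%:E); ring.
have f1 : (m1 W < +oo)%E.
  by rewrite m1E ltey_eq fin_numD fin_numM ?fin.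
have f2 : (m2 W < +oo)%E.
  by rewrite m2E ltey_eq fin_numD fin_numM ?fin.
exists nu'; split.
  move=> phi tphi; have [mphi [c phic]] := test_bounded tphi.
  rewrite (rL _ tphi) (charge_integral_diff mW f1 f2 nuE mphi phic).
  have ib (m : {measure set T -> \bar R}) : (m W < +oo)%E ->
      m.-integrable W (EFin \o phi).
    by move=> fm; exact: bounded_integrable phic.
  have flt (m : {finite_measure set T -> \bar R}) : (m W < +oo)%E.
    by rewrite ltey_eq fin.
  have fs (m : {finite_measure set T -> \bar R}) : (mscale sn m W < +oo)%E.
    by rewrite ltey_eq /mscale/= fin_numM// fin.
  have fint (m : {measure set T -> \bar R}) : (m W < +oo)%E ->
      (\int[m]_(x in W) (phi x)%:E)%E \is a fin_num.
    by move=> fm; apply: integrable_fin_num => //; exact: ib.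
  have E1 (m e : {finite_measure set T -> \bar R}) :
      \int[measure_add (mscale sn m) e]_(x in W) phi x =
      s * \int[m]_(x in W) phi x + \int[e]_(x in W) phi x.
    rewrite /Rintegral integral_measure_add//; [|exact/ib/fs|exact/ib/flt].
    rewrite (Rintegral_mscale sn (flt m)) ?ib//; last exact: flt.
    rewrite fineD ?fineM ?fin_numM ?fint// ?flt//; exact: flt.
  rewrite [in RHS](E1 jp dp) [in RHS](E1 jn dn).
  have ihp : mu.-integrable W (EFin \o (fun x => h x * phi x)).
    rewrite (_ : _ \o _ = ((EFin \o h) \* (EFin \o phi))%E)//.
    apply: integrableMl => //; exists c; split; first exact: num_real.
    by move=> M cM x Wx /=; rewrite (le_trans (phic x Wx))// ltW.
  have E2 : \int[mu]_(x in W) (h x * phi x) =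
      \int[dp]_(x in W) phi x - \int[dn]_(x in W) phi x.
    rewrite /Rintegral -fineB; [congr fine|exact/fint/flt|exact/fint/flt].
    rewrite integral_density//; last exact/ib/flt.
    rewrite integral_density//; last exact/ib/flt.
    have hp x : W x -> (hW^\+ x = (Num.max (h x) 0)%:E)%E.
      by move=> Wx; rewrite funeposE /hW patchE mem_set//= EFin_max.
    have hn x : W x -> (hW^\- x = (Num.max (- h x) 0)%:E)%E.
      by move=> Wx; rewrite funenegE /hW patchE mem_set//= EFin_max EFinN.
    have mh : measurable_fun W h by apply/measurable_EFinP; exact: measurable_int ih.
    have im (k : T -> R) : measurable_fun W k -> (forall x, W x -> `|k x| <= `|h x|) ->
        mu.-integrable W (EFin \o (fun x => phi x * k x)).
      move=> mk kh; apply: le_integrable ihp => //.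
        by apply/measurable_EFinP; exact: measurable_funM.
      move=> x Wx /=; rewrite lee_fin !normrM mulrC ler_wpM2r//; exact: kh.
    have mx (a : R) : `|Num.max a 0| <= `|a|.
      by rewrite ger0_norm ?le_max ?lexx ?orbT// ge_max ler_norm/=.
    rewrite [X in (X - _)%E](eq_integral (EFin \o (fun x => phi x * Num.max (h x) 0))); last first.
      by move=> x /[!inE] Wx; rewrite hp.
    rewrite [X in (_ - X)%E](eq_integral (EFin \o (fun x => phi x * Num.max (- h x) 0))); last first.
      by move=> x /[!inE] Wx; rewrite hn.
    rewrite -integralB//; last 2 first.
    - apply: im; first exact: measurable_maxr.
      by move=> x _; exact: mx.
    - apply: im; first by apply: measurable_maxr => //; exact: measurableT_comp.
      by move=> x _; rewrite -(normrN (h x)); exact: mx.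
    apply: eq_integral => x _ /=; rewrite -EFinB; congr (_%:E).
    rewrite mulrC -mulrBr; congr (_ * _).
    by case: (leP (h x) 0) => hx; case: (leP (- h x) 0) => hx'; lra.
  rewrite E2 (_ : charge_integral nu W phi =
    \int[jp]_(x in W) phi x - \int[jn]_(x in W) phi x)//; ring.
apply: le_trans (charge_variation_le mW f1 f2 nuE) _.
rewrite (_ : charge_total_variation nu W = (jp W + jn W)%E)//.
rewrite -[leLHS]/(m1 W + m2 W)%E m1E m2E.
have E : (\int[mu]_(x in W) `|h x|%:E = dp W + dn W)%E.
  rewrite /dp /dn /density -ge0_integralD//; last 2 first.
  - by apply: measurable_funTS; exact: measurable_int ip.
  - by apply: measurable_funTS; exact: measurable_int iN.
  apply: eq_integral => x /[!inE] Wx.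
  by rewrite -[RHS]/((hW^\+ \+ hW^\-)%E x) -fune_abse /hW /= patchE mem_set.
rewrite E.
move: (fin dp W mW) (fin dn W mW) (fin jp W mW) (fin jn W mW).
move: (dp W) (dn W) (jp W) (jn W) => [a| |] [b| |] [p| |] [q| |] // _ _ _ _.
by rewrite -!(EFinD, EFinN, EFinM) lee_fin; lra.
Qed.

End RadonPerturbation.

Section RadonNorm.
Context {R : realType} d (T : measurableType d).
Variables (W : set T) (test : set (T -> R)).
Hypothesis mW : measurable W.
Hypothesis test_bounded : forall phi, test phi ->
  measurable_fun W phi /\ exists c : R, forall x, W x -> `|phi x| <= c.
Implicit Types (L : (T -> R) -> R) (h phi : T -> R).

Lemma eq_represents L L' : (forall phi, test phi -> L phi = L' phi) ->
  represents W test L = represents W test L'.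
Proof.
move=> LL'; apply/seteqP; split=> nu rL phi tphi.
  by rewrite -LL'// rL.
by rewrite LL'// rL.
Qed.

Lemma eq_Radon_norm L L' : (forall phi, test phi -> L phi = L' phi) ->
  Radon_norm W test L = Radon_norm W test L'.
Proof. by move=> LL'; rewrite /Radon_norm (eq_represents LL'). Qed.

Lemma Radon_norm_ge0 L : (0 <= Radon_norm W test L)%E.
Proof. by apply: le_ereal_inf_tmp => _ [nu _ <-]; exact: adde_ge0. Qed.

Lemma Radon_norm_perturb (mu : {sigma_finite_measure set T -> \bar R}) L (s : R) h :
  0 <= s -> mu.-integrable W (EFin \o h) -> (Radon_norm W test L < +oo)%E ->
  (Radon_norm W test
     (fun phi => (s * L phi + \int[mu]_(x in W) (h x * phi x))%R) <=
   s%:E * Radon_norm W test L + \int[mu]_(x in W) `|h x|%:E)%E.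
Proof.
move=> s0 ih fN; set N := Radon_norm W test L in fN *.
have finN : N \is a fin_num by rewrite ge0_fin_numE// Radon_norm_ge0.
apply/lee_addgt0Pr => e e0.
have e1 : 0 < e / (s + 1) by rewrite divr_gt0// ltr_wpDl.
have [_ [nu rL <-] nuN] := lb_ereal_inf_adherent e1 finN.
have [nu' [rL' nu'le]] := represents_perturb mW test_bounded s0 ih rL.
apply: le_trans (ereal_inf_lbound _) _; first by exists nu'.
apply: le_trans nu'le _.
rewrite addeAC leeD2r//.
apply: (@le_trans _ _ (s%:E * (N + (e / (s + 1))%:E))%E).
  by rewrite lee_wpmul2l ?lee_fin// ltW.
rewrite muleDr// ?fin_num_adde_defl//.
rewrite leeD2l// -EFinM lee_fin mulrA ler_pdivrMr ?ltr_wpDl//; nra.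
Qed.

(** A functional represented by a measure is bounded by its norm times the
    maximum of the test function. *)
Lemma Radon_norm_ge L phi c : test phi -> 0 < c ->
  (forall x, W x -> `|phi x| <= c) ->
  ((L phi)%:E <= c%:E * Radon_norm W test L)%E.
Proof.
move=> tphi c0 phic; rewrite muleC -lee_pdivrMr//.
apply: le_ereal_inf_tmp => _ [nu rL <-].
rewrite lee_pdivrMr// muleC (rL _ tphi).
by apply: charge_integral_le => //; [exact: (test_bounded tphi).1|exact: ltW].
Qed.

End RadonNorm.

(** * Slices of smooth functions *)

Section Slices.
Context {R : realType} {U V : normedModType R}.
Implicit Types phi : U * V -> R.

Lemma derive_slice1 phi t v x :
  'D_v (fun x => phi (x, t)) x = 'D_(v, 0) phi (x, t).
Proof.
rewrite /derive; congr (lim (_ @ 0^')); apply/funext => h /=.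
by rewrite (_ : h *: (v, 0) + (x, t) = (h *: v + x, t))// /GRing.add/= /add_pair/= scaler0 add0r.
Qed.

Lemma derive_slice2 phi t v x :
  'D_v (fun x => phi (t, x)) x = 'D_(0, v) phi (t, x).
Proof.
rewrite /derive; congr (lim (_ @ 0^')); apply/funext => h /=.
by rewrite (_ : h *: (0, v) + (t, x) = (t, h *: v + x))// /GRing.add/= /add_pair/= scaler0 add0r.
Qed.

Lemma derivable_slice1 phi t v x :
  derivable phi (x, t) (v, 0) -> derivable (fun x => phi (x, t)) x v.
Proof.
rewrite /derivable; set a := (X in cvg (X @ _)); set b := (X in _ -> cvg (X @ _)).
suff -> : a = b by [].
apply/funext => h; rewrite /a /b /=.
by rewrite (_ : h *: (v, 0) + (x, t) = (h *: v + x, t))// /GRing.add/= /add_pair/= scaler0 add0r.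
Qed.

Lemma derivable_slice2 phi t v x :
  derivable phi (t, x) (0, v) -> derivable (fun x => phi (t, x)) x v.
Proof.
rewrite /derivable; set a := (X in cvg (X @ _)); set b := (X in _ -> cvg (X @ _)).
suff -> : a = b by [].
apply/funext => h; rewrite /a /b /=.
by rewrite (_ : h *: (0, v) + (t, x) = (t, h *: v + x))// /GRing.add/= /add_pair/= scaler0 add0r.
Qed.

Lemma smooth_slice1 phi t : smooth phi -> smooth (fun x => phi (x, t)).
Proof.
move=> sphi n; elim: n phi sphi => [|n IH] phi sphi.
  split=> // x; apply: (@continuous_comp _ _ _ (fun x => (x, t)) phi).
    by apply: cvg_pair; [exact: cvg_id|exact: cvg_cst].
  exact: smooth_continuous.
split; first by apply: (@Cn_continuous _ _ n); exact: IH.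
move=> v; split.
  by move=> x; apply: derivable_slice1; exact: smooth_derivable.
rewrite (_ : 'D_v _ = fun x => 'D_(v, 0) phi (x, t)).
  by apply: (IH ('D_(v, 0) phi)); exact: smooth_derive.
by apply/funext => x; exact: derive_slice1.
Qed.

Lemma smooth_slice2 phi t : smooth phi -> smooth (fun x => phi (t, x)).
Proof.
move=> sphi n; elim: n phi sphi => [|n IH] phi sphi.
  split=> // x; apply: (@continuous_comp _ _ _ (fun x => (t, x)) phi).
    by apply: cvg_pair; [exact: cvg_cst|exact: cvg_id].
  exact: smooth_continuous.
split; first by apply: (@Cn_continuous _ _ n); exact: IH.
move=> v; split.
  by move=> x; apply: derivable_slice2; exact: smooth_derivable.
rewrite (_ : 'D_v _ = fun x => 'D_(0, v) phi (t, x)).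
  by apply: (IH ('D_(0, v) phi)); exact: smooth_derive.
by apply/funext => x; exact: derive_slice2.
Qed.

(** Slices of a test function are test functions on any set containing the
    projection of its domain. *)
Lemma testfun_slice1 (W : set (U * V)) (w : set U) phi t :
  (forall y, W y -> w y.1) -> testfun W phi -> testfun w (fun x => phi (x, t)).
Proof.
move=> Ww [sphi [K [cK KW phi0]]]; split; first exact: smooth_slice1.
exists (fst @` K); split.
- apply: continuous_compact => //; apply: continuous_subspaceT => x.
  exact: cvg_fst.
- by move=> _ [y Ky <-]; exact/Ww/KW.
- by move=> x Kx; apply: phi0 => Kxt; apply: Kx; exists (x, t).
Qed.

Lemma testfun_slice2 (W : set (U * V)) (w : set V) phi t :
  (forall y, W y -> w y.2) -> testfun W phi -> testfun w (fun x => phi (t, x)).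
Proof.
move=> Ww [sphi [K [cK KW phi0]]]; split; first exact: smooth_slice2.
exists (snd @` K); split.
- apply: continuous_compact => //; apply: continuous_subspaceT => x.
  exact: cvg_snd.
- by move=> _ [y Ky <-]; exact/Ww/KW.
- by move=> x Kx; apply: phi0 => Kxt; apply: Kx; exists (t, x).
Qed.

End Slices.

Section IntegralDerivative.
Context {R : realType}.
Local Notation leb := (@lebesgue_measure R).

(** The derivative of a compactly supported function on the line integrates to
    zero. *)
Lemma integral_derive_line (u : R^o -> R) : testfun [set: R^o] u ->
  (\int[leb]_t ('D_(1 : R^o) u t)%:E = 0)%E.
Proof.
move=> tu; have [su [K [cK _ u0]]] := tu.
have [M [_ MK]] := compact_bounded cK.
pose m := `|M| + 1.
have m0 : 0 < m by rewrite ltr_wpDl.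
(* the support of [u] lies inside of ]- m, m[ *)
have off t : m <= `|t| -> ~ K t.
  move=> mt Kt; have := MK (`|M| + 1 / 2).
  rewrite (le_lt_trans (ler_norm M)) ?ltrDl ?divr_gt0// => /(_ isT t Kt)/=.
  rewrite leNgt => /negP; apply; apply: lt_le_trans mt; rewrite /m; lra.
have u0m t : m <= `|t| -> u t = 0 by move=> /off; exact: u0.
have d0m t : m <= `|t| -> 'D_(1 : R^o) u t = 0.
  by move=> /off; exact: derive_off_compact.
have E : (fun t => ('D_(1 : R^o) u t)%:E) =
    (fun t => ('D_(1 : R^o) u t)%:E) \_ `[- m, m].
  apply/funext => t; rewrite patchE; case: ifPn => // tm.
  rewrite d0m// leNgt; apply: contra tm => tm.
  by rewrite inE/= in_itv/= -ler_norml ltW.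
rewrite E -integral_mkcond.
have du t : derivable u t 1 by exact: smooth_derivable.
have cu : continuous u by exact: smooth_continuous.
rewrite (@continuous_FTC2 _ ('D_(1 : R^o) u) u).
- by rewrite !u0m ?subee// ?normrN gtr0_norm.
- by rewrite ltrN10 || lra.
- apply: continuous_subspaceT; exact: (smooth_continuous (smooth_derive _ su)).
- split.
  + by move=> t _; exact: du.
  + by apply: cvg_at_right_filter; exact: cu.
  + by apply: cvg_at_left_filter; exact: cu.
- by move=> t _; rewrite derive1E.
Qed.

End IntegralDerivative.

(** * Test functions on a bounded open set *)

Section PlaneIntegrals.
Context {R : realType}.
Local Notation leb := (@lebesgue_measure R).

Lemma bounded_box2 (S : set (R * R)) : bounded_set S ->
  exists M : R, 0 < M /\ S `<=` `[- M, M] `*` `[- M, M].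
Proof.
move=> [M [_ SM]]; exists (`|M| + 1); split; first by rewrite ltr_wpDl.
move=> x Sx; have := SM (`|M| + 1) _ x Sx.
rewrite (le_lt_trans (ler_norm M)) ?ltrDl// => /(_ isT).
rewrite /= prod_normE ge_max => /andP[].
by rewrite !ler_norml !in_itv.
Qed.

Lemma bounded_leb2_lty (S : set (R * R)) : measurable (S : set (mplane R)) ->
  bounded_set S -> (@leb2 R S < +oo)%E.
Proof.
move=> mS /bounded_box2[M [M0 SM]].
apply: (@le_lt_trans _ _ (@leb2 R (`[- M, M] `*` `[- M, M]))).
  by apply: le_measure; rewrite ?inE//; exact: measurableX.
rewrite /leb2 product_measure1E// /= !lebesgue_measure_itv/= !lte_fin.
by case: ifP => _; rewrite -?EFinD -?EFinM ?mule0 ltry.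
Qed.

Lemma bounded_leb3_lty (S : set (R * R * R)) : measurable (S : set (mspace R)) ->
  bounded_set S -> (@leb3 R S < +oo)%E.
Proof.
move=> mS [M [_ SM]]; pose m := `|M| + 1.
have m0 : 0 < m by rewrite ltr_wpDl.
apply: (@le_lt_trans _ _ (@leb3 R ((`[- m, m] `*` `[- m, m]) `*` `[- m, m]))).
  apply: le_measure; rewrite ?inE//; first by do 2 apply: measurableX => //.
  move=> x Sx; have := SM m _ x Sx.
  rewrite (le_lt_trans (ler_norm M)) ?ltrDl// => /(_ isT).
  rewrite /= !prod_normE !ge_max => /andP[/andP[]].
  by rewrite !ler_norml !in_itv.
rewrite /leb3 product_measure1E//; last exact: measurableX.
rewrite lte_mul_pinfty//.
- rewrite ge0_fin_numE// bounded_leb2_lty//; first exact: measurableX.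
  exists m; split; first exact: num_real.
  move=> r mr x [/= x1 x2]; rewrite prod_normE ge_max !ler_norml.
  by move: x1 x2; rewrite !in_itv/= => ? ?; apply/andP; split; lra.
- rewrite /= lebesgue_measure_itv/= lte_fin.
  by case: ifP => _; rewrite -?EFinD ltry.
Qed.

Variable w : set (R * R).
Hypotheses (ow : open w) (bw : bounded_set w).
Local Notation test := (testfun w).

Lemma domain_measurable : measurable (w : set (mplane R)).
Proof. exact: open_measurable2. Qed.

Lemma domain_lty : (@leb2 R w < +oo)%E.
Proof. by apply: bounded_leb2_lty => //; exact: domain_measurable. Qed.

Lemma continuous_measurable_on2 (f : R * R -> R) (D : set (mplane R)) :
  continuous f -> measurable_fun D f.
Proof. by move=> cf; apply: measurable_funTS; exact: continuous_measurable2. Qed.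

Lemma testfun_measurable phi (D : set (mplane R)) : test phi -> measurable_fun D phi.
Proof. by move=> tphi; apply: continuous_measurable_on2; exact: testfun_continuous tphi. Qed.

Lemma testfun_L2 phi : test phi -> L2 (@leb2 R) w phi.
Proof.
move=> tphi; have [M [M0 HM]] := testfun_bounded tphi.
apply: (@bounded_L2 _ _ _ (@leb2 R) _ domain_measurable _ M domain_lty).
  exact: testfun_measurable.
by move=> x _; exact: HM.
Qed.

Lemma testfun_integrable phi : test phi -> (@leb2 R).-integrable w (EFin \o phi).
Proof.
move=> tphi; have [M [M0 HM]] := testfun_bounded tphi.
apply: bounded_integrable => //.
- exact: domain_measurable.
- exact: domain_lty.
- exact: testfun_measurable.
Qed.

Lemma testfun_patch phi : test phi -> (EFin \o phi) \_ w = EFin \o phi.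
Proof.
move=> tphi; apply/funext => x; rewrite patchE; case: ifPn => //=.
by rewrite notin_setE => /(testfun_off tphi) ->.
Qed.

Lemma testfun_integrableT phi : test phi ->
  (@leb2 R).-integrable setT (EFin \o phi).
Proof.
move=> tphi; have := testfun_integrable tphi.
move/(@integrable_mkcond _ (mplane R) R (@leb2 R) w (EFin \o phi)
  domain_measurable).1.
by rewrite testfun_patch.
Qed.

Let slice1 phi y : test phi -> testfun [set: R^o] (fun x : R^o => phi (x, y)).
Proof. by apply: (@testfun_slice1 R R^o R^o w). Qed.

Let slice2 phi y : test phi -> testfun [set: R^o] (fun x : R^o => phi (y, x)).
Proof. by apply: (@testfun_slice2 R R^o R^o w). Qed.

(** Partial derivatives of test functions have zero mean. *)
Lemma integral_derive1 phi : test phi -> \int[@leb2 R]_(x in w) 'D_e1 phi x = 0.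
Proof.
move=> tphi; have td := testfun_derive e1 tphi.
rewrite /Rintegral integral_mkcond (testfun_patch td).
rewrite -(integral21_prod_meas1 (testfun_integrableT td)) integral0_eq// => y _.
rewrite /fubini_G/= -[RHS](integral_derive_line (slice1 y tphi)).
by apply: eq_integral => x _; rewrite (@derive_slice1 R R^o R^o).
Qed.

Lemma integral_derive2 phi : test phi -> \int[@leb2 R]_(x in w) 'D_e2 phi x = 0.
Proof.
move=> tphi; have td := testfun_derive e2 tphi.
rewrite /Rintegral integral_mkcond (testfun_patch td).
rewrite -(integral12_prod_meas1 (testfun_integrableT td)) integral0_eq// => y _.
rewrite /fubini_F/= -[RHS](integral_derive_line (slice2 y tphi)).
by apply: eq_integral => x _; rewrite (@derive_slice2 R R^o R^o).
Qed.

End PlaneIntegrals.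

(** * The space H^1_0 *)

Section SobolevTheory.
Context {R : realType}.
Variable w : set (R * R).
Hypotheses (ow : open w) (bw : bounded_set w).
Local Notation test := (@testfun R (R * R)%type w).
Local Notation L2w := (L2 (@leb2 R) w).
Local Notation ip := (dot (@leb2 R) w).
Local Notation cvg2 := (cvgL2 (@leb2 R) w).
Local Notation mw := (domain_measurable ow).
Implicit Types (phi psi f g h : R * R -> R).

Let ipC f g : ip f g = ip g f. Proof. exact: dotC. Qed.

Let ipDl f g h : L2w f -> L2w g -> L2w h ->
  ip (fun x => f x + g x) h = ip f h + ip g h.
Proof. exact: (dotDl mw). Qed.

Let ipDr f g h : L2w f -> L2w g -> L2w h ->
  ip h (fun x => f x + g x) = ip h f + ip h g.
Proof. exact: (dotDr mw). Qed.

Let ipZl c f g : L2w f -> L2w g -> ip (fun x => c * f x) g = c * ip f g.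
Proof. exact: (dotZl mw). Qed.

Let ipZr c f g : L2w f -> L2w g -> ip g (fun x => c * f x) = c * ip g f.
Proof. exact: (dotZr mw). Qed.

Let L2Dw f g : L2w f -> L2w g -> L2w (fun x => f x + g x).
Proof. exact: (L2D mw). Qed.

Let L2Bw f g : L2w f -> L2w g -> L2w (fun x => f x - g x).
Proof. exact: (L2B mw). Qed.

Let L2Zw c f : L2w f -> L2w (fun x => c * f x).
Proof. exact: (L2Z mw). Qed.

Lemma testfun_derive_L2 phi v : test phi -> L2w ('D_v phi).
Proof. by move=> tphi; apply: testfun_L2 => //; exact: testfun_derive. Qed.

Lemma smooth_fst : smooth (fst : R * R -> R).
Proof.
have D (v x : R * R) : is_derive x v (fst : R * R -> R) v.1.
  have E : (fun h : R => h^-1 *: (((fst : R * R -> R) \o shift x) (h *: v) - x.1))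
      @ 0^' --> v.1.
    apply: cvg_near_cst; near=> h.
    have h0 : h != 0 by near: h; exact: nbhs_dnbhs_neq.
    by rewrite /= addrK scalerA mulVf// scale1r.
  by apply: DeriveDef; [apply/cvg_ex; exists v.1|exact/cvg_lim].
have c : continuous (fst : R * R -> R) by move=> x; exact: cvg_fst.
move=> [|n]; split=> // v; split; first by move=> x; have [] := D v x.
rewrite (_ : 'D_v _ = cst v.1); first exact: Cn_cst.
by apply/funext => x; have [_ ->] := D v x.
Unshelve. all: by end_near. Qed.

(** Integration by parts between test functions. *)
Lemma dot_derive1 phi psi : test phi -> test psi -> ip phi ('D_e1 psi) = - ip ('D_e1 phi) psi.
Proof.
move=> tphi tpsi; have tm : test (fun x => phi x * psi x) by exact: (testfunM tphi.1).
have := integral_derive1 ow bw tm.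
have -> : \int[@leb2 R]_(x in w) 'D_e1 (fun y => phi y * psi y) x =
    ip phi ('D_e1 psi) + ip ('D_e1 phi) psi.
  have I1 := L2_mul_integrable mw (testfun_L2 ow bw tphi) (testfun_derive_L2 e1 tpsi).
  have I2 := L2_mul_integrable mw (testfun_derive_L2 e1 tphi) (testfun_L2 ow bw tpsi).
  rewrite /dot -(RintegralD mw I1 I2); apply: eq_Rintegral => x _.
  rewrite (@deriveM _ _ phi psi).
  - by rewrite /GRing.scale/= (mulrC (psi x)).
  - exact: testfun_derivable tphi.
  - exact: testfun_derivable tpsi.
by move/eqP; rewrite addr_eq0 => /eqP.
Qed.

Lemma dot_derive2 phi psi : test phi -> test psi -> ip phi ('D_e2 psi) = - ip ('D_e2 phi) psi.
Proof.
move=> tphi tpsi; have tm : test (fun x => phi x * psi x) by exact: (testfunM tphi.1).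
have := integral_derive2 ow bw tm.
have -> : \int[@leb2 R]_(x in w) 'D_e2 (fun y => phi y * psi y) x =
    ip phi ('D_e2 psi) + ip ('D_e2 phi) psi.
  have I1 := L2_mul_integrable mw (testfun_L2 ow bw tphi) (testfun_derive_L2 e2 tpsi).
  have I2 := L2_mul_integrable mw (testfun_derive_L2 e2 tphi) (testfun_L2 ow bw tpsi).
  rewrite /dot -(RintegralD mw I1 I2); apply: eq_Rintegral => x _.
  rewrite (@deriveM _ _ phi psi).
  - by rewrite /GRing.scale/= (mulrC (psi x)).
  - exact: testfun_derivable tphi.
  - exact: testfun_derivable tpsi.
by move/eqP; rewrite addr_eq0 => /eqP.
Qed.

(** The Poincare inequality, from integrating the derivative of
    [x.1 * phi x ^+ 2]. *)
Lemma poincare : exists C : R, 0 < C /\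
  forall phi, test phi -> ip phi phi <= C * ip ('D_e1 phi) ('D_e1 phi).
Proof.
have [M [M0 wM]] := bounded_box2 bw.
exists (4 * M ^+ 2); split; first by rewrite mulr_gt0// exprn_gt0.
move=> phi tphi.
have Lp := testfun_L2 ow bw tphi.
have Ld := testfun_derive_L2 e1 tphi.
have mx1 : measurable_fun (w : set (mplane R)) (fst : R * R -> R).
  by apply: continuous_measurable_on2 => x; exact: cvg_fst.
have x1M (x : R * R) : w x -> `|x.1| <= M.
  by move=> /wM[/=]; rewrite in_itv/= ler_norml.
pose B := fun x : R * R => x.1 * 'D_e1 phi x.
have LB : L2w B by exact: (L2_mul_bounded mw mx1 x1M).
have tx : test (fun x : R * R => x.1 * phi x) by apply: testfunM => //; exact: smooth_fst.
(* the integral of D_1 (x.1 * phi^2) vanishes *)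
have E : ip phi phi + 2 * ip phi B = 0.
  have := dot_derive1 tx tphi.
  have -> : ip (fun x : R * R => x.1 * phi x) ('D_e1 phi) = ip phi B.
    by apply: eq_Rintegral => x _; rewrite /B; ring.
  have -> : 'D_e1 (fun x : R * R => x.1 * phi x) =
      (fun x => phi x + B x).
    apply/funext => x.
    rewrite (@deriveM _ _ (fst : R * R -> R) phi); last 2 first.
    - exact: (smooth_derivable smooth_fst).
    - exact: testfun_derivable tphi.
    have -> : 'D_e1 (fst : R * R -> R) x = 1.
      rewrite /derive; apply: cvg_lim => //; apply: cvg_near_cst; near=> h.
      have h0 : h != 0 by near: h; exact: nbhs_dnbhs_neq.
      by rewrite /= addrK /GRing.scale/= mulr1 mulVf.
    by rewrite /B /GRing.scale/= mulr1 addrC.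
  rewrite ipDl// (ipC B); lra.
have := dot_ge0 (@leb2 R) w (fun x : R * R => phi x + 2 * B x).
have L2B : L2w (fun x => 2 * B x) by exact: L2Zw.
rewrite ipDl ?ipDr ?ipZl ?ipZr//; last exact: L2Dw.
rewrite (ipC B).
have : ip B B <=
    M ^+ 2 * ip ('D_e1 phi) ('D_e1 phi).
  rewrite /dot -RintegralZl; [|exact: mw|by apply: L2_mul_integrable => //; exact: mw].
  apply: le_Rintegral; first exact: mw.
  - by apply: L2_mul_integrable => //; exact: mw.
  - rewrite (_ : _ \o _ = fun x => ((M ^+ 2)%:E * ('D_e1 phi x * 'D_e1 phi x)%:E)%E)//.
    apply: integrableZl; first exact: mw.
    by apply: L2_mul_integrable => //; exact: mw.
  - move=> x wx; rewrite -!expr2 exprMn ler_wpM2r ?sqr_ge0//.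
    by rewrite -(real_normK (num_real x.1)) lerXn2r ?nnegrE ?(ltW M0)// x1M.
move: E; move: (ip phi phi) (ip phi _) (ip _ _) (ip ('D_e1 phi) _) => a b c e E h1 h2.
by nra.
Unshelve. all: by end_near. Qed.

(** [phi n] are test functions converging to [u] in H^1, with gradients
    converging to [(G1, G2)]. *)
Definition H10_approx (phi : nat -> R * R -> R) (u G1 G2 : R * R -> R) : Prop :=
  [/\ forall n, test (phi n), [/\ L2w u, L2w G1 & L2w G2] &
    [/\ cvg2 phi u, cvg2 (fun n => 'D_e1 (phi n)) G1 &
        cvg2 (fun n => 'D_e2 (phi n)) G2]].

Lemma H10_approx_in_H10 (phi : nat -> R * R -> R) u G1 G2 : H10_approx phi u G1 G2 ->
  in_H10 w u (fun x => (G1 x, G2 x)).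
Proof.
move=> [tphi [Lu LG1 LG2] [cu c1 c2]].
have Lphi n := testfun_L2 ow bw (tphi n).
have L1 n := testfun_derive_L2 e1 (tphi n).
have L2' n := testfun_derive_L2 e2 (tphi n).
split.
  split=> // psi tpsi; have Lpsi := testfun_L2 ow bw tpsi.
  split.
    have A := cvgL2_dot mw Lphi Lu (testfun_derive_L2 e1 tpsi) cu.
    have B : (fun n => - ip ('D_e1 (phi n)) psi) @ \oo --> - ip G1 psi.
      by apply: cvgN; exact: (cvgL2_dot mw L1 LG1 Lpsi c1).
    have E : (fun n => ip (phi n) ('D_e1 psi)) = (fun n => - ip ('D_e1 (phi n)) psi).
      by apply/funext => n; exact: dot_derive1.
    rewrite E in A; exact: (cvg_unique (@norm_hausdorff _ R) A B).
  have A := cvgL2_dot mw Lphi Lu (testfun_derive_L2 e2 tpsi) cu.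
  have B : (fun n => - ip ('D_e2 (phi n)) psi) @ \oo --> - ip G2 psi.
    by apply: cvgN; exact: (cvgL2_dot mw L2' LG2 Lpsi c2).
  have E : (fun n => ip (phi n) ('D_e2 psi)) = (fun n => - ip ('D_e2 (phi n)) psi).
    by apply/funext => n; exact: dot_derive2.
  rewrite E in A; exact: (cvg_unique (@norm_hausdorff _ R) A B).
exists phi; split=> //.
have LB (f g : R * R -> R) : L2w f -> L2w g -> L2w (fun x => f x - g x).
  exact: L2Bw.
have E n : (\int[@leb2 R]_(x in w)
     ((phi n x - u x) ^+ 2 + normsq (grad (phi n) x - (G1 x, G2 x)))%:E)%E =
   (ip (fun x => phi n x - u x) (fun x => phi n x - u x) +
   (ip (fun x => 'D_e1 (phi n) x - G1 x) (fun x => 'D_e1 (phi n) x - G1 x) +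
    ip (fun x => 'D_e2 (phi n) x - G2 x) (fun x => 'D_e2 (phi n) x - G2 x)))%:E.
  rewrite !EFinD -!(dotE mw); try exact: LB.
  have m f : L2w f -> measurable_fun (w : set (mplane R)) (fun x => (f x ^+ 2)%:E).
    by move=> [mf _]; apply/measurable_EFinP; exact: measurable_funX.
  rewrite -ge0_integralD//; try exact: mw; try (by apply: m; exact: LB);
    try (by move=> x _; rewrite lee_fin sqr_ge0).
  rewrite -ge0_integralD//; try exact: mw; try (by apply: m; exact: LB);
    try (by move=> x _; rewrite lee_fin ?addr_ge0 ?sqr_ge0).
  by apply: emeasurable_funD; apply: m; exact: LB.
under eq_fun do rewrite E.
apply: cvg_EFin; first exact: nearW.
rewrite [X in _ --> X](_ : _ = 0 + (0 + 0)); last by rewrite !addr0.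
by apply: cvgD => //; exact: cvgD.
Qed.

Lemma in_H10_approx u G : in_H10 w u G ->
  exists phi : nat -> R * R -> R, H10_approx phi u (fun x => (G x).1) (fun x => (G x).2).
Proof.
move=> [[Lu LG1 LG2 _] [phi [tphi cphi]]]; exists phi; split=> //.
have Lphi n := testfun_L2 ow bw (tphi n).
have L1 n := testfun_derive_L2 e1 (tphi n).
have L2' n := testfun_derive_L2 e2 (tphi n).
have LB (f g : R * R -> R) : L2w f -> L2w g -> L2w (fun x => f x - g x).
  exact: L2Bw.
have K (v : nat -> R * R -> R) : (forall n, L2w (v n)) ->
    (forall n x, v n x ^+ 2 <= (phi n x - u x) ^+ 2 + normsq (grad (phi n) x - G x)) ->
    ip (v n) (v n) @[n --> \oo] --> (0 : R).
  move=> Lv vle.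
  have : (ip (v n) (v n))%:E @[n --> \oo] --> (0 : R)%:E.
    apply: (@squeeze_cvge _ _ _ _ (cst 0%E)); [|exact: cvg_cst|exact: cphi].
    apply: nearW => n; rewrite lee_fin dot_ge0/= -(dotE mw)//.
    apply: ge0_le_integral; first exact: mw.
    - by move=> x _; rewrite lee_fin sqr_ge0.
    - by apply/measurable_EFinP; apply: measurable_funX; have [] := Lv n.
    - apply/measurable_EFinP; apply: measurable_funD.
        by apply: measurable_funX; have [] := LB _ _ (Lphi n) Lu.
      apply: measurable_funD; apply: measurable_funX.
        by have [] := LB _ _ (L1 n) LG1.
      by have [] := LB _ _ (L2' n) LG2.
    - by move=> x _; rewrite lee_fin; exact: vle.
  by move/fine_cvgP => [].
split; apply: K => n; try exact: LB; move=> x; rewrite /normsq /grad /=.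
- by rewrite lerDl addr_ge0 ?sqr_ge0.
- by rewrite addrCA lerDl addr_ge0 ?sqr_ge0.
- by rewrite addrA lerDr addr_ge0 ?sqr_ge0.
Qed.

End SobolevTheory.

(** * The Dirichlet problem *)

(** Real arithmetic of the direct method.  In [parallelogram_le] and
    [variation_ge0], [A], [B], [C] stand for the energies
    of two functions and their cross term, [D], [E] for the values of the
    linear functional, and [m] for the infimum. *)
Section QuadraticInequalities.
Context {R : realType}.
Implicit Types a b c d s t r z : R.

Lemma comb_sum3 s t a b c a' b' c' :
  s * a + t * a' + (s * b + t * b') + (s * c + t * c') =
  s * (a + b + c) + t * (a' + b' + c').
Proof. ring. Qed.

Lemma comb_sum2 s t a b c a' b' c' :
  s ^+ 2 * a + 2 * s * t * b + t ^+ 2 * c +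
  (s ^+ 2 * a' + 2 * s * t * b' + t ^+ 2 * c') =
  s ^+ 2 * (a + a') + 2 * s * t * (b + b') + t ^+ 2 * (c + c').
Proof. ring. Qed.

Lemma young_sum a b c d1 d2 A1 A2 A3 y :
  a <= 1 * A1 + (4 * 1)^-1 * d1 -> b <= 1 * A2 + (4 * 1)^-1 * d2 ->
  c <= A3 + y -> y <= 4^-1 * d1 -> 0 <= d2 ->
  - (A1 + A2 + A3) <= 2^-1 * (d1 + d2) - (a + b + c).
Proof. by rewrite mulr1; lra. Qed.

Lemma young_arith a b c z : 0 < z ->
  0 <= (2 * z) ^+ 2 * a + 2 * (2 * z) * -1 * b + (-1) ^+ 2 * c ->
  b <= z * a + (4 * z)^-1 * c.
Proof.
move=> z0; rewrite -(@pmulr_rge0 _ ((4 * z)^-1)) ?invr_gt0 ?mulr_gt0//.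
have -> : (4 * z)^-1 * ((2 * z) ^+ 2 * a + 2 * (2 * z) * -1 * b + (-1) ^+ 2 * c)
    = z * a - b + (4 * z)^-1 * c by field; rewrite gt_eqF.
lra.
Qed.

Lemma parallelogram_le m A B C D E r r' :
  2^-1 * B - E < m + r' -> 2^-1 * A - D < m + r ->
  m <= 2^-1 * (2^-1 ^+ 2 * A + 2 * 2^-1 * 2^-1 * C + 2^-1 ^+ 2 * B) -
       (2^-1 * D + 2^-1 * E) ->
  1 ^+ 2 * A + 2 * 1 * -1 * C + (-1) ^+ 2 * B <= 4 * (r + r').
Proof. by lra. Qed.

Lemma cauchy_le r r' e : r < e / 8 -> r' < e / 8 -> 4 * (r + r') <= e.
Proof. by lra. Qed.

Lemma variation_ge0 m A B C D E r t :
  2^-1 * A - D < m + r ->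
  m <= 2^-1 * (1 ^+ 2 * A + 2 * 1 * t * C + t ^+ 2 * B) - (1 * D + t * E) ->
  0 <= 2^-1 * t ^+ 2 * B + t * (C - E) + r.
Proof. by lra. Qed.

(** A quadratic polynomial without constant term that is nonnegative on the
    line has no linear term. *)
Lemma linear_part_eq0 a z : 0 <= a ->
  (forall t, 0 <= 2^-1 * t ^+ 2 * a + t * z) -> z = 0.
Proof.
move=> a0 var; have := var (- z / (a + 1)).
have a1 : 0 < a + 1 by lra.
have -> : 2^-1 * (- z / (a + 1)) ^+ 2 * a + (- z / (a + 1)) * z =
    - (z ^+ 2 * (2^-1 * a + 1) / (a + 1) ^+ 2) by field; rewrite gt_eqF.
rewrite oppr_ge0 => h.
have : z ^+ 2 * (2^-1 * a + 1) / (a + 1) ^+ 2 == 0.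
  rewrite eq_le h/= divr_ge0 ?sqr_ge0// mulr_ge0 ?sqr_ge0//; lra.
rewrite mulf_eq0 invr_eq0 sqrf_eq0 (gt_eqF a1) orbF mulf_eq0 sqrf_eq0.
rewrite (gt_eqF (_ : 0 < 2^-1 * a + 1)) ?orbF; last by lra.
by move=> /eqP.
Qed.

End QuadraticInequalities.

Section DirichletProblem.
Context {R : realType}.
Variable w : set (R * R).
Hypotheses (ow : open w) (bw : bounded_set w).
Local Notation test := (@testfun R (R * R)%type w).
Local Notation L2w := (L2 (@leb2 R) w).
Local Notation ip := (dot (@leb2 R) w).
Local Notation mw := (domain_measurable ow).
Implicit Types (phi psi f g h : R * R -> R).

Let ipC f g : ip f g = ip g f. Proof. exact: dotC. Qed.

Let ipDl f g h : L2w f -> L2w g -> L2w h ->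
  ip (fun x => f x + g x) h = ip f h + ip g h.
Proof. exact: (dotDl mw). Qed.

Let ipDr f g h : L2w f -> L2w g -> L2w h ->
  ip h (fun x => f x + g x) = ip h f + ip h g.
Proof. exact: (dotDr mw). Qed.

Let ipZl c f g : L2w f -> L2w g -> ip (fun x => c * f x) g = c * ip f g.
Proof. exact: (dotZl mw). Qed.

Let ipZr c f g : L2w f -> L2w g -> ip g (fun x => c * f x) = c * ip g f.
Proof. exact: (dotZr mw). Qed.

Let L2Dw f g : L2w f -> L2w g -> L2w (fun x => f x + g x).
Proof. exact: (L2D mw). Qed.

Let L2Zw c f : L2w f -> L2w (fun x => c * f x).
Proof. exact: (L2Z mw). Qed.

Let ip_comb f g (s t : R) : L2w f -> L2w g ->
  ip (fun x => s * f x + t * g x) (fun x => s * f x + t * g x) =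
  s ^+ 2 * ip f f + 2 * s * t * ip f g + t ^+ 2 * ip g g.
Proof.
move=> Lf Lg; have Ls := L2Zw s Lf; have Lt := L2Zw t Lg.
rewrite ipDl ?ipDr ?ipZl ?ipZr//; last exact: L2Dw.
by rewrite (ipC g f); ring.
Qed.

Let ip_combr f g h (s t : R) : L2w f -> L2w g -> L2w h ->
  ip h (fun x => s * f x + t * g x) = s * ip h f + t * ip h g.
Proof.
move=> Lf Lg Lh; have Ls := L2Zw s Lf; have Lt := L2Zw t Lg.
by rewrite ipDr ?ipZr.
Qed.

Let derive_comb phi psi (s t : R) v : test phi -> test psi ->
  'D_v (fun x => s * phi x + t * psi x) = (fun x => s * 'D_v phi x + t * 'D_v psi x).
Proof.
move=> tphi tpsi; apply/funext => x.
have d1 : derivable phi x v by exact: testfun_derivable tphi.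
have d2 : derivable psi x v by exact: testfun_derivable tpsi.
rewrite (@deriveD _ _ _ (s *: phi) (t *: psi)).
- by rewrite (deriveZ s d1) (deriveZ t d2).
- exact: derivableZ.
- exact: derivableZ.
Qed.

Let Ld phi v : test phi -> L2w ('D_v phi).
Proof. exact: testfun_derive_L2. Qed.

Let Lt phi : test phi -> L2w phi.
Proof. exact: testfun_L2. Qed.

Variables P1 P2 F : R * R -> R.
Hypotheses (LP1 : L2w P1) (LP2 : L2w P2) (LF : L2w F).

(* the linear functional, the Dirichlet energy and the functional [J] that the
   solution minimizes *)
Let l phi := ip P1 ('D_e1 phi) + ip P2 ('D_e2 phi) + ip F phi.
Let energy phi := ip ('D_e1 phi) ('D_e1 phi) + ip ('D_e2 phi) ('D_e2 phi).
Let J phi := 2^-1 * energy phi - l phi.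

Let l_comb phi psi (s t : R) : test phi -> test psi ->
  l (fun x => s * phi x + t * psi x) = s * l phi + t * l psi.
Proof.
move=> tphi tpsi; rewrite /l.
rewrite (derive_comb s t e1 tphi tpsi) (derive_comb s t e2 tphi tpsi).
rewrite (ip_combr s t (Ld e1 tphi) (Ld e1 tpsi) LP1).
rewrite (ip_combr s t (Ld e2 tphi) (Ld e2 tpsi) LP2).
rewrite (ip_combr s t (Lt tphi) (Lt tpsi) LF).
exact: comb_sum3.
Qed.

Let cross phi psi := ip ('D_e1 phi) ('D_e1 psi) + ip ('D_e2 phi) ('D_e2 psi).

Let energy_comb phi psi (s t : R) : test phi -> test psi ->
  energy (fun x => s * phi x + t * psi x) =
  s ^+ 2 * energy phi + 2 * s * t * cross phi psi + t ^+ 2 * energy psi.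
Proof.
move=> tphi tpsi; rewrite /energy /cross.
rewrite (derive_comb s t e1 tphi tpsi) (derive_comb s t e2 tphi tpsi).
rewrite (ip_comb s t (Ld e1 tphi) (Ld e1 tpsi)).
rewrite (ip_comb s t (Ld e2 tphi) (Ld e2 tpsi)).
exact: comb_sum2.
Qed.

Let energy_ge0 phi : 0 <= energy phi.
Proof. by apply: addr_ge0; exact: dot_ge0. Qed.

(* Young's inequality *)
Let young f g (c : R) : 0 < c -> L2w f -> L2w g ->
  ip f g <= c * ip f f + (4 * c)^-1 * ip g g.
Proof.
move=> c0 Lf Lg.
have := dot_ge0 (@leb2 R) w (fun x => (2 * c) * f x + (-1) * g x).
rewrite (ip_comb _ _ Lf Lg); exact: young_arith.
Qed.

Let J_bounded_below : exists m : R, forall phi, test phi -> m <= J phi.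
Proof.
have [C [C0 HC]] := poincare ow bw.
exists (- (ip P1 P1 + ip P2 P2 + C * ip F F)) => phi tphi.
have h1 := young ltr01 LP1 (Ld e1 tphi).
have h2 := young ltr01 LP2 (Ld e2 tphi).
have h3 := young C0 LF (Lt tphi).
have h4 : (4 * C)^-1 * ip phi phi <= 4^-1 * ip ('D_e1 phi) ('D_e1 phi).
  rewrite invfM -mulrA ler_pM2l ?invr_gt0// ler_pdivrMl//; exact: HC.
have h5 := dot_ge0 (@leb2 R) w ('D_e2 phi).
exact: young_sum h1 h2 h3 h4 h5.
Qed.

(** Riesz representation in H^1_0(w): a functional that is bounded for the
    L^2 norm of the gradient is represented by the gradient of its minimizer. *)
Lemma dirichlet_solution : exists (u G1 G2 : R * R -> R) (phi : nat -> R * R -> R),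
  H10_approx w phi u G1 G2 /\
  forall psi, test psi -> ip G1 ('D_e1 psi) + ip G2 ('D_e2 psi) =
    ip P1 ('D_e1 psi) + ip P2 ('D_e2 psi) + ip F psi.
Proof.
have [b bP] := J_bounded_below.
pose S := [set J phi | phi in test].
have hS : has_inf S.
  split; first by exists (J (cst 0)), (cst 0) => //; exact: testfun0.
  by exists b => _ [phi tphi <-]; exact: bP.
pose m := inf S.
have mP phi : test phi -> m <= J phi.
  by move=> tphi; apply: ge_inf; [exact: hS.2|exists phi].
have ex n : exists phi, test phi /\ J phi < m + n.+1%:R^-1.
  have e0 : (0 : R) < n.+1%:R^-1 by rewrite invr_gt0.
  by have [_ [phi tphi <-] ?] := inf_adherent e0 hS; exists phi.
have [phi phiP] := choice ex.
have tphi n : test (phi n) := (phiP n).1.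
have Jphi n : J (phi n) < m + n.+1%:R^-1 := (phiP n).2.
(* the parallelogram identity makes the minimizing sequence Cauchy *)
have par n k : energy (fun x => 1 * phi n x + (-1) * phi k x) <=
    4 * (n.+1%:R^-1 + k.+1%:R^-1).
  have tm : test (fun x => 2^-1 * phi n x + 2^-1 * phi k x).
    by apply: testfunD; exact: testfunZ.
  have := mP _ tm; have := Jphi n; have := Jphi k.
  rewrite /J (energy_comb _ _ (tphi n) (tphi k)) (energy_comb _ _ (tphi n) (tphi k)).
  rewrite (l_comb _ _ (tphi n) (tphi k)).
  exact: parallelogram_le.
have [C [C0 HC]] := poincare ow bw.
have cau (e : R) : 0 < e -> exists N, forall n k, (N <= n)%N -> (N <= k)%N ->
    energy (fun x => 1 * phi n x + (-1) * phi k x) <= e.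
  move=> e0; have e8 : 0 < e / 8 by rewrite divr_gt0.
  have [N _ NP] := near_infty_natSinv_lt (PosNum e8).
  exists N => n k Nn Nk; apply: le_trans (par n k) _.
  have /= r1 := NP n Nn; have /= r2 := NP k Nk.
  exact: cauchy_le r1 r2.
have tdiff n k : test (fun x => 1 * phi n x + (-1) * phi k x).
  by apply: testfunD; exact: testfunZ.
have cvg_of (v : nat -> R * R -> R) (K : R) : 0 < K -> (forall n, L2w (v n)) ->
   (forall n k, ip (fun x => v n x - v k x) (fun x => v n x - v k x) <=
      K * energy (fun x => 1 * phi n x + (-1) * phi k x)) ->
   exists f, L2w f /\ cvgL2 (@leb2 R) w v f.
  move=> K0 Lv vK; apply: (L2_complete mw Lv).
  move=> e e0; have eK : 0 < e / K by rewrite divr_gt0.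
  have [N NP] := cau _ eK; exists N => n k Nn Nk.
  by apply: le_trans (vK n k) _; rewrite mulrC -ler_pdivlMr//; exact: NP.
have sub1 (f g : R * R -> R) : (fun x => f x - g x) = (fun x => 1 * f x + (-1) * g x).
  by apply/funext => x; ring.
have [u [Lu cu]] : exists f, L2w f /\ cvgL2 (@leb2 R) w phi f.
  apply: (cvg_of _ C) => // [n|n k]; first exact: Lt.
  rewrite !sub1; apply: le_trans (HC _ (tdiff n k)) _.
  by rewrite ler_pM2l// lerDl dot_ge0.
have [G1 [LG1 c1]] : exists f, L2w f /\ cvgL2 (@leb2 R) w (fun n => 'D_e1 (phi n)) f.
  apply: (cvg_of _ 1) => // [n|n k]; first exact: Ld.
  by rewrite !sub1 -derive_comb// mul1r lerDl dot_ge0.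
have [G2 [LG2 c2]] : exists f, L2w f /\ cvgL2 (@leb2 R) w (fun n => 'D_e2 (phi n)) f.
  apply: (cvg_of _ 1) => // [n|n k]; first exact: Ld.
  by rewrite !sub1 -derive_comb// mul1r lerDr dot_ge0.
exists u, G1, G2, phi; split=> // psi tpsi.
have cv : cross (phi n) psi @[n --> \oo] --> ip G1 ('D_e1 psi) + ip G2 ('D_e2 psi).
  apply: cvgD; apply: (cvgL2_dot mw) => //; try exact: Ld; by move=> n; exact: Ld.
set q := ip G1 ('D_e1 psi) + ip G2 ('D_e2 psi) in cv *.
rewrite -/(l psi).
(* the minimizing sequence satisfies the Euler-Lagrange equation in the limit *)
have var (t : R) : 0 <= 2^-1 * t ^+ 2 * energy psi + t * (q - l psi).
  have B : 2^-1 * t ^+ 2 * energy psi + t * (cross (phi n) psi - l psi) + n.+1%:R^-1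
      @[n --> \oo] --> 2^-1 * t ^+ 2 * energy psi + t * (q - l psi) + 0.
    apply: cvgD; last first.
      exact: cvg_harmonic.
    apply: cvgD; first exact: cvg_cst.
    by apply: cvgMr; apply: cvgB => //; exact: cvg_cst.
  rewrite -[leRHS]addr0 -(cvg_lim (@norm_hausdorff _ R) B).
  apply: limr_ge; first by apply/cvg_ex; eexists; exact: B.
  apply: nearW => n.
  have tm : test (fun x => 1 * phi n x + t * psi x).
    by apply: testfunD; exact: testfunZ.
  have := mP _ tm; have := Jphi n.
  rewrite /J (energy_comb _ _ (tphi n) tpsi) (l_comb _ _ (tphi n) tpsi).
  exact: variation_ge0.
by apply/eqP; rewrite -subr_eq0; exact/eqP/(linear_part_eq0 (energy_ge0 psi) var).
Qed.

End DirichletProblem.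

(** * Planar fields on the thin domain *)

(** The curl of the planar field (k1, k2) on w is the function h. *)
Definition curl_is {R : realType} (w : set (R * R)) (k1 k2 h : R * R -> R) : Prop :=
  forall psi : R * R -> R, testfun w psi ->
  \int[@leb2 R]_(x in w) (k1 x * 'D_e2 psi x - k2 x * 'D_e1 psi x) =
  \int[@leb2 R]_(x in w) (h x * psi x).

Section ThinDomain.
Context {R : realType}.
Variables (w : set (R * R)) (f g fe ge : R * R -> R) (al be : R).
Hypotheses (ow : open w) (bw : bounded_set w).
Hypotheses (cfe : continuous fe) (cge : continuous ge).
Hypotheses (ffe : forall x, w x -> f x = fe x) (gge : forall x, w x -> g x = ge x).
Hypotheses (al0 : 0 < al) (alw : forall x, w x -> al <= g x - f x).
Hypotheses (fbe : forall x, w x -> `|f x| <= be) (gbe : forall x, w x -> `|g x| <= be).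
Local Notation leb := (@lebesgue_measure R).
Local Notation mw := (domain_measurable ow).
Local Notation Om := (Omega w f g).
Local Notation test := (@testfun R (R * R)%type w).
Local Notation test3 := (@testfun R (R * R * R)%type Om).
Local Notation L2w := (L2 (@leb2 R) w).
Local Notation L2O := (L2 (@leb3 R) Om).
Implicit Types (k h : R * R -> R) (phi : R * R * R -> R).

Let OmE : Om = [set y | w y.1 /\ fe y.1 < y.2 < ge y.1].
Proof.
apply/seteqP; split=> y [wy yf]; split=> //.
  by rewrite -ffe// -gge.
by rewrite ffe// gge.
Qed.

Lemma Omega_open : open Om.
Proof.
have c1 : continuous (fst : R * R * R -> R * R) by move=> x; exact: cvg_fst.
have c2 : continuous (snd : R * R * R -> R) by move=> x; exact: cvg_snd.
rewrite OmE (_ : [set y | _] = (fst @^-1` w) `&`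
    (((fun y : R * R * R => y.2 - fe y.1) @^-1` [set z | 0 < z]) `&`
     ((fun y : R * R * R => ge y.1 - y.2) @^-1` [set z | 0 < z]))); last first.
  apply/seteqP; split=> y /=; first by move=> [wy /andP[? ?]]; rewrite !subr_gt0.
  by rewrite !subr_gt0 => -[wy [-> ->]].
apply: openI; first by apply: open_comp => // x _; exact: c1.
apply: openI; apply: open_comp; try exact: open_gt.
- move=> x _; apply: cvgB; first exact: c2.
  by apply: (@continuous_comp _ _ _ fst fe); [exact: c1|exact: cfe].
- move=> x _; apply: cvgB; last exact: c2.
  by apply: (@continuous_comp _ _ _ fst ge); [exact: c1|exact: cge].
Qed.

Lemma Omega_measurable : measurable (Om : set (mspace R)).
Proof. by apply: open_measurable3; exact: Omega_open. Qed.
Local Notation mO := Omega_measurable.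

Lemma Omega_lty : (@leb3 R Om < +oo)%E.
Proof.
apply: bounded_leb3_lty; first exact: mO.
have [M [M0 wM]] := bounded_box2 bw.
exists (M + be); split; first exact: num_real.
move=> r Mr y [wy /andP[y1 y2]].
have := fbe wy; have := gbe wy; rewrite !ler_norml => /andP[g1 g2] /andP[f1 f2].
have be0 : 0 <= be by apply: le_trans (fbe wy).
have [/=] := wM _ wy; rewrite !in_itv/= => /andP[a1 a2] /andP[b1 b2].
rewrite !prod_normE !ge_max !ler_norml; apply/andP; split.
  by apply/andP; split; apply/andP; split; lra.
by apply/andP; split; lra.
Qed.

Lemma testfun3_L2 phi : test3 phi -> L2O phi.
Proof.
move=> tphi; have [M [M0 HM]] := testfun_bounded tphi.
apply: (@bounded_L2 _ _ _ (@leb3 R) _ mO _ M Omega_lty).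
  by apply: measurable_funTS; apply: continuous_measurable3; exact: testfun_continuous tphi.
by move=> x _; exact: HM.
Qed.

(** A function [k] on [w] is identified with the function [fun y => k y.1] on
    the thin domain. *)
Lemma measurable_lift k : measurable_fun (w : set (mplane R)) k ->
  measurable_fun (Om : set (mspace R)) (fun y => k y.1).
Proof.
move=> mk; apply: (@measurable_comp _ _ _ (mspace R) (mplane R) _ w k Om fst) => //.
- exact: mw.
- by move=> _ [y [wy _] <-].
- by apply: measurable_funTS; exact: measurable_fst.
Qed.

Lemma measurable_unlift k : measurable_fun (Om : set (mspace R)) (fun y => k y.1) ->
  measurable_fun (w : set (mplane R)) k.
Proof.
move=> mk.
(* restriction to the mid-surface *)
pose s (x : mplane R) : mspace R := (x, (fe x + ge x) / 2).
have ms : measurable_fun [set: mplane R] s.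
  apply: measurable_fun_pair; first exact: measurable_id.
  apply: continuous_measurable2 => x; apply: cvgMl.
  by apply: cvgD; [exact: cfe|exact: cge].
apply: (@measurable_comp _ _ _ (mplane R) (mspace R) _ Om (fun y => k y.1) w s) => //.
- exact: mO.
- move=> _ [x wx <-]; split => //; rewrite /s/=; have := alw wx; rewrite (ffe wx) (gge wx) => ag.
  have lt : fe x < ge x by rewrite -subr_gt0 (lt_le_trans al0).
  by rewrite !midf_lt.
- exact: measurable_funTS.
Qed.

(** Integration over the fibres. *)
Lemma integral_lift k : measurable_fun (w : set (mplane R)) k ->
  (forall x, w x -> 0 <= k x) ->
  (\int[@leb3 R]_(y in Om) (k y.1)%:E = \int[@leb2 R]_(x in w) ((g x - f x) * k x)%:E)%E.
Proof.
move=> mk k0; rewrite integral_mkcond [RHS]integral_mkcond.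
pose F : mspace R -> \bar R := (fun y => (k y.1)%:E) \_ Om.
have mF : measurable_fun [set: mspace R] F.
  apply/measurable_restrict => //; first exact: mO.
  by rewrite setTI; apply/measurable_EFinP; exact: measurable_lift.
have F0 y : (0 <= F y)%E.
  by rewrite /F patchE; case: ifPn => // /[!inE] -[wy _]; rewrite lee_fin k0.
rewrite -/F (@fubini_tonelli1 _ _ _ _ _ (@leb2 R) leb F mF F0).
apply: eq_integral => x _; rewrite /fubini_F patchE.
case: ifPn; last first.
  rewrite notin_setE => wx.
  apply: integral0_eq => t _; rewrite /F patchE ifN//.
  by rewrite notin_setE => -[].
rewrite inE => wx.
have E t : F (x, t) = ((k x)%:E * (\1_(`]f x, g x[) t)%:E)%E.
  rewrite /F patchE indicE; case: ifPn => [/[!inE] -[_ /= ft]|].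
    by rewrite mem_set/= ?in_itv//= mule1.
  rewrite notin_setE => H; rewrite memNset ?mule0//=.
  by rewrite in_itv/= => ft; apply: H.
under eq_integral do rewrite E.
rewrite ge0_integralZl//; last by rewrite lee_fin k0.
- rewrite integral_indic// setIT /= lebesgue_measure_itv/= lte_fin.
  have ag : f x < g x by rewrite -subr_gt0 (lt_le_trans al0)// alw.
  rewrite ag.
  by rewrite -EFinD -EFinM mulrC.
- by apply/measurable_EFinP; exact: measurable_indic.
Qed.

Lemma L2_lift k : L2w k -> L2O (fun y => k y.1).
Proof.
move=> Lk; have [mk ki] := Lk; split; first exact: measurable_lift.
rewrite (@integral_lift (fun x => k x ^+ 2)); last 2 first.
- exact: measurable_funX.
- by move=> x _; exact: sqr_ge0.
apply: (@le_lt_trans _ _ (\int[@leb2 R]_(x in w) ((2 * be)%:E * (k x ^+ 2)%:E))%E).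
  apply: ge0_le_integral; first exact: mw.
  - move=> x wx; rewrite lee_fin mulr_ge0 ?sqr_ge0//; exact: le_trans (ltW al0) (alw wx).
  - apply/measurable_EFinP; apply: measurable_funM; last exact: measurable_funX.
    apply: (@eq_measurable_fun _ _ (mplane R) _ _ (fun x => ge x - fe x)).
      by move=> x /[!inE] wx; rewrite ffe// gge.
    apply: measurable_funTS; apply: continuous_measurable2 => x.
    by apply: cvgB; [exact: cge|exact: cfe].
  - apply/measurable_EFinP; apply: measurable_funM => //; exact: measurable_funX.
  - move=> x wx; rewrite -EFinM lee_fin ler_wpM2r ?sqr_ge0//.
    by have := fbe wx; have := gbe wx; rewrite !ler_norml => /andP[? ?] /andP[? ?]; lra.
have [[x0 wx0]|we] := pselect (w !=set0); last first.
  rewrite (_ : w = set0) ?integral_set0//; apply/seteqP; split=> // x wx.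
  by apply: we; exists x.
have be0 : 0 <= 2 * be by rewrite mulr_ge0//; apply: le_trans (fbe wx0).
have mk2 : measurable_fun (w : set (mplane R)) (fun x => (k x ^+ 2)%:E).
  by apply/measurable_EFinP; exact: measurable_funX.
have k2 (x : mplane R) : w x -> (0 <= (k x ^+ 2)%:E)%E.
  by move=> _; rewrite lee_fin sqr_ge0.
rewrite (ge0_integralZl (@leb2 R) mw mk2 k2) ?lee_fin//.
by rewrite lte_mul_pinfty ?lee_fin.
Qed.

Lemma L2_unlift k : L2O (fun y => k y.1) -> L2w k.
Proof.
move=> [mk3 ki]; have mk := measurable_unlift mk3.
apply: (@L2_eq _ _ (mplane R) (@leb2 R) _ mw (fun x => al^-1 * (al * k x))).
  by move=> x _; rewrite mulKf// gt_eqF.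
apply: (L2Z mw); split.
  by apply: measurable_funM => //.
apply: (@le_lt_trans _ _ (al%:E * \int[@leb3 R]_(y in Om) (k y.1 ^+ 2)%:E)%E); last first.
  by rewrite lte_mul_pinfty// lee_fin ltW.
rewrite (@integral_lift (fun x => k x ^+ 2)); last 2 first.
- exact: measurable_funX.
- by move=> x _; exact: sqr_ge0.
have ma : measurable_fun (w : set (mplane R)) (fun x => (g x - f x) * k x ^+ 2).
  apply: measurable_funM; last exact: measurable_funX.
  apply: (@eq_measurable_fun _ _ (mplane R) _ _ (fun x => ge x - fe x)).
    by move=> x /[!inE] wx; rewrite ffe// gge.
  apply: measurable_funTS; apply: continuous_measurable2 => x.
  by apply: cvgB; [exact: cge|exact: cfe].
have ma0 (x : mplane R) : w x -> (0 <= ((g x - f x) * k x ^+ 2)%:E)%E.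
  by move=> wx; rewrite lee_fin mulr_ge0 ?sqr_ge0// (le_trans (ltW al0) (alw wx)).
have maE := (measurable_EFinP _ _).2 ma.
rewrite -(ge0_integralZl (@leb2 R) mw maE ma0) ?lee_fin ?(ltW al0)//.
apply: ge0_le_integral; first exact: mw.
- by move=> x _; rewrite lee_fin sqr_ge0.
- by apply/measurable_EFinP; apply: measurable_funX; exact: measurable_funM.
- by apply/measurable_EFinP; exact: measurable_funM.
- move=> x wx; rewrite -EFinM lee_fin exprMn expr2 -mulrA ler_pM2l//.
  by rewrite ler_wpM2r ?sqr_ge0// alw.
Qed.

Let OmW y : Om y -> w y.1. Proof. by case. Qed.

Lemma testfun_fibre phi t : test3 phi -> test (fun x => phi (x, t)).
Proof. by move=> tphi; exact: (testfun_slice1 t OmW tphi). Qed.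

Let testfun_vert phi x : test3 phi -> testfun [set: R^o] (fun t : R^o => phi (x, t)).
Proof. by apply: (@testfun_slice2 R (R * R)%type R^o Om). Qed.

Let off3 phi v y : test3 phi -> ~ Om y -> 'D_v phi y = 0.
Proof. by move=> tphi; exact: testfun_off (testfun_derive v tphi). Qed.

Let lift_integrable k phi : L2w k -> test3 phi ->
  (@leb3 R).-integrable Om (EFin \o (fun y => k y.1 * phi y)).
Proof.
by move=> Lk tphi; apply: (L2_mul_integrable mO); [exact: L2_lift|exact: testfun3_L2].
Qed.

Let mkcondT (F : R * R * R -> R) : (@leb3 R).-integrable Om (EFin \o F) ->
  (@leb3 R).-integrable setT ((EFin \o F) \_ Om).
Proof. exact: (@integrable_mkcond _ (mspace R) R (@leb3 R) Om (EFin \o F) mO).1. Qed.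

(** A field that does not depend on the third variable has no vertical
    derivative. *)
Lemma integral_vertical_derive k phi : L2w k -> test3 phi ->
  \int[@leb3 R]_(y in Om) (k y.1 * 'D_i3 phi y) = 0.
Proof.
move=> Lk tphi; have td := testfun_derive i3 tphi.
pose F (y : R * R * R) : R := k y.1 * 'D_i3 phi y.
have iF : (@leb3 R).-integrable Om (EFin \o F) := lift_integrable Lk td.
rewrite /Rintegral integral_mkcond -/(EFin \o F).
rewrite -(integral12_prod_meas1 (mkcondT iF)) integral0_eq// => x _.
rewrite /fubini_F.
have [wx|wx] := pselect (w x); last first.
  apply: integral0_eq => t _; rewrite patchE ifN//.
  by rewrite notin_setE => -[].
have tv := testfunZ (k x) (testfun_vert x tphi).
rewrite -[RHS](integral_derive_line tv); apply: eq_integral => t _.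
have -> : 'D_(1 : R^o) (fun t : R^o => k x * phi (x, t)) t = F (x, t).
  rewrite /F -(@derive_slice2 R (R * R)%type R^o).
  by rewrite -[RHS]deriveZ//; exact: testfun_derivable (testfun_vert x tphi).
rewrite patchE; case: ifPn => //; rewrite notin_setE => Ot.
by rewrite /F (off3 _ tphi Ot) mulr0.
Qed.

(** If [(k1, k2)] has curl [h] in [w], so has its lift to the thin domain. *)
Lemma curl_lift k1 k2 h phi : L2w k1 -> L2w k2 -> L2w h ->
  curl_is w k1 k2 h -> test3 phi ->
  \int[@leb3 R]_(y in Om) (k1 y.1 * 'D_i2 phi y - k2 y.1 * 'D_i1 phi y) =
  \int[@leb3 R]_(y in Om) (h y.1 * phi y).
Proof.
move=> L1 L2 Lh kh tphi.
have I1 := lift_integrable L1 (testfun_derive i2 tphi).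
have I2 := lift_integrable L2 (testfun_derive i1 tphi).
have I3 := lift_integrable Lh tphi.
have I12 : (@leb3 R).-integrable Om
    (EFin \o (fun y => k1 y.1 * 'D_i2 phi y - k2 y.1 * 'D_i1 phi y)).
  by have := integrableB mO I1 I2.
apply/eqP; rewrite -subr_eq0 -(RintegralB mO I12 I3); apply/eqP.
pose F (y : R * R * R) : R := k1 y.1 * 'D_i2 phi y - k2 y.1 * 'D_i1 phi y - h y.1 * phi y.
have iF : (@leb3 R).-integrable Om (EFin \o F) by have := integrableB mO I12 I3.
rewrite /Rintegral integral_mkcond -/(EFin \o F).
rewrite -(integral21_prod_meas1 (mkcondT iF)) integral0_eq// => t _.
rewrite /fubini_G.
have tt := testfun_fibre t tphi; set psi := fun x => phi (x, t) in tt.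
have mul (a b : R * R -> R) : L2w a -> L2w b ->
    (@leb2 R).-integrable w (EFin \o (fun x => a x * b x)).
  by move=> *; exact: (L2_mul_integrable mw).
have J1 := mul _ _ L1 (testfun_derive_L2 ow bw e2 tt).
have J2 := mul _ _ L2 (testfun_derive_L2 ow bw e1 tt).
have J3 := mul _ _ Lh (testfun_L2 ow bw tt).
have J12 : (@leb2 R).-integrable w
    (EFin \o (fun x => k1 x * 'D_e2 psi x - k2 x * 'D_e1 psi x)).
  by have := integrableB mw J1 J2.
have J123 : (@leb2 R).-integrable w
    (EFin \o (fun x => k1 x * 'D_e2 psi x - k2 x * 'D_e1 psi x - h x * psi x)).
  by have := integrableB mw J12 J3.
have : \int[@leb2 R]_(x in w) (k1 x * 'D_e2 psi x - k2 x * 'D_e1 psi x - h x * psi x) = 0.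
  by rewrite (RintegralB mw J12 J3) (kh _ tt) subrr.
rewrite /Rintegral => /eqP; rewrite fine_eq0; last exact: (integrable_fin_num mw J123).
move=> /eqP E; rewrite -[RHS]E [RHS]integral_mkcond; apply: eq_integral => x _.
rewrite !patchE; have [wx|wx] := pselect (w x); last first.
  rewrite ifN ?ifN//; rewrite notin_setE// => -[wx' _]; exact: wx.
rewrite [in RHS]mem_set//.
have E1 := @derive_slice1 R (R * R)%type R^o phi t e1 x.
have E2 := @derive_slice1 R (R * R)%type R^o phi t e2 x.
rewrite E1 E2; case: ifPn => //; rewrite notin_setE => Ot.
by rewrite !(off3 _ tphi Ot) /psi (testfun_off tphi Ot) !mulr0 !subr0.
Qed.

Let test3_bounded phi : test3 phi ->
  measurable_fun (Om : set (mspace R)) phi /\ exists c : R, forall y, Om y -> `|phi y| <= c.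
Proof.
move=> tphi; have [M [M0 HM]] := testfun_bounded tphi; split.
  by apply: measurable_funTS; apply: continuous_measurable3; exact: testfun_continuous tphi.
by exists M => y _; exact: HM.
Qed.

Let Radon_perturb (L L' : (R * R * R -> R) -> R) (s : R) h : 0 <= s -> L2w h ->
  (forall phi, test3 phi ->
     L' phi = s * L phi + \int[@leb3 R]_(y in Om) (h y.1 * phi y)) ->
  @is_Radon R _ (mspace R) Om test3 L -> @is_Radon R _ (mspace R) Om test3 L'.
Proof.
move=> s0 Lh LE [nu rL].
have ih : (@leb3 R).-integrable Om (EFin \o (fun y => h y.1)).
  have L1 : L2O (cst 1).
    by apply: (@bounded_L2 _ _ (mspace R) (@leb3 R) _ mO _ 1 Omega_lty) => // y _;
      rewrite normr1.
  have := L2_mul_integrable mO (L2_lift Lh) L1.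
  by apply: eq_integrable; [exact: mO|move=> y _ /=; rewrite mulr1].
have [nu' [rL' _]] := represents_perturb mO test3_bounded s0 ih rL.
by exists nu' => phi tphi; rewrite LE// -rL'.
Qed.

Lemma Zspace_L2 (j : R * R -> R * R) : Zspace w f g j ->
  L2w (fun x => (j x).1) /\ L2w (fun x => (j x).2).
Proof. by move=> [[L1 L2 _] _]; split; exact: L2_unlift. Qed.

(** Nonnegative multiples of elements of [Zspace], perturbed by planar fields
    with square integrable curl, stay in [Zspace]. *)
Lemma Zspace_perturb (j : R * R -> R * R) (s : R) k1 k2 h : 0 <= s ->
  L2w k1 -> L2w k2 -> L2w h ->
  curl_is w k1 k2 h ->
  Zspace w f g j ->
  Zspace w f g (fun x => (s * (j x).1 + k1 x, s * (j x).2 + k2 x)).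
Proof.
move=> s0 Lk1 Lk2 Lh kh jZ; have [Lj1 Lj2] := Zspace_L2 jZ.
have [_ [R1 R2 R3]] := jZ.
have LO (a b : R * R -> R) : L2w a -> L2w b -> L2O (fun y => s * a y.1 + b y.1).
  move=> La Lb; apply: (L2D mO); last exact: L2_lift.
  by apply: (L2Z mO); exact: L2_lift.
split.
  split; [exact: (LO (fun x => (j x).1) k1 Lj1 Lk1)|
    exact: (LO (fun x => (j x).2) k2 Lj2 Lk2)|exact: L2_0].
have L0 : L2w (cst 0) by exact: L2_0.
have I k phi v : L2w k -> test3 phi ->
    (@leb3 R).-integrable Om (EFin \o (fun y => k y.1 * 'D_v phi y)).
  by move=> Lk tphi; apply: lift_integrable => //; exact: testfun_derive.
have Z0 phi : \int[@leb3 R]_(y in Om) ((cst 0 : R * R -> R) y.1 * phi y) = 0.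
  rewrite (@eq_Rintegral _ _ _ _ _ (cst 0)); last by move=> y _; rewrite mul0r.
  by rewrite /Rintegral integral0.
have V (a b : R * R -> R) phi : L2w a -> L2w b -> test3 phi ->
    \int[@leb3 R]_(y in Om) ((s * a y.1 + b y.1) * 'D_i3 phi y) = 0.
  move=> La Lb tphi; apply: (@integral_vertical_derive (fun x => s * a x + b x)) => //.
  by apply: (L2D mw) => //; exact: (L2Z mw).
have VN (a : R * R -> R) phi : L2w a -> test3 phi ->
    \int[@leb3 R]_(y in Om) (0 * 'D_i1 phi y - a y.1 * 'D_i3 phi y) = 0.
  move=> La tphi.
  rewrite -[RHS](@integral_vertical_derive (fun x => -1 * a x) phi)//; last exact: (L2Z mw).
  by apply: eq_Rintegral => y _; ring.
split.
- apply: (Radon_perturb s0 L0 _ R1) => phi tphi; rewrite Z0 /curl3_1 /=.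
  under eq_Rintegral do rewrite mul0r subr0.
  under [in RHS]eq_Rintegral do rewrite mul0r subr0.
  rewrite (V (fun x => (j x).2) k2 phi Lj2 Lk2 tphi).
  by rewrite (integral_vertical_derive Lj2 tphi) !mulr0 addr0.
- apply: (Radon_perturb s0 L0 _ R2) => phi tphi; rewrite Z0 /curl3_2 /=.
  rewrite (VN (fun x => s * (j x).1 + k1 x))//; last by apply: (L2D mw) => //; exact: (L2Z mw).
  by rewrite (VN (fun x => (j x).1))// !mulr0 addr0.
- apply: (Radon_perturb (h := fun x => 2^-1 * h x) s0 _ _ R3); first exact: (L2Z mw).
  move=> phi tphi; rewrite /curl3_3 /=.
  have B (a b : R * R -> R) : L2w a -> L2w b -> (@leb3 R).-integrable Om
      (EFin \o (fun y => a y.1 * 'D_i2 phi y - b y.1 * 'D_i1 phi y)).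
    by move=> La Lb; have := integrableB mO (I a phi i2 La tphi) (I b phi i1 Lb tphi).
  have Bs : (@leb3 R).-integrable Om (EFin \o (fun y => s *
      ((j y.1).1 * 'D_i2 phi y - (j y.1).2 * 'D_i1 phi y))).
    by have := integrableZl mO s (B _ _ Lj1 Lj2).
  have -> : \int[@leb3 R]_(y in Om) ((s * (j y.1).1 + k1 y.1) * 'D_i2 phi y -
        (s * (j y.1).2 + k2 y.1) * 'D_i1 phi y) =
      s * \int[@leb3 R]_(y in Om) ((j y.1).1 * 'D_i2 phi y - (j y.1).2 * 'D_i1 phi y) +
      \int[@leb3 R]_(y in Om) (h y.1 * phi y).
    rewrite -(curl_lift Lk1 Lk2 Lh kh tphi) -(RintegralZl s mO (B _ _ Lj1 Lj2)).
    rewrite -(RintegralD mO Bs (B _ _ Lk1 Lk2)).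
    apply: eq_Rintegral => y _; move: ('D_i2 phi y) ('D_i1 phi y) => D2 D1.
    move: (j y.1) (k1 y.1) (k2 y.1) => [p q] c d /=.
    by rewrite !mulrDl mulrBr !mulrA opprD addrACA.
  have -> : \int[@leb3 R]_(y in Om) (2^-1 * h y.1 * phi y) =
      2^-1 * \int[@leb3 R]_(y in Om) (h y.1 * phi y).
    rewrite -(RintegralZl _ mO (lift_integrable Lh tphi)).
    by apply: eq_Rintegral => y _; rewrite mulrA.
  by rewrite mulrDr mulrCA.
Qed.

End ThinDomain.

(** * Bounded multipliers and bounds on closures *)

Section BoundedMultipliers.
Context {R : realType} d (T : measurableType d).
Variables (mu : {measure set T -> \bar R}) (D : set T).
Hypothesis mD : measurable D.
Implicit Types (f g p u : T -> R) (th : nat -> T -> R).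
Local Notation L2 := (L2 mu D).
Local Notation dot := (dot mu D).

Lemma cvgL2_subseq (v : nat -> T -> R) u (s : nat -> nat) : (forall n, (n <= s n)%N) ->
  cvgL2 mu D v u -> cvgL2 mu D (fun n => v (s n)) u.
Proof.
move=> sn vu; apply/cvgrPdist_le => e e0.
move/cvgrPdist_le : vu => /(_ e e0)[N _ NP]; exists N => // n /= Nn.
by apply: NP => /=; exact: leq_trans (sn n).
Qed.

Lemma cvgL2_eq (v : nat -> T -> R) f g : (forall n, L2 (v n)) -> L2 f -> L2 g ->
  dot (fun x => f x - g x) (fun x => f x - g x) = 0 ->
  cvgL2 mu D v f -> cvgL2 mu D v g.
Proof.
move=> Lv Lf Lg fg vf.
apply: (@squeeze_cvgr _ _ _ _ (cst 0) (fun n =>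
   2 * dot (fun x => v n x - f x) (fun x => v n x - f x) + 2 * 0)).
- apply: nearW => n; rewrite dot_ge0/= -fg.
  rewrite (_ : (fun x => v n x - g x) = (fun x => (v n x - f x) + (f x - g x))).
    by apply: dotD_le => //; exact: L2B.
  by apply/funext => x; ring.
- exact: cvg_cst.
- rewrite -[X in _ --> X](_ : 2 * 0 + 2 * 0 = 0); last by rewrite mulr0 addr0.
  by apply: cvgD; [apply: cvgMr|exact: cvg_cst].
Qed.

(** Dominated convergence for bounded multipliers. *)
Lemma cvg_Rintegral_mul th f p (C : R) : (forall n, measurable_fun D (th n)) ->
  (forall n x, D x -> `|th n x| <= C) ->
  {ae mu, forall x, D x -> th n x @[n --> \oo] --> f x} ->
  measurable_fun D f -> mu.-integrable D (EFin \o p) ->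
  \int[mu]_(x in D) (th n x * p x) @[n --> \oo] --> \int[mu]_(x in D) (f x * p x).
Proof.
move=> mth thC thf mf ip.
have mp : measurable_fun D p by apply/measurable_EFinP; exact: measurable_int ip.
have iC : mu.-integrable D (EFin \o (fun x => C * `|p x|)).
  have := integrableZl mD C (integrable_norm ip).
  by apply: eq_integrable => // x _ /=; rewrite EFinM.
have m1 n : measurable_fun D (EFin \o (fun x => th n x * p x)).
  by apply/measurable_EFinP; exact: measurable_funM.
have m2 : measurable_fun D (EFin \o (fun x => f x * p x)).
  by apply/measurable_EFinP; exact: measurable_funM.
have a1 : {ae mu, forall x, D x ->
    (EFin \o (fun x => th n x * p x)) x @[n --> \oo] --> (EFin \o (fun x => f x * p x)) x}.
  apply: filterS thf => x thf Dx; apply: cvg_EFin; first exact: nearW.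
  by apply: cvgMl; exact: thf.
have a2 : {ae mu, forall x n, D x ->
    (`|(EFin \o (fun x => th n x * p x)%R) x| <= (EFin \o (fun x => C * `|p x|)%R) x)%E}.
  by apply: aeW => x n Dx /=; rewrite lee_fin normrM ler_wpM2r//; exact: thC.
have [i1 _ H] := dominated_convergence mD m1 m2 a1 iC a2.
apply: fine_cvg; rewrite fineK; first exact: H.
by apply: integrable_fin_num.
Qed.

(** Multipliers that are bounded by 1 and tend to 1 almost everywhere disappear
    in the limit of products of square integrable functions. *)
Lemma cvg_dot_mul th p u (v : nat -> T -> R) : (forall n, measurable_fun D (th n)) ->
  (forall n x, D x -> `|th n x| <= 1) ->
  {ae mu, forall x, D x -> th n x @[n --> \oo] --> (1 : R)} ->
  L2 p -> L2 u -> (forall n, L2 (v n)) -> cvgL2 mu D v u ->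
  dot (fun x => th n x * p x) (v n) @[n --> \oo] --> dot p u.
Proof.
move=> mth th1 thc Lp Lu Lv vu.
have Lth n : L2 (fun x => th n x * p x) by exact: L2_mul_bounded (mth n) (th1 n) Lp.
have LB n : L2 (fun x => v n x - u x) by exact: L2B.
have E n : dot (fun x => th n x * p x) (v n) =
    dot (fun x => th n x * p x) (fun x => v n x - u x) +
    dot (fun x => th n x * p x) u.
  by rewrite dotBr// subrK.
under eq_fun do rewrite E.
rewrite -[dot p u]add0r; apply: cvgD.
  apply/cvgrPdist_le => e e0.
  have p0 : 0 < dot p p + 1 by rewrite ltr_wpDl// dot_ge0.
  have e2 : 0 < e ^+ 2 / (dot p p + 1) by rewrite divr_gt0// exprn_gt0.
  move/cvgrPdist_le : vu => /(_ _ e2); apply: filterS => n.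
  rewrite !sub0r !normrN (@ger0_norm _ (dot _ _)) ?dot_ge0// => vn.
  rewrite -(@ler_pXn2r _ 2)// ?nnegrE ?(ltW e0)//.
  rewrite real_normK ?num_real// (le_trans (dot_CS mD (Lth n) (LB n)))//.
  have : dot (fun x => th n x * p x) (fun x => th n x * p x) <= dot p p.
    apply: le_Rintegral => //; [exact: L2_mul_integrable|exact: L2_mul_integrable|].
    move=> x Dx; rewrite -!expr2 exprMn ler_piMl ?sqr_ge0//.
    by rewrite -(real_normK (num_real (th n x))) exprn_ile1 ?th1.
  have := dot_ge0 mu D p; have := dot_ge0 mu D (fun x => v n x - u x).
  have := dot_ge0 mu D (fun x => th n x * p x).
  move: vn; rewrite ler_pdivlMr//.
  move: (dot _ _) (dot _ _) (dot _ _) => A B C; nra.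
have -> : dot p u = \int[mu]_(x in D) (cst 1 x * (p x * u x)).
  by apply: eq_Rintegral => x _; rewrite mul1r.
under eq_fun => n.
  rewrite (_ : dot _ _ = \int[mu]_(x in D) (th n x * (p x * u x))).
    over.
  by apply: eq_Rintegral => x _; rewrite mulrA.
by apply: (cvg_Rintegral_mul mth th1) => //; exact: L2_mul_integrable.
Qed.

End BoundedMultipliers.

(** The zero functional has norm zero. *)
Lemma Radon_norm0 {R : realType} d (T : measurableType d) (W : set T)
    (test : set (T -> R)) : measurable W ->
  (forall phi, test phi ->
    measurable_fun W phi /\ exists c : R, forall x, W x -> `|phi x| <= c) ->
  (Radon_norm W test (fun=> 0%R) <= 0)%E.
Proof.
move=> mW tb.
pose m0 : {measure set T -> \bar R} := mzero.
pose nu0 : {charge set T -> \bar R} := czero.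
have m0W : (m0 W < +oo)%E by rewrite /m0/= /mzero.
have nuE A : measurable A -> A `<=` W -> (nu0 A + m0 A = m0 A)%E.
  by move=> _ _; rewrite /nu0 /m0/= /czero /mzero add0e.
apply: (@le_trans _ _ (charge_total_variation nu0 W)); last first.
  apply: le_trans (charge_variation_le mW m0W m0W nuE) _.
  by rewrite /m0/= /mzero add0e.
apply: ereal_inf_lbound; exists nu0 => // phi tphi.
have [mphi [c phic]] := tb _ tphi.
by rewrite (charge_integral_diff mW m0W m0W nuE mphi phic) subrr.
Qed.

Section ClosureBounds.
Context {R : realType}.
Variable w : set (R * R).
Hypotheses (ow : open w) (bw : bounded_set w).

Lemma closure_compact : compact (closure w).
Proof.
have [M [M0 wM]] := bounded_box2 bw.
have cB : compact (`[- M, M] `*` `[- M, M] : set (R * R)).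
  by apply: compact_setX; exact: segment_compact.
apply: (subclosed_compact _ cB); first exact: closed_closure.
have cl : closed (`[- M, M] `*` `[- M, M] : set (R * R)) by exact: compact_closed.
rewrite [X in _ `<=` X]((closure_id _).1 cl); exact: closure_subset.
Qed.

Lemma continuous_bounded_on (u ue : R * R -> R) : continuous ue ->
  (forall x, w x -> u x = ue x) ->
  exists C : R, 0 < C /\ forall x, w x -> `|u x| <= C.
Proof.
move=> cu uE.
have cc : compact (ue @` closure w).
  by apply: continuous_compact; [exact: continuous_subspaceT|exact: closure_compact].
have [M [_ HM]] := compact_bounded cc.
exists (`|M| + 1); split; first by rewrite ltr_wpDl.
move=> x wx; rewrite uE//.
apply: (HM (`|M| + 1)); first by rewrite (le_lt_trans (ler_norm M))// ltrDl.
by exists x => //; exact: subset_closure.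
Qed.

Lemma continuous_on_measurable (u ue : R * R -> R) : continuous ue ->
  (forall x, w x -> u x = ue x) -> measurable_fun (w : set (mplane R)) u.
Proof.
move=> cu uE; apply: (@eq_measurable_fun _ _ (mplane R) _ _ ue).
  by move=> x /[!inE] wx; rewrite uE.
by apply: measurable_funTS; exact: continuous_measurable2.
Qed.

Lemma continuous_on_L2 (u ue : R * R -> R) : continuous ue ->
  (forall x, w x -> u x = ue x) -> L2 (@leb2 R) w u.
Proof.
move=> cu uE; have [C [C0 HC]] := continuous_bounded_on cu uE.
apply: (@bounded_L2 _ _ _ (@leb2 R) _ (domain_measurable ow) _ C (domain_lty ow bw)) => //.
exact: continuous_on_measurable cu uE.
Qed.

Lemma continuous_gap (fe ge : R * R -> R) : w !=set0 -> continuous fe -> continuous ge ->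
  (forall x, closure w x -> fe x < ge x) ->
  exists al : R, 0 < al /\ forall x, w x -> al <= ge x - fe x.
Proof.
move=> [x0 wx0] cf cg fg.
have cc : {within closure w, continuous (fun x => ge x - fe x)}.
  by apply: continuous_subspaceT => x; apply: cvgB; [exact: cg|exact: cf].
have [c cw cmin] := @compact_EVT_min _ _ (fun x => ge x - fe x) (closure w)
  (ex_intro _ x0 (subset_closure wx0)) closure_compact cc.
exists (ge c - fe c); split.
  by rewrite subr_gt0 fg//; move: cw; rewrite inE.
by move=> x wx; apply: cmin; rewrite inE; exact: subset_closure.
Qed.

End ClosureBounds.

(** * First variations and weighted inner products *)

Section FirstVariation.
Context {R : realType}.
Implicit Types z t a b : R.

(** The first-order condition at the left end of an interval. *)
Lemma linear_part_ge0 z b : (forall t, 0 < t <= 1 -> 0 <= t * z + t ^+ 2 * b) -> 0 <= z.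
Proof.
move=> H; rewrite leNgt; apply/negP => z0.
pose k := `|b| + 1 - z.
have b0 := normr_ge0 b; have bb := ler_norm b.
have k0 : 0 < k by rewrite /k; lra.
have := H (- z / (2 * k)).
have -> : 0 < - z / (2 * k) <= 1.
  rewrite divr_gt0 ?oppr_gt0 ?mulr_gt0//= ler_pdivrMr ?mulr_gt0// /k; lra.
move=> /(_ isT).
have -> : - z / (2 * k) * z + (- z / (2 * k)) ^+ 2 * b =
    z ^+ 2 / (4 * k ^+ 2) * (b - 2 * k) by field; rewrite gt_eqF.
rewrite pmulr_rge0; last first.
  have z2 : 0 < z ^+ 2 by rewrite exprn_even_gt0//= lt_eqF.
  by rewrite (divr_gt0 z2)// mulr_gt0// exprn_gt0.
by rewrite /k; lra.
Qed.

Lemma le_of_lt_factor a b c : 0 <= b ->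
  (forall t, c < t -> a <= t * b) -> a <= c * b.
Proof.
move=> b0 H; rewrite leNgt; apply/negP => ab.
have e0 : 0 < (a - c * b) / (2 * (b + 1)).
  by rewrite divr_gt0 ?subr_gt0// mulr_gt0// ltr_wpDl.
have := H (c + (a - c * b) / (2 * (b + 1))); rewrite ltrDl => /(_ e0).
rewrite mulrDl -lerBlDl mulrAC ler_pdivlMr ?mulr_gt0 ?ltr_wpDl//.
have : 0 < a - c * b by rewrite subr_gt0.
move: (a - c * b) => z z0; nra.
Qed.

End FirstVariation.

Section WeightedProduct.
Context {R : realType}.
Variables (w : set (R * R)) (a : R * R -> R) (c : R).
Local Notation L2w := (L2 (@leb2 R) w).
Local Notation ip := (dot (@leb2 R) w).
Implicit Types p q u : R * R -> R.

(** The inner product of L^2(w) with weight a. *)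
Definition wdot p q := ip (fun x => a x * p x) q.

(** The squared distance from (k1, k2) to (b1, b2) for this inner product. *)
Definition misfit (b1 b2 k1 k2 : R * R -> R) :=
  wdot (fun x => k1 x - b1 x) (fun x => k1 x - b1 x) +
  wdot (fun x => k2 x - b2 x) (fun x => k2 x - b2 x).

Hypotheses (mw : measurable (w : set (mplane R)))
  (ma : measurable_fun (w : set (mplane R)) a)
  (ac : forall x, w x -> `|a x| <= c).

Lemma L2_weight p : L2w p -> L2w (fun x => a x * p x).
Proof. exact: (L2_mul_bounded mw ma ac). Qed.

Lemma wdotC p q : wdot p q = wdot q p.
Proof. by apply: eq_Rintegral => x _; rewrite mulrAC mulrC mulrA mulrAC. Qed.

Lemma wdotDl p q u : L2w p -> L2w q -> L2w u ->
  wdot (fun x => p x + q x) u = wdot p u + wdot q u.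
Proof.
move=> Lp Lq Lu; rewrite /wdot -(dotDl mw (L2_weight Lp) (L2_weight Lq) Lu).
by apply: eq_Rintegral => x _; rewrite mulrDr.
Qed.

Lemma wdotZl s p u : L2w p -> L2w u -> wdot (fun x => s * p x) u = s * wdot p u.
Proof.
move=> Lp Lu; rewrite /wdot -(dotZl mw s (L2_weight Lp) Lu).
by apply: eq_Rintegral => x _; rewrite mulrCA.
Qed.

Lemma wdot_sqr p q s : L2w p -> L2w q ->
  wdot (fun x => p x + s * q x) (fun x => p x + s * q x) =
  wdot p p + 2 * s * wdot p q + s ^+ 2 * wdot q q.
Proof.
move=> Lp Lq; have Lc := L2Z mw s Lq; have Ls := L2D mw Lp Lc.
rewrite (wdotDl Lp Lc Ls) (wdotC p) (wdotC (fun x => s * q x)).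
rewrite (wdotDl Lp Lc Lp) (wdotDl Lp Lc Lc) (wdotZl s Lq Lp) (wdotZl s Lq Lc).
rewrite (wdotC p (fun x => s * q x)) (wdotC q (fun x => s * q x)).
rewrite (wdotZl s Lq Lp) (wdotZl s Lq Lq) (wdotC q p).
by move: (wdot p p) (wdot p q) (wdot q q) => A' B' C'; ring.
Qed.

End WeightedProduct.

(** * Comparison of the minimizer with its perturbations *)

Section Minimizer.
Context {R : realType}.
Variables (w : set (R * R)) (f g fe ge F : R * R -> R) (B j : R * R -> R * R).
Variables (al be : R).
Hypotheses (ow : open w) (bw : bounded_set w).
Hypotheses (sfe : smooth fe) (sge : smooth ge).
Hypotheses (ffe : forall x, w x -> f x = fe x) (gge : forall x, w x -> g x = ge x).
Hypotheses (al0 : 0 < al) (alw : forall x, w x -> al <= g x - f x).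
Hypotheses (fbe : forall x, w x -> `|f x| <= be) (gbe : forall x, w x -> `|g x| <= be).
Local Notation mw := (domain_measurable ow).
Local Notation test := (@testfun R (R * R)%type w).
Local Notation L2w := (L2 (@leb2 R) w).
Local Notation ip := (dot (@leb2 R) w).
Local Notation a := (thickness f g).
Let B1 x := (B x).1.
Let B2 x := (B x).2.
Let j1 x := (j x).1.
Let j2 x := (j x).2.
Hypotheses (LB1 : L2w B1) (LB2 : L2w B2) (LF : L2w F).
Hypothesis hcurl : forall phi, test phi ->
  curl2 w B phi = \int[@leb2 R]_(x in w) (F x * phi x).
Hypothesis hj : Zspace w f g j.
Hypothesis hmin : forall k : R * R -> R * R,
  (Iinfty w f g B j <= Iinfty w f g B k)%E.
Implicit Types (k h u p q : R * R -> R) (phi psi : R * R -> R).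

Let cfe : continuous fe. Proof. exact: smooth_continuous. Qed.
Let cge : continuous ge. Proof. exact: smooth_continuous. Qed.
Let ae x := ge x - fe x.
Let sae : smooth ae. Proof. exact: smoothB. Qed.
Let aE x : w x -> a x = ae x.
Proof. by move=> wx; rewrite /thickness /ae ffe// gge. Qed.
Let ma : measurable_fun (w : set (mplane R)) a.
Proof. exact: (continuous_on_measurable (smooth_continuous sae) aE). Qed.
Let aw x : w x -> al <= a x. Proof. exact: alw. Qed.
Let a_gt0 x : w x -> 0 < a x.
Proof. by move=> wx; apply: lt_le_trans (aw wx). Qed.
Let abe x : w x -> `|a x| <= 2 * be.
Proof.
move=> wx; apply: le_trans (ler_normB _ _) _.
by have := fbe wx; have := gbe wx; lra.
Qed.

Let Lj : L2w j1 /\ L2w j2.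
Proof. exact: (Zspace_L2 ow cfe cge ffe gge al0 alw hj). Qed.
Let Lj1 : L2w j1. Proof. by have [] := Lj. Qed.
Let Lj2 : L2w j2. Proof. by have [] := Lj. Qed.

Let L2D' p q : L2w p -> L2w q -> L2w (fun x => p x + q x).
Proof. exact: (L2D mw). Qed.
Let L2B' p q : L2w p -> L2w q -> L2w (fun x => p x - q x).
Proof. exact: (L2B mw). Qed.
Let L2Z' c p : L2w p -> L2w (fun x => c * p x).
Proof. exact: (L2Z mw). Qed.
Let L2a p : L2w p -> L2w (fun x => a x * p x).
Proof. exact: (L2_mul_bounded mw ma abe). Qed.
Let int p q : L2w p -> L2w q ->
  (@leb2 R).-integrable w (EFin \o (fun x => p x * q x)).
Proof. by move=> Lp Lq; exact: (L2_mul_integrable mw Lp Lq). Qed.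

Let ipC p q : ip p q = ip q p. Proof. exact: dotC. Qed.
Let ipDl p q u : L2w p -> L2w q -> L2w u ->
  ip (fun x => p x + q x) u = ip p u + ip q u.
Proof. exact: (dotDl mw). Qed.
Let ipBl p q u : L2w p -> L2w q -> L2w u ->
  ip (fun x => p x - q x) u = ip p u - ip q u.
Proof. exact: (dotBl mw). Qed.
Let ipZl c p q : L2w p -> L2w q -> ip (fun x => c * p x) q = c * ip p q.
Proof. exact: (dotZl mw). Qed.

Local Notation Q := (misfit w a B1 B2).

(* the distribution a curl k, and its norm *)
Let L_ (k : R * R -> R * R) phi : R := curl2 w k (fun x => a x * phi x).
Let RN (k : R * R -> R * R) : \bar R := @Radon_norm R _ (mplane R) w test (L_ k).

Let QE (k : R * R -> R * R) : L2w (fun x => (k x).1) -> L2w (fun x => (k x).2) ->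
  (\int[@leb2 R]_(x in w) (a x * normsq (k x - B x))%:E)%E =
  (Q (fun x => (k x).1) (fun x => (k x).2))%:E.
Proof.
move=> L1 L2.
have I1 := int (L2a (L2B' L1 LB1)) (L2B' L1 LB1).
have I2 := int (L2a (L2B' L2 LB2)) (L2B' L2 LB2).
rewrite /misfit /wdot /dot -(RintegralD mw I1 I2) /Rintegral fineK.
  apply: eq_integral => x _; congr (_%:E); rewrite /normsq /B1 /B2 /=; ring.
apply: integrable_fin_num; first exact: mw.
by have := integrableD mw I1 I2.
Qed.

Let IE (k : R * R -> R * R) : Zspace w f g k -> L2w (fun x => (k x).1) -> L2w (fun x => (k x).2) ->
  Iinfty w f g B k = ((2^-1)%:E * RN k +
    (2^-1)%:E * (Q (fun x => (k x).1) (fun x => (k x).2))%:E)%E.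
Proof. by move=> Zk L1 L2; rewrite /Iinfty asboolT// QE. Qed.

Let test_bounded phi : test phi ->
  measurable_fun (w : set (mplane R)) phi /\ exists c : R, forall x, w x -> `|phi x| <= c.
Proof.
move=> tphi; have [M [M0 HM]] := testfun_bounded tphi; split.
  exact: (L2_measurable (testfun_L2 ow bw tphi)).
by exists M => x _; exact: HM.
Qed.

Let testa phi : test phi -> test (fun x => a x * phi x).
Proof. exact: (testfunM_on sae aE). Qed.

(* the perturbed competitor *)
Let pert s k1 k2 (x : R * R) : R * R := (s * (j x).1 + k1 x, s * (j x).2 + k2 x).

Let Zpert s k1 k2 h : 0 <= s -> L2w k1 -> L2w k2 -> L2w h -> curl_is w k1 k2 h ->
  Zspace w f g (pert s k1 k2).
Proof.
move=> s0 L1 L2 Lh kh.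
exact: (Zspace_perturb ow bw cfe cge ffe gge al0 alw fbe gbe s0 L1 L2 Lh kh hj).
Qed.

Let L_pert s k1 k2 h phi : L2w k1 -> L2w k2 -> L2w h -> curl_is w k1 k2 h ->
  test phi -> L_ (pert s k1 k2) phi =
    s * L_ j phi + \int[@leb2 R]_(x in w) (a x * h x * phi x).
Proof.
move=> L1 L2 Lh kh tphi; have ta := testa tphi.
rewrite /L_ /curl2 /pert /=; set psi := fun x => a x * phi x in ta *.
have D v := testfun_derive_L2 ow bw v ta.
have Ij : (@leb2 R).-integrable w
    (EFin \o (fun x => (j x).1 * 'D_e2 psi x - (j x).2 * 'D_e1 psi x)).
  by have := integrableB mw (int Lj1 (D e2)) (int Lj2 (D e1)).
have Ik : (@leb2 R).-integrable w
    (EFin \o (fun x => k1 x * 'D_e2 psi x - k2 x * 'D_e1 psi x)).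
  by have := integrableB mw (int L1 (D e2)) (int L2 (D e1)).
have -> : \int[@leb2 R]_(x in w) (a x * h x * phi x) =
    \int[@leb2 R]_(x in w) (h x * psi x).
  by apply: eq_Rintegral => x _; rewrite /psi; ring.
rewrite -(kh _ ta) -(RintegralZl s mw Ij).
have Is : (@leb2 R).-integrable w (EFin \o
    (fun x => s * ((j x).1 * 'D_e2 psi x - (j x).2 * 'D_e1 psi x))).
  by have := integrableZl mw s Ij.
rewrite -(RintegralD mw Is Ik).
by apply: eq_Rintegral => x _; ring.
Qed.

(* comparison with the competitor 0 *)
Let RN_fin : RN j \is a fin_num.
Proof.
rewrite ge0_fin_numE ?Radon_norm_ge0//.
have L0 : L2w (cst 0) by exact: L2_0.
have c0 : curl_is w (cst 0) (cst 0) (cst 0).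
  move=> psi _; apply: eq_Rintegral => x _; by rewrite !mul0r subr0.
have Z0 := Zpert (lexx 0) L0 L0 L0 c0.
have Lp (p : R * R -> R) : L2w p -> L2w (fun x => 0 * p x + cst 0 x).
  by move=> Lp; apply: L2D' => //; exact: L2Z'.
have := hmin (pert 0 (cst 0) (cst 0)).
rewrite (IE hj Lj1 Lj2) (IE Z0 (Lp _ Lj1) (Lp _ Lj2)).
have -> : RN (pert 0 (cst 0) (cst 0)) = 0%E.
  apply/eqP; rewrite eq_le Radon_norm_ge0 andbT.
  suff -> : RN (pert 0 (cst 0) (cst 0)) = @Radon_norm R _ (mplane R) w test (fun=> 0).
    exact: (Radon_norm0 mw test_bounded).
  apply: eq_Radon_norm => phi tphi; rewrite (L_pert _ L0 L0 L0 c0 tphi) mul0r add0r.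
  rewrite (@eq_Rintegral _ _ _ _ _ (cst 0)); last by move=> x _; rewrite mulr0 mul0r.
  by rewrite /Rintegral integral0.
rewrite mule0 add0e; move: (Radon_norm_ge0 w test (L_ j)).
rewrite -/(RN j); case: (RN j) => [r _ _| _| //]; first by rewrite ltry.
by rewrite gt0_muley ?lte_fin ?invr_gt0// -EFinM addye// leye_eq.
Qed.

Let N : R := fine (RN j).
Let NE : RN j = N%:E. Proof. by rewrite fineK// RN_fin. Qed.
Let N0 : 0 <= N. Proof. by rewrite fine_ge0// Radon_norm_ge0. Qed.

Let key s k1 k2 h : 0 <= s -> L2w k1 -> L2w k2 -> L2w h -> curl_is w k1 k2 h ->
  N + Q j1 j2 <= s * N + ip a (fun x => `|h x|) +
    Q (fun x => s * j1 x + k1 x) (fun x => s * j2 x + k2 x).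
Proof.
move=> s0 L1 L2 Lh kh.
have Lsj p q : L2w p -> L2w q -> L2w (fun x => s * p x + q x).
  by move=> Lp Lq; apply: L2D' => //; exact: L2Z'.
have Lah := L2a Lh.
have Lc : L2w (cst 1).
  apply: (@bounded_L2 _ _ (mplane R) (@leb2 R) _ mw _ 1 (domain_lty ow bw)) => //.
  by move=> x _; rewrite normr1.
have iah : (@leb2 R).-integrable w (EFin \o (fun x => a x * h x)).
  have := int Lah Lc.
  by apply: eq_integrable; [exact: mw|move=> x _ /=; rewrite mulr1].
have E : (\int[@leb2 R]_(x in w) `|a x * h x|%:E)%E = (ip a (fun x => `|h x|))%:E.
  rewrite /dot /Rintegral fineK; last first.
    apply: integrable_fin_num; first exact: mw.
    have := integrable_norm iah; apply: eq_integrable; first exact: mw.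
    by move=> x /[!inE] wx /=; rewrite normrM gtr0_norm// a_gt0.
  apply: eq_integral => x /[!inE] wx.
  by rewrite normrM gtr0_norm// a_gt0.
have RNlt : (RN j < +oo)%E by rewrite NE ltry.
have RNp : (RN (pert s k1 k2) <= (s * N + ip a (fun x => `|h x|))%:E)%E.
  have -> : RN (pert s k1 k2) = @Radon_norm R _ (mplane R) w test
      (fun phi => s * L_ j phi + \int[@leb2 R]_(x in w) (a x * h x * phi x)).
    by apply: eq_Radon_norm => phi tphi; exact: L_pert.
  have := Radon_norm_perturb mw test_bounded s0 iah RNlt.
  by rewrite -/(RN j) NE E -EFinM -EFinD.
have := hmin (pert s k1 k2).
rewrite (IE hj Lj1 Lj2) (IE (Zpert s0 L1 L2 Lh kh) (Lsj _ _ Lj1 L1) (Lsj _ _ Lj2 L2)).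
rewrite NE; have RNge : (0 <= RN (pert s k1 k2))%E .
  exact: (@Radon_norm_ge0 R _ (mplane R) w test).
move: RNp RNge; case: (RN _) => [r rN _| |].
- rewrite lee_fin in rN.
  rewrite -!EFinM -!EFinD lee_fin -mulrDr -mulrDr ler_pM2l ?invr_gt0//.
  by move=> /le_trans; apply; rewrite lerD2r.
- by rewrite leye_eq.
- by move=> _; rewrite leeNy_eq.
Qed.

(** Minimality of [j] tested with the fields s j + k, where the curl of k is the
    function [h]; [N'] is the norm of a curl j. *)
Lemma minimizer_inequalities : exists N' : R, [/\ 0 <= N',
  forall phi c, test phi -> 0 < c -> (forall x, w x -> `|phi x| <= c) ->
    curl2 w j (fun x => a x * phi x) <= c * N' &
  forall s k1 k2 h, 0 <= s -> L2w k1 -> L2w k2 -> L2w h -> curl_is w k1 k2 h ->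
    N' + Q j1 j2 <= s * N' + ip a (fun x => `|h x|) +
      Q (fun x => s * j1 x + k1 x) (fun x => s * j2 x + k2 x)].
Proof.
exists N; split=> [|phi c tphi c0 phic|s k1 k2 h]; first exact: N0.
  have := @Radon_norm_ge R _ (mplane R) w test mw test_bounded (L_ j) phi c tphi c0 phic.
  by rewrite -/(RN j) NE -EFinM lee_fin.
exact: key.
Qed.

End Minimizer.

(** * The potential of a minimizer *)

Section Excess.
Context {R : realType}.
Implicit Types c u : R.

(** The difference of u and its projection onto the interval [-c, c]. *)
Definition excess c u : R := Num.max (u - c) 0 - Num.max (- u - c) 0.

Lemma excess_cases c u : 0 <= c ->
  [\/ c < u /\ excess c u = u - c, u < - c /\ excess c u = u + c |
      `|u| <= c /\ excess c u = 0].
Proof.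
move=> c0; rewrite /excess.
have [h1|h1] := ltP c u.
  apply: Or31; split=> //; rewrite max_l ?subr_ge0 ?ltW// max_r ?subr0//; lra.
have [h2|h2] := ltP u (- c).
  apply: Or32; split=> //; rewrite max_r ?subr_le0// max_l; lra.
apply: Or33; split; first by rewrite ler_norml h2 h1.
by rewrite max_r ?subr_le0// max_r ?subr0//; lra.
Qed.

Lemma excess_le c u : 0 <= c -> `|excess c u| <= `|u|.
Proof.
move=> c0; have [] := excess_cases u c0; last by move=> [_ ->]; rewrite normr0.
- move=> [cu ->]; rewrite !ger0_norm; lra.
- move=> [uc ->]; rewrite !ler0_norm; lra.
Qed.

Lemma excess_mul c u : 0 <= c ->
  excess c u * u = excess c u * excess c u + c * `|excess c u|.
Proof.
move=> c0; have [] := excess_cases u c0; last by move=> [_ ->]; rewrite normr0; ring.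
- by move=> [cu ->]; rewrite ger0_norm ?subr_ge0 ?ltW//; ring.
- by move=> [uc ->]; rewrite ler0_norm; [ring|lra].
Qed.

Lemma excess_eq0 c u : 0 <= c -> excess c u = 0 -> `|u| <= c.
Proof. by move=> c0; have [] := excess_cases u c0; move=> [? ->]// ?; lra. Qed.

End Excess.

Section DualProblem.
Context {R : realType}.
Variables (w : set (R * R)) (a ae F b1 b2 j1 j2 : R * R -> R) (al be N : R).
Hypotheses (ow : open w) (bw : bounded_set w).
Hypotheses (sae : smooth ae) (aE : forall x, w x -> a x = ae x).
Hypotheses (al0 : 0 < al) (aw : forall x, w x -> al <= a x).
Hypothesis abe : forall x, w x -> `|a x| <= be.
Local Notation mw := (domain_measurable ow).
Local Notation test := (@testfun R (R * R)%type w).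
Local Notation L2w := (L2 (@leb2 R) w).
Local Notation ip := (dot (@leb2 R) w).
Local Notation cvg2 := (cvgL2 (@leb2 R) w).
Hypotheses (Lb1 : L2w b1) (Lb2 : L2w b2) (LF : L2w F) (Lj1 : L2w j1) (Lj2 : L2w j2).
Hypothesis curlb : curl_is w b1 b2 F.
Hypotheses (N0 : 0 <= N)
  (curlj_le : forall phi c, test phi -> 0 < c -> (forall x, w x -> `|phi x| <= c) ->
    \int[@leb2 R]_(x in w) (j1 x * 'D_e2 (fun y => a y * phi y) x -
      j2 x * 'D_e1 (fun y => a y * phi y) x) <= c * N)
  (jmin : forall s k1 k2 h, 0 <= s -> L2w k1 -> L2w k2 -> L2w h -> curl_is w k1 k2 h ->
    N + misfit w a b1 b2 j1 j2 <= s * N + ip a (fun x => `|h x|) +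
      misfit w a b1 b2 (fun x => s * j1 x + k1 x) (fun x => s * j2 x + k2 x)).
Implicit Types (k h u p q : R * R -> R) (phi psi : R * R -> R).

Let ma : measurable_fun (w : set (mplane R)) a.
Proof. exact: (continuous_on_measurable (smooth_continuous sae) aE). Qed.
Let a_gt0 x : w x -> 0 < a x.
Proof. by move=> wx; apply: lt_le_trans (aw wx). Qed.
Let L2D' p q : L2w p -> L2w q -> L2w (fun x => p x + q x).
Proof. exact: (L2D mw). Qed.
Let L2B' p q : L2w p -> L2w q -> L2w (fun x => p x - q x).
Proof. exact: (L2B mw). Qed.
Let L2Z' c p : L2w p -> L2w (fun x => c * p x).
Proof. exact: (L2Z mw). Qed.
Let L2N' p : L2w p -> L2w (fun x => - p x).
Proof.
move=> Lp; apply: (L2_eq mw _ (L2Z' (-1) Lp)) => x _; exact: mulN1r.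
Qed.
Let L2a p : L2w p -> L2w (fun x => a x * p x).
Proof. exact: (L2_weight mw ma abe). Qed.
Let mia : measurable_fun (w : set (mplane R)) (fun x => (a x)^-1).
Proof.
have cia : continuous (fun x => (al + `|ae x - al|)^-1).
  move=> x; apply: cvgV; first by rewrite gt_eqF// ltr_pwDl.
  apply: cvgD; first exact: cvg_cst.
  by apply: cvg_norm; apply: cvgB; [exact: (smooth_continuous sae)|exact: cvg_cst].
apply: (continuous_on_measurable cia) => x wx.
by rewrite ger0_norm -aE// ?subr_ge0 ?aw// addrC subrK.
Qed.
Let iale x : w x -> `|(a x)^-1| <= al^-1.
Proof.
by move=> wx; rewrite gtr0_norm ?invr_gt0 ?a_gt0// lef_pV2 ?posrE ?a_gt0// aw.
Qed.
Let L2q p : L2w p -> L2w (fun x => p x / a x).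
Proof.
move=> Lp; apply: (L2_eq mw _ (L2_mul_bounded mw mia iale Lp)) => x _.
by rewrite mulrC.
Qed.
Let int p q : L2w p -> L2w q ->
  (@leb2 R).-integrable w (EFin \o (fun x => p x * q x)).
Proof. by move=> Lp Lq; exact: (L2_mul_integrable mw Lp Lq). Qed.
Let ipC p q : ip p q = ip q p. Proof. exact: dotC. Qed.
Let ipDl p q u : L2w p -> L2w q -> L2w u ->
  ip (fun x => p x + q x) u = ip p u + ip q u.
Proof. exact: (dotDl mw). Qed.
Let ipBl p q u : L2w p -> L2w q -> L2w u ->
  ip (fun x => p x - q x) u = ip p u - ip q u.
Proof. exact: (dotBl mw). Qed.
Let ipZl c p q : L2w p -> L2w q -> ip (fun x => c * p x) q = c * ip p q.
Proof. exact: (dotZl mw). Qed.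
Let ipNl p q : L2w p -> L2w q -> ip (fun x => - p x) q = - ip p q.
Proof.
move=> Lp Lq; rewrite -[RHS]mulN1r -(ipZl (-1) Lp Lq).
by apply: eq_Rintegral => x _; rewrite mulN1r.
Qed.

(* the field v = a (B - j) *)
Let v1 x := a x * (b1 x - j1 x).
Let v2 x := a x * (b2 x - j2 x).
Let Lv1 : L2w v1. Proof. exact: L2a (L2B' Lb1 Lj1). Qed.
Let Lv2 : L2w v2. Proof. exact: L2a (L2B' Lb2 Lj2). Qed.

(* second-order expansion of the misfit *)
Let misfit_var p1 p2 q1 q2 t : L2w q1 -> L2w q2 ->
  (forall x, p1 x - b1 x = (j1 x - b1 x) + t * q1 x) ->
  (forall x, p2 x - b2 x = (j2 x - b2 x) + t * q2 x) ->
  misfit w a b1 b2 p1 p2 = misfit w a b1 b2 j1 j2 -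
    t * (2 * (ip v1 q1 + ip v2 q2)) + t ^+ 2 * (wdot w a q1 q1 + wdot w a q2 q2).
Proof.
move=> Lq1 Lq2 /funext E1 /funext E2; rewrite /misfit E1 E2.
rewrite (wdot_sqr mw ma abe t (L2B' Lj1 Lb1) Lq1).
rewrite (wdot_sqr mw ma abe t (L2B' Lj2 Lb2) Lq2).
have V (b j q v : R * R -> R) : L2w v -> L2w q ->
    (forall x, v x = a x * (b x - j x)) ->
    wdot w a (fun x => j x - b x) q = - ip v q.
  move=> Lv Lq vE; rewrite -(ipNl Lv Lq); apply: eq_Rintegral => x _.
  by rewrite vE -mulrN opprB.
rewrite (V b1 j1 q1 v1 Lv1 Lq1 (fun=> erefl)) (V b2 j2 q2 v2 Lv2 Lq2 (fun=> erefl)).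
move: (wdot _ _ _ _) (wdot _ _ _ _) (wdot _ _ _ _) (wdot _ _ _ _) (ip v1 _) (ip v2 _).
by move=> A1 A2 A3 A4 A5 A6; ring.
Qed.

(** Perturbations of j by t k for t > 0, where k has curl [h]. *)
Let first_variation k1 k2 h : L2w k1 -> L2w k2 -> L2w h -> curl_is w k1 k2 h ->
  ip v1 k1 + ip v2 k2 <= 2^-1 * ip a (fun x => `|h x|).
Proof.
move=> L1 L2 Lh kh.
have H t : 0 < t <= 1 -> 0 <= t * (ip a (fun x => `|h x|) - 2 * (ip v1 k1 + ip v2 k2)) +
    t ^+ 2 * (wdot w a k1 k1 + wdot w a k2 k2).
  move=> /andP[t0 _].
  have kt : curl_is w (fun x => t * k1 x) (fun x => t * k2 x) (fun x => t * h x).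
    move=> psi tpsi; have Ld v := testfun_derive_L2 ow bw v tpsi.
    have I : (@leb2 R).-integrable w
        (EFin \o (fun x => k1 x * 'D_e2 psi x - k2 x * 'D_e1 psi x)).
      by have := integrableB mw (int L1 (Ld e2)) (int L2 (Ld e1)).
    transitivity (t * \int[@leb2 R]_(x in w) (k1 x * 'D_e2 psi x - k2 x * 'D_e1 psi x)).
      rewrite -(RintegralZl t mw I); apply: eq_Rintegral => x _.
      by rewrite mulrBr !mulrA.
    rewrite (kh _ tpsi) -(RintegralZl t mw (int Lh (testfun_L2 ow bw tpsi))).
    by apply: eq_Rintegral => x _; rewrite mulrA.
  have := jmin ler01 (L2Z' t L1) (L2Z' t L2) (L2Z' t Lh) kt.
  rewrite (@misfit_var (fun x => 1 * j1 x + t * k1 x) (fun x => 1 * j2 x + t * k2 x)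
    k1 k2 t L1 L2); last 2 first.
  - by move=> x; rewrite mul1r addrAC.
  - by move=> x; rewrite mul1r addrAC.
  have Labs : L2w (fun x => `|h x|).
    apply: (@L2_le _ _ (mplane R) (@leb2 R) _ mw _ h) => //.
      by apply: measurableT_comp => //; exact: (L2_measurable Lh).
    by move=> x _; rewrite normr_id.
  have La : L2w a.
    exact: (bounded_L2 mw (domain_lty ow bw) ma abe).
  have -> : ip a (fun x => `|t * h x|) = t * ip a (fun x => `|h x|).
    rewrite (ipC _ (fun x => `|h x|)) -(ipZl t Labs La) ipC.
    by apply: eq_Rintegral => x _; rewrite normrM gtr0_norm.
  move: (misfit _ _ _ _ _ _) (ip a _) (ip v1 _ + ip v2 _) (wdot _ _ _ _ + wdot _ _ _ _).
  by move=> A1 A2 A3 A4; lra.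
by have := linear_part_ge0 H; move: (ip a _) (ip v1 _ + ip v2 _) => A1 A2; lra.
Qed.

(** Perturbations of j by multiples of j, of both signs. *)
Let scaling_variation : ip v1 j1 + ip v2 j2 = 2^-1 * N.
Proof.
have L0 : L2w (cst 0) by exact: L2_0.
have c0 : curl_is w (cst 0) (cst 0) (cst 0).
  by move=> psi _; apply: eq_Rintegral => x _; rewrite !mul0r subr0.
have a0 : ip a (fun x => `|cst 0 x : R|) = 0.
  rewrite /dot (@eq_Rintegral _ _ _ _ _ (cst 0)); last by move=> x _; rewrite /= normr0 mulr0.
  by rewrite /Rintegral integral0.
have V t : -1 <= t -> 0 <= t * (N - 2 * (ip v1 j1 + ip v2 j2)) +
    t ^+ 2 * (wdot w a j1 j1 + wdot w a j2 j2).
  move=> t1; have s0 : 0 <= 1 + t by lra.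
  have := jmin s0 L0 L0 L0 c0; rewrite a0.
  rewrite (@misfit_var (fun x => (1 + t) * j1 x + cst 0 x)
    (fun x => (1 + t) * j2 x + cst 0 x) j1 j2 t Lj1 Lj2); last 2 first.
  - by move=> x; rewrite /= addr0 mulrDl mul1r addrAC.
  - by move=> x; rewrite /= addr0 mulrDl mul1r addrAC.
  move: (misfit _ _ _ _ _ _) (ip v1 _ + ip v2 _) (wdot _ _ _ _ + wdot _ _ _ _).
  by move=> A1 A2 A3; lra.
have P : 0 <= N - 2 * (ip v1 j1 + ip v2 j2).
  apply: (@linear_part_ge0 _ _ (wdot w a j1 j1 + wdot w a j2 j2)) => t /andP[t0 _].
  by apply: V; lra.
have M : 0 <= - (N - 2 * (ip v1 j1 + ip v2 j2)).
  apply: (@linear_part_ge0 _ _ (wdot w a j1 j1 + wdot w a j2 j2)) => t /andP[t0 t1].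
  have t2 : -1 <= - t by lra.
  by have := V _ t2; rewrite sqrrN mulrN mulNr.
by move: P M; move: (ip v1 _ + ip v2 _) => A1; lra.
Qed.

(** The field v is the rotated gradient of an element [zeta] of H^1_0: the
    projection of v onto rotated gradients leaves a curl-free remainder q, and
    perturbing j by q shows that q vanishes. *)
Let potential : exists (zeta : R * R -> R) (phi : nat -> R * R -> R),
  H10_approx w phi zeta (fun x => - v2 x) v1.
Proof.
have L0 : L2w (cst 0) by exact: L2_0.
have [u [G1 [G2 [phi [[tphi [Lu LG1 LG2] [cu c1 c2]] HG]]]]] :=
  dirichlet_solution ow bw (L2N' Lv2) Lv1 L0.
pose q1 x := v1 x - G2 x; pose q2 x := v2 x + G1 x.
have Lq1 : L2w q1 by exact: L2B'.
have Lq2 : L2w q2 by exact: L2D'.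
have D v psi : test psi -> L2w ('D_v psi) by exact: testfun_derive_L2.
have z0 psi : ip (cst 0) psi = 0.
  rewrite /dot (@eq_Rintegral _ _ _ _ _ (cst 0)); last by move=> x _; rewrite mul0r.
  by rewrite /Rintegral integral0.
(* q is curl-free *)
have free psi : test psi -> ip q1 ('D_e2 psi) - ip q2 ('D_e1 psi) = 0.
  move=> tpsi; rewrite (ipBl Lv1 LG2 (D e2 _ tpsi)) (ipDl Lv2 LG1 (D e1 _ tpsi)).
  have := HG _ tpsi; rewrite z0 (ipNl Lv2 (D e1 _ tpsi)).
  move: (ip G1 _) (ip G2 _) (ip v1 _) (ip v2 _) => A1 A2 A3 A4; lra.
have q0 : curl_is w q1 q2 (cst 0).
  move=> psi tpsi; rewrite -/(dot (@leb2 R) w (cst 0) psi) z0 -(free _ tpsi) /dot.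
  by rewrite -(RintegralB mw (int Lq1 (D e2 _ tpsi)) (int Lq2 (D e1 _ tpsi))).
(* q is orthogonal to the rotated gradient of [u] *)
have orth : ip G2 q1 - ip G1 q2 = 0.
  have A : ip ('D_e2 (phi n)) q1 - ip ('D_e1 (phi n)) q2 @[n --> \oo] -->
      ip G2 q1 - ip G1 q2.
    apply: cvgB.
      by apply: (cvgL2_dot mw _ LG2 Lq1 c2) => n; exact: D.
    by apply: (cvgL2_dot mw _ LG1 Lq2 c1) => n; exact: D.
  have B : ip ('D_e2 (phi n)) q1 - ip ('D_e1 (phi n)) q2 @[n --> \oo] --> (0 : R).
    apply: cvg_near_cst; apply: nearW => n.
    by rewrite (ipC _ q1) (ipC _ q2) free.
  exact: (cvg_unique (@norm_hausdorff _ R) A B).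
have neg := first_variation Lq1 Lq2 L0 q0.
have a0 : ip a (fun x => `|cst 0 x : R|) = 0.
  rewrite ipC (_ : (fun x => _) = cst 0) ?z0//.
  by apply/funext => x; rewrite /= normr0.
rewrite a0 mulr0 in neg.
have E1 : ip q1 q1 = ip v1 q1 - ip G2 q1 by rewrite -(ipBl Lv1 LG2 Lq1).
have E2 : ip q2 q2 = ip v2 q2 + ip G1 q2 by rewrite -(ipDl Lv2 LG1 Lq2).
have p1 := dot_ge0 (@leb2 R) w q1; have p2 := dot_ge0 (@leb2 R) w q2.
have [Z1 Z2] : ip q1 q1 = 0 /\ ip q2 q2 = 0.
  move: p1 p2 neg orth E1 E2; move: (ip q1 q1) (ip q2 q2) (ip v1 q1) (ip G2 q1).
  by move: (ip v2 q2) (ip G1 q2) => A1 A2 A3 A4 A5 A6; lra.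
exists u, phi; split=> //; first by split=> //; exact: L2N'.
split=> //.
  apply: (cvgL2_eq mw _ LG1 (L2N' Lv2) _ c1) => [n|]; first exact: D.
  by rewrite -Z2; apply: eq_Rintegral => x _; rewrite /q2 opprK addrC.
apply: (cvgL2_eq mw _ LG2 Lv1 _ c2) => [n|]; first exact: D.
by rewrite -Z1; apply: eq_Rintegral => x _; rewrite /q1 -mulrNN !opprB.
Qed.

(** With [h] the excess of [zeta] over a / 2, perturb j by a field k with curl
    [h], the rotated gradient of the solution of Poisson's equation.  Since
    the integral of v . k is that of [h * zeta], the first variation bounds it
    by the integral of a |h| / 2, and [excess_mul] gives [h = 0]. *)
Let potential_bound zeta (phi : nat -> R * R -> R) :
  H10_approx w phi zeta (fun x => - v2 x) v1 ->
  {ae @leb2 R, forall x, w x -> `|zeta x| <= a x / 2}.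
Proof.
move=> [tphi [Lz _ _] [cz c1 c2]].
have a2 x : w x -> 0 <= a x / 2 by move=> wx; rewrite divr_ge0// ltW// a_gt0.
pose h x := excess (a x / 2) (zeta x).
have mz := L2_measurable Lz.
have Lh : L2w h.
  apply: (@L2_le _ _ (mplane R) (@leb2 R) _ mw _ zeta) => //; last first.
    by move=> x wx; exact: excess_le (a2 x wx).
  have ma2 : measurable_fun (w : set (mplane R)) (fun x => a x / 2).
    exact: measurable_funM.
  apply: measurable_funB; apply: measurable_maxr => //; apply: measurable_funB => //.
  exact: measurableT_comp.
have L0 : L2w (cst 0) by exact: L2_0.
have [u [G1 [G2 [psi [[_ [Lu LG1 LG2] _] HG]]]]] := dirichlet_solution ow bw L0 L0 Lh.
have D v p : test p -> L2w ('D_v p) by exact: testfun_derive_L2.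
have z0 p : ip (cst 0) p = 0.
  rewrite /dot (@eq_Rintegral _ _ _ _ _ (cst 0)); last by move=> x _; rewrite mul0r.
  by rewrite /Rintegral integral0.
have HG' p : test p -> ip G1 ('D_e1 p) + ip G2 ('D_e2 p) = ip h p.
  by move=> tp; rewrite HG// !z0 !add0r.
have kh : curl_is w G2 (fun x => - G1 x) h.
  move=> p tp; rewrite -/(dot (@leb2 R) w h p) -(HG' _ tp) addrC.
  rewrite -[X in _ = _ + X]opprK -(ipNl LG1 (D e1 _ tp)).
  by rewrite -(RintegralB mw (int LG2 (D e2 _ tp)) (int (L2N' LG1) (D e1 _ tp))).
have V := first_variation LG2 (L2N' LG1) Lh kh.
have E : ip h zeta = ip v1 G2 + ip v2 (fun x => - G1 x).
  have Lp n := testfun_L2 ow bw (tphi n).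
  have A : ip (phi n) h @[n --> \oo] --> ip zeta h by exact: (cvgL2_dot mw Lp Lz Lh cz).
  have B : ip ('D_e1 (phi n)) G1 + ip ('D_e2 (phi n)) G2 @[n --> \oo] -->
      ip (fun x => - v2 x) G1 + ip v1 G2.
    apply: cvgD.
      by apply: (cvgL2_dot mw _ (L2N' Lv2) LG1 c1) => n; exact: D.
    by apply: (cvgL2_dot mw _ Lv1 LG2 c2) => n; exact: D.
  have AB : (fun n => ip (phi n) h) =
      (fun n => ip ('D_e1 (phi n)) G1 + ip ('D_e2 (phi n)) G2).
    by apply/funext => n; rewrite (ipC _ h) -(HG' _ (tphi n)) (ipC _ G1) (ipC _ G2).
  rewrite AB in A; rewrite (ipC h) (cvg_unique (@norm_hausdorff _ R) A B) addrC.
  congr (_ + _); rewrite (ipNl Lv2 LG1) (ipC v2 (fun x => - G1 x)) (ipNl LG1 Lv2).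
  by rewrite (ipC v2).
have La : L2w a by exact: (bounded_L2 mw (domain_lty ow bw) ma abe).
have Labs : L2w (fun x => `|h x|).
  apply: (@L2_le _ _ (mplane R) (@leb2 R) _ mw _ h) => //.
    by apply: measurableT_comp => //; exact: (L2_measurable Lh).
  by move=> x _; rewrite normr_id.
have S : ip h zeta = ip h h + 2^-1 * ip a (fun x => `|h x|).
  rewrite -(ipZl (2^-1) La Labs).
  rewrite -(RintegralD mw (int Lh Lh) (int (L2Z' (2^-1) La) Labs)).
  apply: eq_Rintegral => x /[!inE] wx; rewrite /h (excess_mul _ (a2 x wx)).
  by rewrite (mulrC (a x)).
have h0 : ip h h = 0.
  have := dot_ge0 (@leb2 R) w h; move: V S; rewrite E.
  move: (ip h h) (ip a _) (ip v1 G2 + _) => A1 A2 A3; lra.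
apply: filterS (dot_eq0 mw Lh h0) => x hx wx.
by apply: (excess_eq0 (a2 x wx)); exact: hx.
Qed.

(* the product rule for phi = a (phi / a), solved for the last derivative *)
Let ratio_derive phi v x : test phi ->
  ae x * 'D_v (fun y => phi y / a y) x = 'D_v phi x - phi x / a x * 'D_v ae x.
Proof.
move=> tphi.
have ae0 y : w y -> ae y != 0 by move=> wy; rewrite -aE// gt_eqF// a_gt0.
have tq : test (fun y => phi y / a y) by exact: (testfun_div ow sae ae0 aE tphi).
have E : phi = fun y => ae y * (phi y / a y).
  apply/funext => y; have [wy|wy] := pselect (w y).
    by rewrite -(aE wy) mulrC divfK// gt_eqF// a_gt0.
  by rewrite (testfun_off tphi wy) mul0r mulr0.
rewrite [in X in _ = X - _]E (@deriveM _ _ ae (fun y => phi y / a y)).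
- by rewrite /GRing.scale/= addrK.
- exact: smooth_derivable.
- exact: testfun_derivable tq.
Qed.

(** The constraint |xi| <= a / 2 bounds the pairing of xi with curl j by half
    of the norm [N] of a curl j.  The test functions are smooth truncations, at
    a level [c > 1 / 2], of the ratios psi / a, where psi approximates xi. *)
Let curl_pairing xi (psi : nat -> R * R -> R) X1 X2 : H10_approx w psi xi X1 X2 ->
  {ae @leb2 R, forall x, w x -> `|xi x| <= a x / 2} ->
  ip j1 X2 - ip j2 X1 <= 2^-1 * N.
Proof.
move=> [tpsi0 [Lxi LX1 LX2] [cx0 c10 c20]] xia.
apply: le_of_lt_factor => // c c2.
have Lpsi0 n := testfun_L2 ow bw (tpsi0 n).
have [s [sn cae]] := cvgL2_ae_subseq mw Lpsi0 Lxi cx0.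
have tpsi n : test (psi (s n)) by [].
have cx := cvgL2_subseq sn cx0.
have c1 := cvgL2_subseq sn c10; have c2' := cvgL2_subseq sn c20.
have ae0 y : w y -> ae y != 0 by move=> wy; rewrite -aE// gt_eqF// a_gt0.
pose phi n (x : R * R) := psi (s n) x / a x.
have tphi n : test (phi n) by exact: (testfun_div ow sae ae0 aE (tpsi n)).
have lam0 n : 0 < n.+1%:R :> R by rewrite ltr0n.
have lamN n : n.+1%:R != 0 :> R by rewrite gt_eqF.
have c0 : 0 < c by lra.
pose Phi n (x : R * R) := clamp n.+1%:R c (phi n x).
pose th n (x : R * R) := dclamp n.+1%:R c (phi n x).
have tPhi n : test (Phi n) by exact: testfun_clamp.
pose eta x := xi x / a x.
pose b x := j1 x * 'D_e2 ae x - j2 x * 'D_e1 ae x.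
have D v p : test p -> L2w ('D_v p) by exact: testfun_derive_L2.
have Lae p v : L2w p -> L2w (fun x => p x * 'D_v ae x).
  move=> Lp; have cD := smooth_continuous (smooth_derive v sae).
  have [C [_ HC]] := continuous_bounded_on bw cD (fun x _ => erefl ('D_v ae x)).
  apply: (L2_eq mw _ (L2_mul_bounded mw (continuous_on_measurable cD (fun x _ => erefl _)) HC Lp)).
  by move=> x _; rewrite mulrC.
have Lb : L2w b by apply: L2B'; exact: Lae.
have dPhi n v x : w x -> 'D_v (fun y => a y * Phi n y) x =
    th n x * ('D_v (psi (s n)) x - phi n x * 'D_v ae x) + Phi n x * 'D_v ae x.
  move=> wx; rewrite (_ : (fun y => a y * Phi n y) = (fun y => ae y * Phi n y)); last first.
    apply/funext => y; have [wy|wy] := pselect (w y); first by rewrite aE.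
    by rewrite (testfun_off (tPhi n) wy) !mulr0.
  rewrite (@deriveM _ _ ae (Phi n)); last 2 first.
  - exact: smooth_derivable.
  - exact: testfun_derivable (tPhi n).
  have dphi : derivable (phi n) x v by exact: testfun_derivable (tphi n).
  have [_ dE] := derive_clamp c (lamN n) dphi.
  rewrite /GRing.scale/= dE -(ratio_derive v x (tpsi n)) -/(th n x).
  by rewrite mulrCA.
have FF := @ae_filter_ringOfSetsType _ _ R (@leb2 R).
(* the limit [eta] of the ratios is bounded by 1/2 < c, so in the limit the
   truncation does nothing *)
have aeX : {ae @leb2 R, forall x, w x ->
    Phi n x @[n --> \oo] --> eta x /\ th n x @[n --> \oo] --> (1 : R)}.
  apply: filterS2 xia cae => x h1 h2 wx.
  have ax := a_gt0 wx.
  have pe : phi n x @[n --> \oo] --> eta x by apply: cvgMl; exact: h2.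
  have ele : `|eta x| <= 2^-1.
    by rewrite normrM (gtr0_norm (_ : 0 < (a x)^-1)) ?invr_gt0// ler_pdivrMr// mulrC h1.
  (* [c - d] is halfway between 1/2 and [c] *)
  pose d := 2^-1 * (c - 2^-1).
  have d0 : 0 < d by rewrite /d; lra.
  have near_c : \forall n \near \oo, `|phi n x| <= c - d.
    move/cvgrPdist_le : pe => /(_ _ d0); apply: filterS => n pn.
    have := ler_normB (eta x) (eta x - phi n x); rewrite subKr => /le_trans; apply.
    by move: pn ele; rewrite /d; lra.
  have harm := @cvg_harmonic R.
  split.
    rewrite -[eta x]addr0 (_ : (fun n => _) = (fun n => phi n x + (Phi n x - phi n x))).
      apply: cvgD => //; apply/cvgrPdist_le => e e0.
      move/cvgrPdist_le : harm => /(_ _ e0); apply: filterS2 near_c => n pn.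
      rewrite !sub0r !normrN => /(le_trans _); apply.
      rewrite /harmonic [leRHS]ger0_norm ?invr_ge0//; apply: clamp_near_id => //.
      by apply: (le_trans pn); lra.
    by apply/funext => n; rewrite addrC subrK.
  apply/cvgrPdist_le => e e0.
  have ed : 0 < e * d / 2 by rewrite divr_gt0// mulr_gt0.
  move/cvgrPdist_le : harm => /(_ _ ed); apply: filterS2 near_c => n pn.
  rewrite sub0r normrN /harmonic ger0_norm ?invr_ge0// => hn.
  have /andP[t0 t1] := dclamp_bounds (phi n x) (lam0 n) (ltW c0).
  rewrite ger0_norm ?subr_ge0//.
  have cd : c - d <= c by lra.
  apply: (le_trans (dclamp_near_1 (lam0 n) pn cd)); rewrite subKr.
  have nd : 0 < n.+1%:R * d by rewrite mulr_gt0.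
  rewrite ler_pdivrMr; last by lra.
  have : 1 <= n.+1%:R * (e * d / 2) by rewrite -ler_pdivrMl// mulr1.
  by move: nd; move: (n.+1%:R : R) => r; nra.
have mth n : measurable_fun (w : set (mplane R)) (th n).
  have cth : continuous (th n).
    by apply: smooth_continuous; apply: smooth_dclamp; exact: (tphi n).1.
  exact: (continuous_on_measurable cth (fun x _ => erefl (th n x))).
have th1 n x : w x -> `|th n x| <= 1.
  move=> _; have /andP[t0 t1] := dclamp_bounds (phi n x) (lam0 n) (ltW c0).
  by rewrite ger0_norm.
have Leta : L2w eta by exact: L2q.
have Lphi n : L2w (phi n) by exact: testfun_L2 (tphi n).
have ceta : cvg2 phi eta.
  have := cvgL2_mul_bounded mw (fun n => Lpsi0 (s n)) Lxi mia iale cx.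
  rewrite /cvgL2; under eq_fun => n.
    rewrite (_ : dot _ _ _ _ = ip (fun x => phi n x - eta x) (fun x => phi n x - eta x)).
      over.
    by apply: eq_Rintegral => x _; rewrite /phi /eta !(mulrC (a x)^-1).
  by [].
(* the bound for the truncation [Phi n], with the derivatives of [psi] and of
   [a] in place of those of [Phi n] *)
have pair n : ip (fun x => th n x * j1 x) ('D_e2 (psi (s n))) -
    ip (fun x => th n x * j2 x) ('D_e1 (psi (s n))) -
    ip (fun x => th n x * b x) (phi n) + \int[@leb2 R]_(x in w) (Phi n x * b x) <= c * N.
  have LPhi := testfun_L2 ow bw (tPhi n).
  have Lth p : L2w p -> L2w (fun x => th n x * p x).
    exact: (L2_mul_bounded mw (mth n) (th1 n)).
  have I1 := int (Lth _ Lj1) (D e2 _ (tpsi n)).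
  have I2 := int (Lth _ Lj2) (D e1 _ (tpsi n)).
  have I3 := int (Lth _ Lb) (Lphi n); have I4 := int LPhi Lb.
  have I12 := integrableB mw I1 I2; have I123 := integrableB mw I12 I3.
  rewrite -(RintegralB mw I1 I2) -(RintegralB mw I12 I3) -(RintegralD mw I123 I4).
  apply: le_trans (curlj_le (tPhi n) c0 _); last first.
    by move=> x _; exact: (clamp_bounded (phi n x) (lam0 n) (ltW c0)).
  rewrite le_eqVlt; apply/orP; left; apply/eqP; apply: eq_Rintegral => x /[!inE] wx; rewrite !dPhi// /b.
  move: ('D_e1 _ x) ('D_e2 _ x) ('D_e1 _ x) ('D_e2 _ x) (th n x) (phi n x) (Phi n x).
  by move=> A1 A2 A3 A4 A5 A6 A7; ring.
have th_lim : {ae @leb2 R, forall x, w x -> th n x @[n --> \oo] --> (1 : R)}.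
  by apply: filterS aeX => x h /h[].
have Phi_lim : {ae @leb2 R, forall x, w x -> Phi n x @[n --> \oo] --> eta x}.
  by apply: filterS aeX => x h /h[].
have lim1 := cvg_dot_mul mw mth th1 th_lim Lj1 LX2 (fun n => D e2 _ (tpsi n)) c2'.
have lim2 := cvg_dot_mul mw mth th1 th_lim Lj2 LX1 (fun n => D e1 _ (tpsi n)) c1.
have lim3 := cvg_dot_mul mw mth th1 th_lim Lb Leta Lphi ceta.
have ib : (@leb2 R).-integrable w (EFin \o b).
  have L1 : L2w (cst 1).
    by apply: (bounded_L2 (c := 1) mw (domain_lty ow bw)) => // x _; rewrite normr1.
  have := int Lb L1; apply: eq_integrable; first exact: mw.
  by move=> x _ /=; rewrite mulr1.
have lim4 := cvg_Rintegral_mul mw (fun n => L2_measurable (testfun_L2 ow bw (tPhi n)))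
  (fun n x _ => clamp_bounded (phi n x) (lam0 n) (ltW c0)) Phi_lim (L2_measurable Leta) ib.
have lim := cvgD (cvgB (cvgB lim1 lim2) lim3) lim4.
have -> : ip j1 X2 - ip j2 X1 = ip j1 X2 - ip j2 X1 - ip b eta +
    \int[@leb2 R]_(x in w) (eta x * b x).
  by rewrite -/(dot (@leb2 R) w eta b) (ipC eta) subrK.
apply: (cvgr_to_le (lim _ _ _)); apply: nearW; exact: pair.
Qed.
Let d1 x := b1 x - j1 x.
Let d2 x := b2 x - j2 x.
Let Ld1 : L2w d1. Proof. exact: L2B'. Qed.
Let Ld2 : L2w d2. Proof. exact: L2B'. Qed.

Let young p d : L2w p -> L2w d ->
  0 <= ip (fun x => p x / a x) p + 2 * ip d p + ip (fun x => a x * d x) d.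
Proof.
move=> Lp Ld; have Lq := L2q Lp; have La := L2a Ld; have Ls := L2D' Lp La.
have : 0 <= ip (fun x => p x / a x + d x) (fun x => p x + a x * d x).
  apply: Rintegral_ge0 => x wx; have ax := a_gt0 wx.
  rewrite (_ : _ * _ = a x * (p x / a x + d x) ^+ 2).
    by rewrite mulr_ge0 ?sqr_ge0// ltW.
  by field; rewrite gt_eqF.
rewrite (ipDl Lq Ld Ls) (ipC _ (fun x => p x + _)) (ipC d (fun x => p x + _)).
rewrite (ipDl Lp La Lq) (ipDl Lp La Ld) (ipC p (fun x => p x / _)) (ipC p d).
have -> : ip (fun x => a x * d x) (fun x => p x / a x) = ip d p.
  apply: eq_Rintegral => x /[!inE] wx; have ax := a_gt0 wx.
  by field; rewrite gt_eqF.
by move: (ip _ _) (ip _ _) (ip _ _) => A1 A2 A3; lra.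
Qed.

Let energyE (xi : R * R -> R) (X : R * R -> R * R) :
  L2w xi -> L2w (fun x => (X x).1) -> L2w (fun x => (X x).2) ->
  \int[@leb2 R]_(x in w) (normsq (X x) / (2 * a x) - F x * xi x) =
  2^-1 * (ip (fun x => (X x).1 / a x) (fun x => (X x).1) +
          ip (fun x => (X x).2 / a x) (fun x => (X x).2)) - ip F xi.
Proof.
move=> Lxi L1 L2; have I1 := int (L2q L1) L1; have I2 := int (L2q L2) L2.
have I12 := integrableD mw I1 I2.
have Ih : (@leb2 R).-integrable w (EFin \o (fun x => 2^-1 *
    ((X x).1 / a x * (X x).1 + (X x).2 / a x * (X x).2))).
  by have := integrableZl mw 2^-1 I12.
rewrite /dot -(RintegralD mw I1 I2) -(RintegralZl _ mw I12).
rewrite -(RintegralB mw Ih (int LF Lxi)); apply: eq_Rintegral => x /[!inE] wx.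
have ax := a_gt0 wx; congr (_ - _); rewrite /normsq.
by move: ((X x).1) ((X x).2) => p q; field; rewrite gt_eqF.
Qed.

(* since curl B = F *)
Let load_pairing xi (psi : nat -> R * R -> R) X1 X2 : H10_approx w psi xi X1 X2 ->
  ip F xi = ip b1 X2 - ip b2 X1.
Proof.
move=> [tpsi [Lxi LX1 LX2] [cx c1 c2]].
have D v n := testfun_derive_L2 ow bw v (tpsi n).
have A := cvgL2_dot mw (fun n => testfun_L2 ow bw (tpsi n)) Lxi LF cx.
have B := cvgB (cvgL2_dot mw (D e2) LX2 Lb1 c2) (cvgL2_dot mw (D e1) LX1 Lb2 c1).
have AB : (fun n => ip (psi n) F) =
    (fun n => ip ('D_e2 (psi n)) b1 - ip ('D_e1 (psi n)) b2).
  apply/funext => n; rewrite (ipC _ F) (ipC _ b1) (ipC _ b2) /dot -(curlb (tpsi n)).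
  by rewrite -(RintegralB mw (int Lb1 (D e2 n)) (int Lb2 (D e1 n))).
rewrite AB in A.
rewrite (ipC F) (ipC b1) (ipC b2); exact: (cvg_unique (@norm_hausdorff _ R) A (B _)).
Qed.

(** By Young's inequality, the energy of any potential is bounded below by the
    pairing of its gradient with j. *)
Let energy_ge xi (psi : nat -> R * R -> R) (X : R * R -> R * R) :
  H10_approx w psi xi (fun x => (X x).1) (fun x => (X x).2) ->
  - (ip j1 (fun x => (X x).2) - ip j2 (fun x => (X x).1)) -
    2^-1 * (ip v1 d1 + ip v2 d2) <=
  \int[@leb2 R]_(x in w) (normsq (X x) / (2 * a x) - F x * xi x).
Proof.
move=> H; have Fx := load_pairing H; have [_ [Lxi L1 L2] _] := H.
rewrite (energyE Lxi L1 L2) Fx.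
have Y1 := young L1 Ld2; have Y2 := young L2 (L2N' Ld1).
have E : ip (fun x => a x * (- d1 x)) (fun x => - d1 x) = ip v1 d1.
  by apply: eq_Rintegral => x _; rewrite !mulrN mulNr opprK.
rewrite E (ipNl Ld1 L2) in Y2.
rewrite (ipBl Lb1 Lj1 L2) in Y2; rewrite (ipBl Lb2 Lj2 L1) in Y1.
rewrite -/v2 in Y1.
move: Y1 Y2; rewrite -/(ip v2 d2).
move: (ip _ _) (ip _ _) (ip _ _) (ip _ _) (ip _ _) (ip _ _) (ip _ _) (ip _ _).
by move=> A1 A2 A3 A4 A5 A6 A7 A8; lra.
Qed.

(** The lower bound of [energy_ge] is attained by [zeta], by [load_pairing] and
    [scaling_variation]. *)
Lemma potential_minimizer (f g : R * R -> R) : (forall x, a x = thickness f g x) ->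
  exists (zeta : R * R -> R) (G : R * R -> R * R),
    [/\ admissible w f g zeta G,
        forall (xi : R * R -> R) (X : R * R -> R * R),
          admissible w f g xi X ->
          Einfty w f g F zeta G <= Einfty w f g F xi X
      & forall x, w x -> (j1 x, j2 x) =
          (b1 x, b2 x) - (thickness f g x)^-1 *: perp (G x)].
Proof.
move=> afg; have [zeta [phi H]] := potential; have [_ [Lz LG1 LG2] _] := H.
pose G (x : R * R) : R * R := (- v2 x, v1 x).
have FF := @ae_filter_ringOfSetsType _ _ R (@leb2 R).
exists zeta, G; split.
- split; first exact: (H10_approx_in_H10 ow bw H).
  by apply: filterS (potential_bound H) => x zx wx; rewrite -afg; exact: zx.
- move=> xi X [HX xia].
  have EE (u : R * R -> R) (Y : R * R -> R * R) : Einfty w f g F u Y =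
      \int[@leb2 R]_(x in w) (normsq (Y x) / (2 * a x) - F x * u x).
    by apply: eq_Rintegral => x _; rewrite afg.
  have [psi Hpsi] := in_H10_approx ow bw HX.
  have xia' : {ae @leb2 R, forall x, w x -> `|xi x| <= a x / 2}.
    by apply: filterS xia => x zx wx; rewrite afg; exact: zx.
  have P := curl_pairing Hpsi xia'; have Q := energy_ge Hpsi.
  rewrite !EE; apply: le_trans Q.
  rewrite (energyE (X := G) Lz LG1 LG2) (load_pairing H) /=.
  have E1 : ip (fun x => v1 x / a x) v1 = ip v1 d1.
    apply: eq_Rintegral => x /[!inE] wx; have ax := a_gt0 wx.
    by rewrite {1}/v1 (mulrAC (a x)) divff ?gt_eqF// mul1r mulrC.
  have E2 : ip (fun x => - v2 x / a x) (fun x => - v2 x) = ip v2 d2.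
    apply: eq_Rintegral => x /[!inE] wx; have ax := a_gt0 wx.
    by rewrite mulNr mulrNN {1}/v2 (mulrAC (a x)) divff ?gt_eqF// mul1r mulrC.
  rewrite E1 E2 (ipC b2) (ipNl Lv2 Lb2) (ipC b1).
  have S := scaling_variation.
  have D1 : ip v1 d1 = ip v1 b1 - ip v1 j1.
    by rewrite (ipC v1 d1) (ipBl Lb1 Lj1 Lv1) (ipC b1) (ipC j1).
  have D2 : ip v2 d2 = ip v2 b2 - ip v2 j2.
    by rewrite (ipC v2 d2) (ipBl Lb2 Lj2 Lv2) (ipC b2) (ipC j2).
  move: P S D1 D2; move: (ip v1 d1) (ip v2 d2) (ip v1 b1) (ip v2 b2) (ip v1 j1) (ip v2 j2).
  by move: (ip j1 _) (ip j2 _) => A1 A2 A3 A4 A5 A6 A7 A8; lra.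
- move=> x wx; have ax : thickness f g x != 0 by rewrite -afg gt_eqF// a_gt0.
  rewrite /perp /G /= opprK /v1 /v2 afg.
  by congr (_, _); rewrite /= /GRing.scale/= mulKf// subKr.
Qed.

End DualProblem.

(** * The minimizing field and its potential *)

(** The derivatives in the effective field are taken of [f] and [g] themselves,
    which agree with their smooth extensions near every point of the open set
    [w]. *)
Lemma effective_field_smooth {R : realType} (w : set (R * R)) (f g fe ge : R * R -> R)
    (H1 H2 H3 : R) : open w -> smooth fe -> smooth ge ->
  (forall x, w x -> f x = fe x) -> (forall x, w x -> g x = ge x) ->
  exists2 Fe : R * R -> R, smooth Fe &
    forall x, w x -> effective_field f g H1 H2 H3 x = Fe x.
Proof.
move=> ow sf sg ffe gge.
pose me (z : R * R) := 2^-1 * (fe z + ge z).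
have sm : smooth me by apply: smoothZ; exact: smoothD.
exists (fun x => H3 - (H1 * 'D_e1 me x + H2 * 'D_e2 me x)).
  apply: smoothB; first exact: smooth_cst.
  by apply: smoothD; apply: smoothZ; exact: smooth_derive.
move=> x wx; have E v : 'D_v (fun z => (f z + g z) / 2) x = 'D_v me x.
  apply: near_eq_derive => //.
  have : \forall z \near x, w z by exact: open_nbhs_nbhs.
  by apply: filterS => z wz; rewrite /me ffe// gge// mulrC.
by rewrite /effective_field !E.
Qed.

Theorem proposition1p3 (R : realType) (w : set (R * R)) (f g : R * R -> R)
  (H1 H2 H3 : R) (B j : R * R -> R * R)
  (F := effective_field f g H1 H2 H3)
  (hw : smooth_bounded_domain w)
  (hf : smooth_on_closure w f) (hg : smooth_on_closure w g)
  (hfg : forall x, closure w x -> f x < g x)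
  (hB1 : smooth_on_closure w (fun x => (B x).1))
  (hB2 : smooth_on_closure w (fun x => (B x).2))
  (hcurl : forall phi, testfun w phi ->
     curl2 w B phi = \int[leb2]_(x in w) (F x * phi x))
  (hj : Zspace w f g j)
  (hmin : forall k : R * R -> R * R, (Iinfty w f g B j <= Iinfty w f g B k)%E) :
  exists (zeta : R * R -> R) (G : R * R -> R * R),
    [/\ admissible w f g zeta G,
        forall (xi : R * R -> R) (X : R * R -> R * R),
          admissible w f g xi X ->
          Einfty w f g F zeta G <= Einfty w f g F xi X
      & {ae leb2, forall x, w x ->
          j x = B x - (thickness f g x)^-1 *: perp (G x)}].
Proof.
have [ow _ w0 bw _] := hw.
have [fe sf ffe] := hf; have [ge sg gge] := hg.
have [be1 sb1 bbe1] := hB1; have [be2 sb2 bbe2] := hB2.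
have clw x : w x -> closure w x by exact: subset_closure.
have fE x : w x -> f x = fe x by move=> /clw; exact: ffe.
have gE x : w x -> g x = ge x by move=> /clw; exact: gge.
have b1E x : w x -> (B x).1 = be1 x by move=> /clw; exact: bbe1.
have b2E x : w x -> (B x).2 = be2 x by move=> /clw; exact: bbe2.
have cf := smooth_continuous sf; have cg := smooth_continuous sg.
have fge x : closure w x -> fe x < ge x by move=> cx; rewrite -ffe// -gge// hfg.
have [al [al0 alw]] := continuous_gap bw w0 cf cg fge.
have alw' x : w x -> al <= g x - f x by move=> wx; rewrite fE// gE// alw.
have [c1 [c1p fc1]] := continuous_bounded_on bw cf fE.
have [c2 [c2p gc2]] := continuous_bounded_on bw cg gE.
have fc x : w x -> `|f x| <= c1 + c2 by move=> wx; have := fc1 x wx; lra.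
have gc x : w x -> `|g x| <= c1 + c2 by move=> wx; have := gc2 x wx; lra.
have LB1 := continuous_on_L2 ow bw (smooth_continuous sb1) b1E.
have LB2 := continuous_on_L2 ow bw (smooth_continuous sb2) b2E.
have [Fe sF FE] := effective_field_smooth H1 H2 H3 ow sf sg fE gE.
have LF := continuous_on_L2 ow bw (smooth_continuous sF) FE.
have [N [N0 Nle jmin]] :=
  minimizer_inequalities ow bw sf sg fE gE al0 alw' fc gc LB1 LB2 hj hmin.
have [Lj1 Lj2] := Zspace_L2 ow cf cg fE gE al0 alw' hj.
have sa : smooth (fun x => ge x - fe x) by exact: smoothB.
have aE x : w x -> thickness f g x = ge x - fe x.
  by move=> wx; rewrite /thickness fE// gE.
have [ca [_ abe]] := continuous_bounded_on bw (smooth_continuous sa) aE.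
have [zeta [G [adm zmin jE]]] := potential_minimizer ow bw sa aE al0 alw' abe
  LB1 LB2 LF Lj1 Lj2 hcurl N0 Nle jmin (fun=> erefl).
exists zeta, G; split=> //; apply: aeW => x wx.
by have := jE x wx; rewrite -!surjective_pairing.
Qed.
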